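(* Let $(M,\tau)$ and $(B,\phi)$ be tracial von Neumann algebras with $B$ finite dimensional. For any finitely generated unital $*$-subalgebra $A\subset M$, one has \[ \sigma(A\otimes B,\tau\otimes\phi)=\sigma(A,\tau)+\sigma(B,\phi)-\sigma(A,\tau)\,\sigma(B,\phi). \]
   Context: A tracial von Neumann algebra $(M,\tau)$ is a finite von Neumann algebra $M$ with a faithful normal tracial state $\tau$. $M^\circ$ is the opposite algebra with trace $\tau^\circ$, and $M\bar\otimes M^\circ$ carries the trace $\tau\otimes\tau^\circ$. For a unital $*$-subalgebra $A\subset M$, $L^2(A\otimes A^\circ,\tau\otimes\tau^\circ)$ is the closure of $A\otimes A^\circ$ in $L^2(M\bar\otimes M^\circ,\tau\otimes\tau^\circ)$ and $(A\otimes A^\circ)''$ is the von Neumann algebra generated by $A\otimes A^\circ$. This Hilbert space is an $A$-$A$ bimodule via $x\cdot\xi\cdot y=(x\otimes y^\circ)\xi$, and has the commuting right action of $(A\otimes A^\circ)''$ by right multiplication. A derivation is a linear map $\delta\colon A\to L^2(A\otimes A^\circ,\tau\otimes\tau^\circ)$ with $\delta(xy)=x\cdot\delta(y)+\delta(x)\cdot y$. Finitely generated means generated as a unital $*$-algebra by a finite set. $\mathrm{Der}_{1\otimes1}(A,\tau)$ is the space of derivations $\delta$ such that $1\otimes1\in\mathrm{dom}(\delta^* )$, where $\delta$ is viewed as a densely defined operator $L^2(A,\tau)\to L^2(A\otimes A^\circ,\tau\otimes\tau^\circ)$. If $X=X^*$ is a finite generating set of $A$, then $\phi_X(\delta)=(\delta(x))_{x\in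 X}$ is an injective right $(A\otimes A^\circ)''$-linear map with closed range from the space of all derivations on $A$ into $L^2(A\otimes A^\circ,\tau\otimes\tau^\circ)^X$, giving the norm $\|\delta\|_X=(\sum_{x\in X}\|\delta(x)\|^2)^{1/2}$; the topology is independent of $X$, and closures are taken in it. The free Stein dimension is \[\sigma(A,\tau)=\dim\overline{\mathrm{Der}_{1\otimes1}(A,\tau)}_{(A\otimes A^\circ)''},\] the von Neumann dimension (with respect to $\tau\otimes\tau^\circ$) of the right Hilbert $(A\otimes A^\circ)''$-module $\phi_X\big(\overline{\mathrm{Der}_{1\otimes1}(A,\tau)}\big)\subset L^2(A\otimes A^\circ,\tau\otimes\tau^\circ)^X$; it does not depend on $X$. *)

(* Defs.v *)
(* Built on MathComp and MathComp-Analysis. *)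
From mathcomp Require Import all_boot all_order all_algebra finmap.
From mathcomp Require Import complex.
From mathcomp Require Import all_classical all_reals topology normedtype.
Set Implicit Arguments.
Unset Strict Implicit.
Unset Printing Implicit Defensive.
Import Order.TTheory GRing.Theory Num.Theory.
Import numFieldNormedType.Exports.
Local Open Scope classical_set_scope.
Local Open Scope ring_scope.
Local Open Scope complex_scope.

(* Inner products are linear in the first variable. *)
Record hilbertType (R : realType) := Hilbert {
  hilbert_space :> completeNormedModType R[i];
  hdot : {dot hilbert_space for Num.conj};
  hdot_norm : forall u, hdot u u = `|u| ^+ 2
}.

Notation "''[' u , v ]" := (hdot _ u v)
  (at level 0, format "''[' u ,  v ]") : ring_scope.

Section Operators.
Context {R : realType} {H : hilbertType R}.

Definition bounded_op (T : H -> H) : Prop :=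
  (forall a u v, T (a *: u + v) = a *: T u + T v) /\ continuous T.

Definition commutant (S : set (H -> H)) : set (H -> H) :=
  [set T | bounded_op T /\ forall s, S s -> T \o s = s \o T].

End Operators.

Section Functionals.
Context {R : realType} {M : algType R[i]} {K : hilbertType R}.
Implicit Types (rep : M -> K -> K) (tau : M -> R[i]) (x : M).

(* 0 <= x as an operator *)
Definition op_ge0 rep x : Prop := forall xi : K, 0 <= '[rep x xi, xi].

Definition op_le rep x y : Prop := op_ge0 rep (y - x).

Definition positive_functional rep tau : Prop :=
  forall x, op_ge0 rep x -> 0 <= tau x.

Definition faithful rep tau : Prop :=
  forall x, op_ge0 rep x -> tau x = 0 -> x = 0.

(* tau (sup D) = sup (tau D) for every nonempty upward directed set D of
   positive elements that has a supremum *)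
Definition normal rep tau : Prop :=
  forall (D : set M) (s : M),
    D !=set0 ->
    (forall d, D d -> op_ge0 rep d) ->
    (forall d1 d2, D d1 -> D d2 ->
       exists d3, [/\ D d3, op_le rep d1 d3 & op_le rep d2 d3]) ->
    (forall d, D d -> op_le rep d s) ->
    (forall t, (forall d, D d -> op_le rep d t) -> op_le rep s t) ->
    forall e : R[i], 0 < e -> exists2 d, D d & tau s - tau d < e.

End Functionals.

(* A unital *-algebra together with a faithful representation on a Hilbert
   space whose image is its own bicommutant, and a faithful normal tracial
   state. Finiteness of the algebra follows from the existence of the trace;
   the laws of the involution follow from [vn_repI] and [vn_rep_star]. *)
Record tracialVNA (R : realType) := TracialVNA {
  vn_alg :> algType R[i];
  vn_star : vn_alg -> vn_alg;
  vn_space : hilbertType R;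
  vn_rep : vn_alg -> vn_space -> vn_space;
  vn_rep_bounded : forall x, bounded_op (vn_rep x);
  vn_rep_linear : forall a x y xi,
    vn_rep (a *: x + y) xi = a *: vn_rep x xi + vn_rep y xi;
  vn_rep1 : forall xi, vn_rep 1 xi = xi;
  vn_repM : forall x y xi, vn_rep (x * y) xi = vn_rep x (vn_rep y xi);
  vn_rep_star : forall x xi eta,
    '[vn_rep x xi, eta] = '[xi, vn_rep (vn_star x) eta];
  vn_repI : injective vn_rep;
  vn_bicommutant : commutant (commutant (range vn_rep)) = range vn_rep;
  vn_tau : vn_alg -> R[i];
  vn_tau_linear : forall a x y, vn_tau (a *: x + y) = a * vn_tau x + vn_tau y;
  vn_tau1 : vn_tau 1 = 1;
  vn_tau_ge0 : positive_functional vn_rep vn_tau;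
  vn_tau_faithful : faithful vn_rep vn_tau;
  vn_tau_normal : normal vn_rep vn_tau;
  vn_tau_tracial : forall x y, vn_tau (x * y) = vn_tau (y * x)
}.

Section TracialVNA.
Context {R : realType}.
Implicit Types M P Q : tracialVNA R.

Definition finite_dimensional M : Prop :=
  exists (n : nat) (b : 'I_n -> M), forall x : M,
    exists c : 'I_n -> R[i], x = \sum_k c k *: b k.

Definition unital_star_subalgebra M (A : set M) : Prop :=
  [/\ A 1,
      forall (a : R[i]) x y, A x -> A y -> A (a *: x + y),
      forall x y, A x -> A y -> A (x * y) &
      forall x, A x -> A (vn_star x)].

Definition star_algebra_gen M (F : set M) : set M :=
  [set x | forall S, unital_star_subalgebra S -> F `<=` S -> S x].

Definition finitely_generated M (A : set M) : Prop :=
  exists F : {fset M}, A = star_algebra_gen [set` F].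

(* X = X^* is a finite generating set of A. *)
Definition sa_generating M (A : set M) (X : {fset M}) : Prop :=
  (forall x, x \in X -> vn_star x \in X) /\ A = star_algebra_gen [set` X].

Definition star_hom M Q (f : M -> Q) : Prop :=
  [/\ forall a x y, f (a *: x + y) = a *: f x + f y,
      f 1 = 1,
      forall x y, f (x * y) = f x * f y &
      forall x, f (vn_star x) = vn_star (f x)].

(* (Q, tau_Q) is the von Neumann algebra tensor product of M and P with the
   product trace, i x and j y being x (x) 1 and 1 (x) y. By uniqueness of the
   GNS construction these conditions determine (Q, i, j) up to a unique
   trace-preserving *-isomorphism. *)
Definition is_vn_tensor M P Q (i : M -> Q) (j : P -> Q) : Prop :=
  [/\ star_hom i /\ star_hom j,
      forall x y, i x * j y = j y * i x,
      forall x y, vn_tau (i x * j y) = vn_tau x * vn_tau y &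
      range (@vn_rep R Q) =
        commutant (commutant
          (@vn_rep R Q @` (range i `|` range j)))].

(* The linear span of the i x * j y, that is, the algebraic tensor product of
   A and B inside the von Neumann algebra tensor product. *)
Definition alg_tensor M P Q (i : M -> Q) (j : P -> Q)
    (A : set M) (B : set P) : set Q :=
  [set z | exists (n : nat) (a : 'I_n -> M) (b : 'I_n -> P),
    [/\ forall k, A (a k), forall k, B (b k) & z = \sum_k i (a k) * j (b k)]].

(* (P, tau_P) is the opposite of (M, tau_M), with op x standing for x°. *)
Definition is_opposite M P (op : M -> P) : Prop :=
  [/\ forall a x y, op (a *: x + y) = a *: op x + op y,
      bijective op,
      forall x y, op (x * y) = op y * op x,
      forall x, op (vn_star x) = vn_star (op x) &
      forall x, vn_tau (op x) = vn_tau x].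

(* The GNS space L^2(Q, tau_Q); [l2_act] is the extension by continuity of left
   multiplication. *)
Record L2space Q := L2Space {
  l2_space :> hilbertType R;
  l2_hat : Q -> l2_space;
  l2_hat_linear : forall a x y, l2_hat (a *: x + y) = a *: l2_hat x + l2_hat y;
  l2_hat_dot : forall x y, '[l2_hat x, l2_hat y] = vn_tau (vn_star y * x);
  l2_hat_dense : dense (range l2_hat);
  l2_act : Q -> l2_space -> l2_space;
  l2_act_bounded : forall x, bounded_op (l2_act x);
  l2_act_hat : forall x y, l2_act x (l2_hat y) = l2_hat (x * y)
}.

(* A realisation of M°, of M (x) M° (von Neumann algebra tensor product) and of
   L^2(M (x) M°, tau (x) tau°). Each is unique up to isomorphism. *)
Record enveloping M := Enveloping {
  env_op : tracialVNA R;
  env_opp : M -> env_op;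
  env_oppP : is_opposite env_opp;
  env_alg : tracialVNA R;
  env_inl : M -> env_alg;
  env_inr : env_op -> env_alg;
  env_tensorP : is_vn_tensor env_inl env_inr;
  env_L2 : L2space env_alg
}.

End TracialVNA.

Section HilbertSums.
Context {R : realType} {H : hilbertType R} {X : finType}.
Implicit Types (v w : {ffun X -> H}) (K : set {ffun X -> H}).

Definition sum_dot v w : R[i] := \sum_x '[v x, w x].

(* Orthogonal projection onto a closed subspace K of H^X. *)
Definition sum_proj K v : {ffun X -> H} :=
  xget 0 [set w | K w /\ forall k, K k -> sum_dot (v - w) k = 0].

Definition sum_basis (o : H) (x : X) : {ffun X -> H} :=
  [ffun y => if y == x then o else 0].

(* Let H contain L^2(N, tau) for a tracial von Neumann algebra N with trace
   vector o = \hat 1, and let K be a closed right N-submodule of L^2(N, tau)^X.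
   The projection onto K commutes with the right action of N, hence is (left
   multiplication by) a matrix p in M_X(N), and
   dim_N K = (Tr (x) tau) p = \sum_x <p e_x, e_x>, where e_x is o in
   coordinate x. The algebra N only enters through its trace vector. *)
Definition vn_dim (o : H) K : R :=
  complex.Re (\sum_x sum_dot (sum_proj K (sum_basis o x)) (sum_basis o x)).

End HilbertSums.

Section FreeSteinDimension.
Context {R : realType} {M : tracialVNA R} (E : enveloping M) (A : set M).
Local Notation H := (env_L2 E).

(* x (x) y° *)
Definition env_tensor (x y : M) : env_alg E :=
  env_inl E x * env_inr (env_opp E y).

Definition env_sub : set (env_alg E) :=
  alg_tensor (@env_inl R M E) (@env_inr R M E) A (@env_opp R M E @` A).

(* L^2(A (x) A°, tau (x) tau°) *)
Definition env_L2_sub : set H := closure (@l2_hat R _ H @` env_sub).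

(* x . xi . y = (x (x) y°) xi *)
Definition bimod_act (x : M) (xi : H) (y : M) : H :=
  l2_act (env_tensor x y) xi.

(* 1 (x) 1 *)
Definition env_one : H := l2_hat H 1.

(* Only the values of delta on A matter. *)
Definition derivation (delta : M -> H) : Prop :=
  [/\ forall x, A x -> env_L2_sub (delta x),
      forall (a : R[i]) x y, A x -> A y ->
        delta (a *: x + y) = a *: delta x + delta y &
      forall x y, A x -> A y ->
        delta (x * y) = bimod_act x (delta y) 1 + bimod_act 1 (delta x) y].

(* zeta lies in the domain of the adjoint of delta, seen as an operator on
   L^2(A, tau) with domain A: x |-> <delta x, zeta> is bounded for the norm
   of L^2(A, tau). *)
Definition dom_adjoint (delta : M -> H) (zeta : H) : Prop :=
  exists c : R[i], forall x, A x ->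
    `|'[delta x, zeta]| <= c * sqrtC (vn_tau (vn_star x * x)).

Definition Der11 : set (M -> H) :=
  [set delta | derivation delta /\ dom_adjoint delta env_one].

Definition phi (X : {fset M}) (delta : M -> H) : {ffun X -> H} :=
  [ffun x => delta (val x)].

(* Square of the norm ||delta||_X. *)
Definition der_norm2 (X : {fset M}) (delta : M -> H) : R[i] :=
  \sum_(x : X) `|delta (val x)| ^+ 2.

Definition Der11_closure (X : {fset M}) : set (M -> H) :=
  [set delta | derivation delta /\
    forall e : R[i], 0 < e ->
      exists2 delta', Der11 delta' & der_norm2 X (delta \- delta') < e].

Definition stein_dim_on (X : {fset M}) : R :=
  vn_dim env_one (phi X @` Der11_closure X).

(* The free Stein dimension of A; [stein_dim_on X] does not depend on the
   self-adjoint finite generating set X, and one is chosen. *)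
Definition stein_dim : R :=
  xget 0 [set s | exists2 X, sa_generating A X & s = stein_dim_on X].

End FreeSteinDimension.

(* Main.v *)
(* Let p in B (x) B° be the separability idempotent of B that projects
   L^2(B (x) B°) onto the B-central vectors. A derivation of A (x) B is, in a
   unique way, [., xi] + delta' with p xi = 0 and delta' zero on B; then delta'
   maps A to B-central vectors. Inner derivations lie in the closure of
   Der_{1 (x) 1}, so this closure is, for A (x) B, the direct sum of
   (1 - p) L^2 and of the closure for A tensored with p L^2(B (x) B°). Its
   dimension is 1 - tau p + sigma(A) tau p, and the same splitting applied to B
   alone gives sigma(B) = 1 - tau p.
   The splitting is only a bounded isomorphism of modules. It preserves the
   dimension because Tr (S T) = Tr (T S) for bounded operators that commute with
   the right action of the algebraic tensor product. *)
Require Import Defs.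
From mathcomp Require Import all_boot all_order all_algebra finmap.
From mathcomp Require Import complex.
From mathcomp Require Import all_classical all_reals topology normedtype.
From mathcomp Require Import ring lra.
Set Implicit Arguments.
Unset Strict Implicit.
Unset Printing Implicit Defensive.
Import Order.TTheory GRing.Theory Num.Theory.
Import numFieldNormedType.Exports.
Local Open Scope classical_set_scope.
Local Open Scope ring_scope.
Local Notation "x %:C" := (real_complex_def (Phant _) x) : ring_scope.

(** * Inner product spaces and Hilbert spaces *)

(** Two obstacles shape the proof. The values lie in L^2(A (x) A°), a closed subspace of L^2(M (x)
    M°) on which only the algebraic tensor product is used; and the L^2 space of the enveloping
    algebra of M (x) B is never identified with a Hilbert space tensor product. So dimensions are
    computed from explicit projections of trace vectors. For the part that vanishes on B, let U be
    xi |-> xi (x) 1 and P the projection for A. The projection of the trace vector at a generator x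
    is then p U (P e_x): extending derivations from A to A (x) B puts it in the closure, and slicing
    back by the adjoint of U makes the remainder orthogonal to the closure. The factor tau p appears
    because U L^2 and B (x) B° are independent for the trace. The idempotent p comes from the
    Casimir tensor of an orthonormal basis b_s of B, the sum of the b_s (x) b_s^*, divided by the
    central invertible element obtained by multiplying its two legs. This makes no use of the
    classification of finite dimensional algebras as sums of matrix algebras. *)

Definition cabs (R : realType) (z : R[i]) : R := complex.Re `|z|.

Section ComplexModulus.
Context {R : realType}.
Implicit Types (z w : R[i]) (a b : R).

Lemma cabsE z : (cabs z)%:C = `|z|.
Proof. by rewrite /cabs RRe_real // normr_real. Qed.

Lemma cabs_ge0 z : 0 <= cabs z.
Proof. by rewrite -lecR cabsE; exact: normr_ge0. Qed.

Lemma cabsM z w : cabs (z * w) = cabs z * cabs w.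
Proof. by apply: complexI; rewrite rmorphM /= !cabsE normrM. Qed.

Lemma cabsD z w : cabs (z + w) <= cabs z + cabs w.
Proof. by rewrite -lecR rmorphD /= !cabsE ler_normD. Qed.

Lemma cabs_eq0 z : (cabs z == 0) = (z == 0).
Proof. by rewrite -(inj_eq (@complexI R)) cabsE normr_eq0. Qed.

Lemma cabs0 : cabs (0 : R[i]) = 0.
Proof. by apply/eqP; rewrite cabs_eq0. Qed.

Lemma cabs_conj z : cabs z^* = cabs z.
Proof. by apply: complexI; rewrite !cabsE norm_conjC. Qed.

Lemma cabsN z : cabs (- z) = cabs z.
Proof. by apply: complexI; rewrite !cabsE normrN. Qed.

Lemma cabs_sum (I : Type) (r : seq I) (P : pred I) (F : I -> R[i]) :
  cabs (\sum_(k <- r | P k) F k) <= \sum_(k <- r | P k) cabs (F k).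
Proof.
elim/big_rec2: _ => [|k x y _ h]; first by rewrite cabs0.
by rewrite (le_trans (cabsD _ _)) // lerD2l.
Qed.

Lemma ge0_ReE z : 0 <= z -> (complex.Re z)%:C = z.
Proof. by move=> z0; rewrite RRe_real // ger0_real. Qed.

Lemma Re_ge0 z : 0 <= z -> 0 <= complex.Re z.
Proof. by move=> z0; rewrite -lecR ge0_ReE. Qed.

Lemma ReD z w : complex.Re (z + w) = complex.Re z + complex.Re w.
Proof. by case: z => ? ?; case: w. Qed.

Lemma ReN z : complex.Re (- z) = - complex.Re z.
Proof. by case: z. Qed.

Lemma ReRM a z : complex.Re (a%:C * z) = a * complex.Re z.
Proof. by case: z => x y /=; rewrite mul0r subr0. Qed.

Lemma Re_conj z : complex.Re z^* = complex.Re z.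
Proof. by case: z. Qed.

Lemma conj_real a : (a%:C)^* = a%:C :> R[i].
Proof. by rewrite conj_Creal // complex_real. Qed.

Lemma cabs_real a : cabs a%:C = `|a|.
Proof.
by apply: complexI; rewrite cabsE normc_def /= expr0n /= addr0 sqrtr_sqr.
Qed.

Lemma mul_conj z : z * z^* = ((cabs z) ^+ 2)%:C.
Proof. by rewrite rmorphXn /= cabsE normCK. Qed.

Lemma Re_le_cabs z : complex.Re z <= cabs z.
Proof.
by rewrite (le_trans (ler_norm _)) // -lecR cabsE normc_ge_Re.
Qed.

End ComplexModulus.

(** Definiteness is kept apart, so that the same lemmas serve [hdot], [sum_dot] and the trace form
    [tau_form]; it is supplied where uniqueness depends on it. *)
Record inner_product (R : realType) (V : lmodType R[i]) (q : V -> V -> R[i]) :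
    Prop := InnerProduct {
  ip_linear : forall a u v w, q (a *: u + v) w = a * q u w + q v w;
  ip_conj : forall u v, q u v = (q v u)^*;
  ip_ge0 : forall u, 0 <= q u u }.

(** The norm of a complex normed module takes values in R[i]; this real version makes order
    arguments in R available. *)
Definition ipnorm (R : realType) (V : lmodType R[i]) (q : V -> V -> R[i])
  (v : V) : R := Num.sqrt (complex.Re (q v v)).

Section InnerProduct.
Context {R : realType} {V : lmodType R[i]} (q : V -> V -> R[i]).
Hypothesis hq : inner_product q.
Implicit Types (u v w : V) (a : R[i]) (K : set V).
Local Notation N := (ipnorm q).

Lemma ip_Dl u v w : q (u + v) w = q u w + q v w.
Proof. by rewrite -{1}[u]scale1r (ip_linear hq) mul1r. Qed.

Lemma ip_0l w : q 0 w = 0.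
Proof. by apply: (addrI (q 0 w)); rewrite -ip_Dl !addr0. Qed.

Lemma ip_Zl a u w : q (a *: u) w = a * q u w.
Proof. by rewrite -[a *: u]addr0 (ip_linear hq) ip_0l addr0. Qed.

Lemma ip_Nl u w : q (- u) w = - q u w.
Proof. by rewrite -scaleN1r ip_Zl mulN1r. Qed.

Lemma ip_Bl u v w : q (u - v) w = q u w - q v w.
Proof. by rewrite ip_Dl ip_Nl. Qed.

Lemma ip_Dr u v w : q w (u + v) = q w u + q w v.
Proof. by rewrite (ip_conj hq w (u + v)) ip_Dl rmorphD /= -!(ip_conj hq). Qed.

Lemma ip_0r w : q w 0 = 0.
Proof. by rewrite (ip_conj hq) ip_0l rmorph0. Qed.

Lemma ip_Zr a u w : q w (a *: u) = a^* * q w u.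
Proof. by rewrite (ip_conj hq w (a *: u)) ip_Zl rmorphM /= -(ip_conj hq). Qed.

Lemma ip_Nr u w : q w (- u) = - q w u.
Proof. by rewrite (ip_conj hq w (- u)) ip_Nl rmorphN /= -(ip_conj hq). Qed.

Lemma ipnorm_ge0 v : 0 <= N v.
Proof. exact: sqrtr_ge0. Qed.

Lemma ipnormK v : N v ^+ 2 = complex.Re (q v v).
Proof. by rewrite sqr_sqrtr // Re_ge0 // ip_ge0. Qed.

Lemma ipnormKC v : (N v ^+ 2)%:C = q v v.
Proof. by rewrite ipnormK ge0_ReE // ip_ge0. Qed.

Lemma ipnormZ a v : N (a *: v) = cabs a * N v.
Proof.
rewrite /ipnorm ip_Zl ip_Zr mulrA mul_conj ReRM sqrtrM ?sqr_ge0 //.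
by rewrite sqrtr_sqr ger0_norm // cabs_ge0.
Qed.

Lemma ipnorm0 : N 0 = 0.
Proof. by rewrite /ipnorm ip_0l sqrtr0. Qed.

Lemma ipnormN v : N (- v) = N v.
Proof. by rewrite /ipnorm ip_Nl ip_Nr opprK. Qed.

Lemma ipnormBC u v : N (u - v) = N (v - u).
Proof. by rewrite -ipnormN opprB. Qed.

Lemma ipnorm_sqrD u v :
  N (u + v) ^+ 2 = N u ^+ 2 + 2 * complex.Re (q u v) + N v ^+ 2.
Proof.
rewrite !ipnormK ip_Dl !ip_Dr !ReD (ip_conj hq v u) Re_conj; lra.
Qed.

Lemma ipnorm_sqrB u v :
  N (u - v) ^+ 2 = N u ^+ 2 - 2 * complex.Re (q u v) + N v ^+ 2.
Proof. by rewrite ipnorm_sqrD ip_Nr ReN ipnormN mulrN. Qed.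

Lemma cauchy_schwarz u v : cabs (q u v) <= N u * N v.
Proof.
set b := cabs (q u v).
have b0 : 0 <= b by exact: cabs_ge0.
(* The multiplier of v contains <u, v> itself, which absorbs its phase: only |<u, v>|^2 and a real
   quadratic in s remain. *)
have key (s : R) : 0 <= N u ^+ 2 - 2 * s * b ^+ 2 + s ^+ 2 * b ^+ 2 * N v ^+ 2.
  have := sqr_ge0 (N (u - (s%:C * q u v) *: v)).
  rewrite ipnorm_sqrB ip_Zr rmorphM /= conj_real -mulrA [_^* * _]mulrC mul_conj ReRM.
  rewrite -/b /= ipnormZ cabsM -/b.
  rewrite cabs_real.
  rewrite !exprMn real_normK ?num_real // => h; lra.
rewrite -(@ler_pXn2r _ 2) ?nnegrE ?mulr_ge0 ?ipnorm_ge0 // exprMn.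
have A0 := sqr_ge0 (N u); have B0 := sqr_ge0 (N v); have C0 := sqr_ge0 b.
move: key A0 B0 C0; move: (N u ^+ 2) (N v ^+ 2) (b ^+ 2) => x y z key x0 y0 z0.
have [->|zn] := eqVneq z 0; first exact: mulr_ge0.
have zp : 0 < z by rewrite lt0r zn.
have [y00|yn] := eqVneq y 0.
  (* If v has norm 0, this s makes the quadratic equal to -1. *)
  have := key ((x + 1) / (2 * z)); rewrite y00 mulr0 addr0.
  have -> : 2 * ((x + 1) / (2 * z)) * z = x + 1 by field.
  lra.
have yp : 0 < y by rewrite lt0r yn.
(* The minimiser of the quadratic. *)
have := key y^-1.
have -> : x - 2 * y^-1 * z + y^-1 ^+ 2 * z * y = x - z / y by field.
by rewrite subr_ge0 ler_pdivrMr.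
Qed.

Lemma ipnormD u v : N (u + v) <= N u + N v.
Proof.
rewrite -(@ler_pXn2r _ 2) ?nnegrE ?addr_ge0 ?ipnorm_ge0 //.
rewrite ipnorm_sqrD sqrrD.
have := le_trans (Re_le_cabs _) (cauchy_schwarz u v); lra.
Qed.

Lemma ipnormB u v : N (u - v) <= N u + N v.
Proof. by rewrite (le_trans (ipnormD _ _)) // ipnormN. Qed.

Lemma ipnorm_dist v u w : N (u - w) <= N (u - v) + N (v - w).
Proof. by rewrite -[u - w](subrKA v) ipnormD. Qed.

Lemma ipnorm_parallelogram u v :
  N (u + v) ^+ 2 + N (u - v) ^+ 2 = 2 * (N u ^+ 2 + N v ^+ 2).
Proof. rewrite ipnorm_sqrD ipnorm_sqrB; lra. Qed.

End InnerProduct.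

Definition cauchy_for (R : realType) (V : zmodType) (N : V -> R)
    (u : nat -> V) : Prop :=
  forall e : R, 0 < e ->
    exists n0, forall n m, (n0 <= n)%N -> (n0 <= m)%N -> N (u n - u m) < e.

Definition cvg_for (R : realType) (V : zmodType) (N : V -> R)
    (u : nat -> V) (l : V) : Prop :=
  forall e : R, 0 < e -> exists n0, forall n, (n0 <= n)%N -> N (u n - l) < e.

(** Sequential and relative to a real-valued N, so that it applies to subspaces of [{ffun X -> H}]
    and to images of spaces of derivations, which carry no topology of their own here. *)
Definition complete_for (R : realType) (V : zmodType) (N : V -> R)
    (K : set V) : Prop :=
  forall u, (forall n, K (u n)) -> cauchy_for N u -> exists2 l, K l & cvg_for N u l.

Definition submodule (R : realType) (V : lmodType R[i]) (K : set V) : Prop :=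
  K 0 /\ forall (a : R[i]) u v, K u -> K v -> K (a *: u + v).

Section Submodule.
Context {R : realType} {V : lmodType R[i]} (K : set V).
Hypothesis hK : submodule K.

Lemma submoduleD u v : K u -> K v -> K (u + v).
Proof. by move=> hu hv; rewrite -[u]scale1r; apply: (proj2 hK). Qed.

Lemma submoduleZ a u : K u -> K (a *: u).
Proof. by move=> hu; rewrite -[_ *: _]addr0; apply: (proj2 hK) => //; case: hK. Qed.

Lemma submoduleN u : K u -> K (- u).
Proof. by move=> hu; rewrite -scaleN1r; apply: submoduleZ. Qed.

Lemma submoduleB u v : K u -> K v -> K (u - v).
Proof. by move=> hu hv; apply: submoduleD => //; apply: submoduleN. Qed.

Lemma submodule_sum (I : Type) (r : seq I) (F : I -> V) :
  (forall k, K (F k)) -> K (\sum_(k <- r) F k).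
Proof.
move=> h; elim: r => [|k r ih]; first by rewrite big_nil; case: hK.
by rewrite big_cons; apply: submoduleD.
Qed.

End Submodule.

(** * Orthogonal projection onto a complete subspace *)

Section Projection.
Context {R : realType} {V : lmodType R[i]} (q : V -> V -> R[i]).
Hypothesis hq : inner_product q.
Context (K : set V).
Hypotheses (hK : submodule K) (cK : complete_for (ipnorm q) K).
Local Notation N := (ipnorm q).

(** Moving w in the direction of <v - w, k> k by a small real s would lower the distance. *)
Lemma min_dist_orthogonal v w : K w ->
  (forall k, K k -> N (v - w) <= N (v - k)) -> forall k, K k -> q (v - w) k = 0.
Proof.
move=> Kw hmin k Kk; set u := v - w; set b := cabs (q u k).
have key (s : R) : 0 <= - (2 * s * b ^+ 2) + s ^+ 2 * b ^+ 2 * N k ^+ 2.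
  have := hmin (w + (s%:C * q u k) *: k) (submoduleD hK Kw (submoduleZ hK _ Kk)).
  rewrite opprD addrA -/u -(@ler_pXn2r _ 2) ?nnegrE ?ipnorm_ge0 //.
  rewrite (ipnorm_sqrB hq u) ip_Zr // rmorphM /= conj_real -mulrA [_^* * _]mulrC mul_conj.
  rewrite ReRM -/b /= ipnormZ // cabsM -/b.
  rewrite cabs_real.
  rewrite !exprMn real_normK ?num_real // => h; lra.
have C0 := sqr_ge0 b; have B0 := sqr_ge0 (N k).
have [z0|zn] := eqVneq (b ^+ 2) 0.
  by apply/eqP; rewrite -cabs_eq0 -/b; move/eqP: z0; rewrite sqrf_eq0.
move: key C0 B0 zn; move: (N k ^+ 2) (b ^+ 2) => y z key z0 y0 zn.
have zp : 0 < z by rewrite lt0r zn.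
have yp : 0 < y + 1 by lra.
(* Using y + 1 instead of y covers the case where k has norm 0. *)
have := key (y + 1)^-1.
have -> : - (2 * (y + 1)^-1 * z) + (y + 1)^-1 ^+ 2 * z * y =
    - (z / (y + 1) + z / (y + 1) ^+ 2) by field; lra.
rewrite oppr_ge0 => h.
exfalso; have := divr_gt0 zp yp; have := divr_gt0 zp (exprn_gt0 2 yp); lra.
Qed.

Lemma min_dist_exists v : exists2 w, K w & forall k, K k -> N (v - w) <= N (v - k).
Proof.
pose S := [set d : R | exists2 k, K k & d = N (v - k) ^+ 2].
have S0 : S !=set0 by exists (N (v - 0) ^+ 2); exists 0 => //; case: hK.
have lbS : has_lbound S by exists 0 => d [k _ ->]; exact: sqr_ge0.
pose d := inf S.
have dle k : K k -> d <= N (v - k) ^+ 2.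
  by move=> Kk; apply: ge_inf => //; exists k.
have d0 : 0 <= d by apply: lb_le_inf => // x [k _ ->]; exact: sqr_ge0.
have /choice[k hk] (n : nat) :
    exists k, K k /\ N (v - k) ^+ 2 < d + n.+1%:R^-1.
  have n0 : 0 < n.+1%:R^-1 :> R by rewrite invr_gt0 ltr0n.
  have [x [k Kk ->] hx] := inf_adherent n0 (conj S0 lbS).
  by exists k.
(* The midpoint of k n and k m is in K, hence at squared distance at least d from v; the
   parallelogram law then bounds the distance of k n and k m. *)
have parl n m : N (k n - k m) ^+ 2 <= 2 * (n.+1%:R^-1 + m.+1%:R^-1).
  have [Kn hn] := hk n; have [Km hm] := hk m.
  have mid : d <= N (v - (2^-1)%:C *: (k n + k m)) ^+ 2.
    by apply: dle; apply: (submoduleZ hK); apply: (submoduleD hK).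
  have := ipnorm_parallelogram hq (v - k m) (v - k n).
  have -> : v - k m + (v - k n) = 2%:C *: (v - (2^-1)%:C *: (k n + k m)).
    have e1 : 2%:C * (2^-1)%:C = 1 :> R[i].
      by rewrite -rmorphM /= divff ?pnatr_eq0.
    rewrite scalerBr scalerA e1 scale1r rmorphD scalerDl !scale1r opprD.
    by rewrite addrACA [- k m + _]addrC.
  rewrite ipnormZ // exprMn.
  have -> : v - k m - (v - k n) = k n - k m by rewrite opprB addrC subrKA.
  rewrite cabs_real ger0_norm //.
  move: hn hm mid; move: n.+1%:R^-1 m.+1%:R^-1 => a b; lra.
have small e : 0 < e -> exists n0, forall n, (n0 <= n)%N -> n.+1%:R^-1 < e :> R.
  move=> e0; exists (Num.truncn e^-1) => n hn.
  rewrite invf_plt ?posrE ?ltr0n //.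
  apply: (lt_le_trans (truncnS_gt _)); first by rewrite ler_nat.
have cau : cauchy_for N k.
  move=> e e0; have e2 : 0 < e ^+ 2 / 4 by rewrite divr_gt0 // exprn_gt0.
  have [n0 hn0] := small _ e2; exists n0 => n m hn hm.
  rewrite -(@ltr_pXn2r _ 2) ?nnegrE ?ipnorm_ge0 // ?ltW //.
  apply: le_lt_trans (parl n m) _.
  have := hn0 n hn; have := hn0 m hm.
  by move: n.+1%:R^-1 m.+1%:R^-1 => a b; lra.
have [w Kw hw] := cK (fun n => proj1 (hk n)) cau.
exists w => // k' Kk'.
rewrite -(@ler_pXn2r _ 2) ?nnegrE ?ipnorm_ge0 //.
apply: le_trans (dle _ Kk').
rewrite leNgt; apply/negP => hlt.
(* e is the excess of the distance of v and w over sqrt d. It is contradicted by a k n that is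
   within sqrt d + e / 2 of v and within e / 2 of w. *)
have [e e0 he] : exists2 e, 0 < e & N (v - w) = Num.sqrt d + e.
  exists (N (v - w) - Num.sqrt d); last by rewrite subrKC.
  rewrite subr_gt0 -(@ltr_pXn2r _ 2) ?nnegrE ?ipnorm_ge0 ?sqrtr_ge0 //.
  by rewrite sqr_sqrtr.
have e2 : 0 < (e / 2) ^+ 2 by rewrite exprn_gt0 // divr_gt0.
have [n1 h1] := small _ e2.
have [n2 h2] := hw _ (divr_gt0 e0 (ltr0Sn R 1)).
pose n := maxn n1 n2.
have a1 := h1 n (leq_maxl _ _); have a2 := h2 n (leq_maxr _ _).
have a3 : N (v - k n) <= Num.sqrt d + e / 2.
  rewrite -(@ler_pXn2r _ 2) ?nnegrE ?ipnorm_ge0 ?addr_ge0 ?sqrtr_ge0 //; last first.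
    by rewrite divr_ge0 // ltW.
  rewrite sqrrD (sqr_sqrtr d0).
  have := proj2 (hk n); have : 0 <= Num.sqrt d * (e / 2) by rewrite mulr_ge0 ?sqrtr_ge0 // divr_ge0 // ltW.
  move: a1; move: n.+1%:R^-1 (N (v - k n) ^+ 2) => a y; rewrite mulr2n.
  move: ((e / 2) ^+ 2) (_ * (e / 2)) => b c; lra.
have := ipnorm_dist hq (k n) v w; lra.
Qed.

Lemma projection_exists v : exists2 w, K w & forall k, K k -> q (v - w) k = 0.
Proof.
have [w Kw hw] := min_dist_exists v.
by exists w => //; exact: min_dist_orthogonal.
Qed.

(** Convertible to [sum_proj] when q is [sum_dot], so the results proved here apply to it
    directly. *)
Definition ip_proj v : V := xget 0 [set w | K w /\ forall k, K k -> q (v - w) k = 0].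

Lemma ip_projP v : K (ip_proj v) /\ forall k, K k -> q (v - ip_proj v) k = 0.
Proof.
have [w Kw hw] := projection_exists v.
by apply: (@xgetPex _ 0 [set w | K w /\ forall k, K k -> q (v - w) k = 0]); exists w.
Qed.

Hypothesis q_definite : forall v, N v = 0 -> v = 0.

Lemma ip_proj_unique v w : K w -> (forall k, K k -> q (v - w) k = 0) -> ip_proj v = w.
Proof.
move=> Kw hw; have [Kp hp] := ip_projP v; set p := ip_proj v in Kp hp *.
have Kd : K (p - w) by exact: (submoduleB hK).
apply/eqP; rewrite -subr_eq0; apply/eqP/q_definite.
apply/eqP; rewrite -sqrf_eq0; apply/eqP/complexI; rewrite (ipnormKC hq).
rewrite -{1}[p - w](subrKA v) (ip_Dl hq) hw // -opprB (ip_Nl hq) hp //.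
by rewrite oppr0 addr0.
Qed.

Lemma ip_proj_id k : K k -> ip_proj k = k.
Proof. by move=> Kk; apply: ip_proj_unique => // k' _; rewrite subrr (ip_0l hq). Qed.

Lemma ip_proj_linear a u v : ip_proj (a *: u + v) = a *: ip_proj u + ip_proj v.
Proof.
have [Ku hu] := ip_projP u; have [Kv hv] := ip_projP v.
apply: ip_proj_unique; first exact: (proj2 hK).
move=> k Kk; rewrite opprD addrACA -scalerBr (ip_linear hq) hu // hv //.
by rewrite mulr0 addr0.
Qed.

Lemma ip_proj_norm v : N (ip_proj v) <= N v.
Proof.
have [Kp hp] := ip_projP v; set p := ip_proj v in Kp hp *.
rewrite -(@ler_pXn2r _ 2) ?nnegrE ?ipnorm_ge0 //.
by rewrite -[v](subrK p) (ipnorm_sqrD hq) hp // mulr0 addr0 lerDr sqr_ge0.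
Qed.

End Projection.

(** A predicate, because many of the maps below are defined by choice and proved linear
    afterwards. *)
Definition lin (R : realType) (V W : lmodType R[i]) (f : V -> W) : Prop :=
  forall (a : R[i]) u v, f (a *: u + v) = a *: f u + f v.

Section Linear.
Context {R : realType} {V W : lmodType R[i]} (f : V -> W).
Hypothesis hf : lin f.

Lemma linD u v : f (u + v) = f u + f v.
Proof. by have := hf 1 u v; rewrite !scale1r. Qed.

Lemma lin0 : f 0 = 0.
Proof. by apply: (addrI (f 0)); rewrite -linD !addr0. Qed.

Lemma linZ a u : f (a *: u) = a *: f u.
Proof. by have := hf a u 0; rewrite lin0 !addr0. Qed.

Lemma linN u : f (- u) = - f u.
Proof. by rewrite -scaleN1r linZ scaleN1r. Qed.

Lemma linB u v : f (u - v) = f u - f v.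
Proof. by rewrite linD linN. Qed.

Lemma lin_sum (I : Type) (r : seq I) (F : I -> V) :
  f (\sum_(k <- r) F k) = \sum_(k <- r) f (F k).
Proof.
elim: r => [|k r ih]; first by rewrite !big_nil lin0.
by rewrite !big_cons linD ih.
Qed.

End Linear.

Definition lipschitz_for (R : realType) (V W : zmodType) (N : V -> R)
    (N' : W -> R) (f : V -> W) : Prop :=
  exists2 c : R, 0 <= c & forall v, N' (f v) <= c * N v.

Section Hilbert.
Context {R : realType} {H : hilbertType R}.
Implicit Types (u v : H) (S : set H).

Lemma hdot_inner_product : inner_product (hdot H).
Proof.
split.
- by move=> a u v w; rewrite linearPl.
- by move=> u v; rewrite hermC expr0 mul1r.
- by move=> u; rewrite hdot_norm exprn_ge0.
Qed.

Local Notation hip := hdot_inner_product.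

Definition hnorm u : R := ipnorm (hdot H) u.

Lemma hdotDl u v w : '[u + v, w] = '[u, w] + '[v, w].
Proof. exact: ip_Dl hip _ _ _. Qed.
Lemma hdotBl u v w : '[u - v, w] = '[u, w] - '[v, w].
Proof. exact: ip_Bl hip _ _ _. Qed.
Lemma hdotZl a u w : '[a *: u, w] = a * '[u, w].
Proof. exact: ip_Zl hip _ _ _. Qed.
Lemma hdot0l w : '[0 : H, w] = 0.
Proof. exact: ip_0l hip _. Qed.
Lemma hdot_suml (I : Type) (r : seq I) (F : I -> H) w :
  '[\sum_(k <- r) F k, w] = \sum_(k <- r) '[F k, w].
Proof.
elim: r => [|k r ih]; first by rewrite !big_nil hdot0l.
by rewrite !big_cons hdotDl ih.
Qed.
Lemma hdot_conj u v : '[u, v] = ('[v, u])^*.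
Proof. exact: ip_conj hip _ _. Qed.
Lemma hdotDr u v w : '[w, u + v] = '[w, u] + '[w, v].
Proof. exact: ip_Dr hip _ _ _. Qed.
Lemma hdotZr a u w : '[w, a *: u] = a^* * '[w, u].
Proof. exact: ip_Zr hip _ _ _. Qed.
Lemma hdot0r w : '[w, 0 : H] = 0.
Proof. exact: ip_0r hip _. Qed.
Lemma hdot_ge0 u : 0 <= '[u, u].
Proof. exact: ip_ge0 hip _. Qed.
Lemma hnorm_ge0 u : 0 <= hnorm u.
Proof. exact: ipnorm_ge0. Qed.
Lemma hnormKC u : (hnorm u ^+ 2)%:C = '[u, u].
Proof. exact: ipnormKC hip _. Qed.
Lemma hnormZ a u : hnorm (a *: u) = cabs a * hnorm u.
Proof. exact: ipnormZ hip _ _. Qed.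
Lemma hnorm0 : hnorm 0 = 0.
Proof. exact: ipnorm0 hip. Qed.
Lemma hnormN u : hnorm (- u) = hnorm u.
Proof. exact: ipnormN hip _. Qed.
Lemma hnormBC u v : hnorm (u - v) = hnorm (v - u).
Proof. exact: ipnormBC hip _ _. Qed.
Lemma hnormD u v : hnorm (u + v) <= hnorm u + hnorm v.
Proof. exact: ipnormD hip _ _. Qed.
Lemma hnormB u v : hnorm (u - v) <= hnorm u + hnorm v.
Proof. exact: ipnormB hip _ _. Qed.
Lemma hnorm_dist v u w : hnorm (u - w) <= hnorm (u - v) + hnorm (v - w).
Proof. exact: ipnorm_dist hip _ _ _. Qed.
Lemma hnorm_sum (I : Type) (r : seq I) (F : I -> H) :
  hnorm (\sum_(k <- r) F k) <= \sum_(k <- r) hnorm (F k).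
Proof.
elim: r => [|k r ih]; first by rewrite !big_nil hnorm0.
by rewrite !big_cons (le_trans (hnormD _ _)) // lerD2l.
Qed.
Lemma hdot_cs u v : cabs '[u, v] <= hnorm u * hnorm v.
Proof. exact: cauchy_schwarz hip _ _. Qed.

Local Notation nm := hnorm.

Lemma hnormE u : (nm u)%:C = `|u|.
Proof.
have n0 : 0 <= (nm u)%:C by rewrite lecR hnorm_ge0.
apply/eqP; rewrite -(@eqrXn2 _ 2) ?normr_ge0 //.
by rewrite -hdot_norm -rmorphXn /= hnormKC.
Qed.

Lemma hnorm_eq0 u : nm u = 0 -> u = 0.
Proof. by move=> h; apply/eqP; rewrite -normr_eq0 -hnormE h. Qed.

Lemma real_lt_ball u v (e : R) : ball u e%:C v <-> nm (u - v) < e.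
Proof. by rewrite -ball_normE /= -hnormE ltcR. Qed.

Lemma ballP_real u v (e : R[i]) : 0 < e -> ball u e v <-> nm (u - v) < complex.Re e.
Proof.
move=> e0; rewrite -real_lt_ball ge0_ReE //; exact: ltW.
Qed.

Lemma nbhs_hnormP u (A : set H) :
  nbhs u A <-> exists2 e : R, 0 < e & forall v, nm (u - v) < e -> A v.
Proof.
split=> [/nbhs_ballP[e /= e0 h]|[e e0 h]].
  exists (complex.Re e); first by rewrite -ltcR ge0_ReE // ltW.
  by move=> v hv; apply: h; apply/ballP_real.
apply/nbhs_ballP; exists e%:C => /=; first by rewrite ltcR.
by move=> v /real_lt_ball; exact: h.
Qed.

Lemma hclosureP S u :
  closure S u <-> forall e : R, 0 < e -> exists2 s, S s & nm (u - s) < e.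
Proof.
split=> [clS e e0|h B /nbhs_hnormP[e e0 hB]].
  have /clS[s [Ss hs]] : nbhs u (fun v => nm (u - v) < e).
    by apply/nbhs_hnormP; exists e.
  by exists s.
by have [s Ss /hB Bs] := h _ e0; exists s.
Qed.

Lemma dense_approx S u (e : R) : dense S -> 0 < e ->
  exists2 s, S s & nm (u - s) < e.
Proof.
move=> dS; move: e; apply/hclosureP => B; rewrite nbhsE => -[O [oO Ou] OB].
by have [s [Os Ss]] := dS O (ex_intro _ u Ou) oO; exists s; split=> //; exact: OB.
Qed.

Lemma hcomplete : complete_for nm [set: H].
Proof.
move=> u _ cau.
have cu : cauchy (u @ \oo).
  apply: cauchy_exP => e e0.
  have [n0 hn0] := cau (complex.Re e) ltac:(by rewrite -ltcR ge0_ReE // ltW).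
  exists (u n0); exists n0 => // n /= hn; apply/ballP_real => //.
  exact: hn0.
have /cauchy_cvgP := cu; set l := lim _ => hl; exists l => // e e0.
have /hl[n0 _ hn0] : nbhs l (fun v => nm (l - v) < e).
  by apply/nbhs_hnormP; exists e.
by exists n0 => n hn; rewrite hnormBC; exact: hn0.
Qed.

Lemma bounded_op_lipschitz (T : H -> H) : bounded_op T ->
  lin T /\ lipschitz_for nm nm T.
Proof.
move=> [lT cT]; split=> //.
have : nbhs (T 0) (fun v => nm (T 0 - v) < 1).
  by apply/nbhs_hnormP; exists 1.
move=> /(cT 0); rewrite nbhs_simpl => /nbhs_hnormP[e e0 he].
have {}he v : nm v < e -> nm (T v) < 1.
  move=> hv; have := he v; rewrite sub0r hnormN => /(_ hv) /=.
  by rewrite (lin0 lT) sub0r hnormN.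
exists (2 / e); first by rewrite divr_ge0 // ltW.
move=> v; have [v0|vn] := eqVneq (nm v) 0.
  by rewrite (hnorm_eq0 v0) (lin0 lT) !hnorm0 mulr0.
have vp : 0 < nm v by rewrite lt0r vn hnorm_ge0.
(* Rescales v to norm e / 2, inside the ball given by continuity at 0. *)
pose c : R := e / (2 * nm v).
have cp : 0 < c by rewrite divr_gt0 // mulr_gt0.
have := he (c%:C *: v); rewrite (linZ lT) !hnormZ cabs_real gtr0_norm // => h.
have {h} : c * nm (T v) < 1.
  apply: h; have -> : c * nm v = e / 2 by rewrite /c; field.
  by rewrite ltr_pdivrMr // ltr_pMr // ltr1n.
rewrite mulrC -ltr_pdivlMr // => /ltW /le_trans; apply.
by rewrite /c invf_div mul1r mulrAC.
Qed.

End Hilbert.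

(** * Finite sums of copies of a Hilbert space *)

Section SumInner.
Context {R : realType} {H : hilbertType R} {X : finType}.
Implicit Types (v w : {ffun X -> H}) (K : set {ffun X -> H}).
Local Notation nm := (@hnorm R H).
Local Notation nmX := (ipnorm (@sum_dot R H X)).
Local Notation hip := (@hdot_inner_product R H).

Lemma sum_dot_inner_product : inner_product (@sum_dot R H X).
Proof.
split.
- move=> a u v w; rewrite /sum_dot mulr_sumr -big_split /=.
  by apply: eq_bigr => x _; rewrite !ffunE hdotDl hdotZl.
- move=> u v; rewrite /sum_dot rmorph_sum; apply: eq_bigr => x _.
  by rewrite hdot_conj.
- by move=> u; apply: sumr_ge0 => x _; exact: hdot_ge0.
Qed.
Local Notation sip := sum_dot_inner_product.

Lemma sum_norm_sqr v : nmX v ^+ 2 = \sum_x nm (v x) ^+ 2.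
Proof.
apply: complexI; rewrite (ipnormKC sip) rmorph_sum /=.
by apply: eq_bigr => x _; rewrite hnormKC.
Qed.

Lemma coord_norm_le v x : nm (v x) <= nmX v.
Proof.
rewrite -(@ler_pXn2r _ 2) ?nnegrE ?ipnorm_ge0 // sum_norm_sqr (bigD1 x) //=.
by rewrite lerDl sumr_ge0 // => y _; rewrite sqr_ge0.
Qed.

Lemma sum_norm_le v : nmX v <= \sum_x nm (v x).
Proof.
have s0 (r : seq X) : 0 <= \sum_(x <- r) nm (v x).
  by apply: sumr_ge0 => x _; rewrite hnorm_ge0.
rewrite -(@ler_pXn2r _ 2) ?nnegrE ?ipnorm_ge0 // sum_norm_sqr.
elim: (index_enum X) => [|x r ih]; first by rewrite !big_nil expr0n.
rewrite !big_cons sqrrD.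
have := mulr_ge0 (hnorm_ge0 (v x)) (s0 r); move: ih; lra.
Qed.

Lemma sum_norm_eq0 v : nmX v = 0 -> v = 0.
Proof.
move=> h; apply/ffunP => x; rewrite ffunE; apply: hnorm_eq0.
by apply/eqP; rewrite eq_le hnorm_ge0 andbT -h coord_norm_le.
Qed.

Lemma sum_norm_lt (e : R) : 0 < e -> exists2 d : R, 0 < d &
  forall v, (forall x, nm (v x) < d) -> nmX v < e.
Proof.
move=> e0; have c0 : 0 < (#|X|.+1%:R : R) by rewrite ltr0n.
(* The successor covers an empty X and makes the final inequality strict. *)
exists (e / #|X|.+1%:R) => [|v hv]; first exact: divr_gt0.
apply: (le_lt_trans (sum_norm_le v)).
apply: (@le_lt_trans _ _ (\sum_(x in X) e / #|X|.+1%:R)).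
  by apply: ler_sum => x _; exact: ltW.
rewrite sumr_const -(mulr_natr (e / _)) mulrAC ltr_pdivrMr // ltr_pM2l // ltr_nat //.
Qed.

Lemma sum_dot_basis v o x : sum_dot v (sum_basis o x) = '[v x, o].
Proof.
rewrite /sum_dot (bigD1 x) //= ffunE eqxx big1 ?addr0 // => y yx.
by rewrite ffunE (negbTE yx) hdot0r.
Qed.

Section Proj.
Context (K : set {ffun X -> H}).
Hypotheses (hK : submodule K) (cK : complete_for nmX K).

Lemma sum_projP v : K (sum_proj K v) /\
  forall k, K k -> sum_dot (v - sum_proj K v) k = 0.
Proof. exact: (ip_projP sip hK cK v). Qed.

Lemma sum_proj_unique v w : K w -> (forall k, K k -> sum_dot (v - w) k = 0) ->
  sum_proj K v = w.
Proof. exact: (ip_proj_unique sip hK cK (@sum_norm_eq0)). Qed.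

Lemma sum_proj_id k : K k -> sum_proj K k = k.
Proof. exact: (ip_proj_id sip hK cK (@sum_norm_eq0)). Qed.

Lemma sum_proj_lin : lin (sum_proj K).
Proof. exact: (ip_proj_linear sip hK cK (@sum_norm_eq0)). Qed.

Lemma sum_proj_norm v : nmX (sum_proj K v) <= nmX v.
Proof. exact: (ip_proj_norm sip hK cK). Qed.

Lemma vn_dimE (o : H) : vn_dim o K =
  complex.Re (\sum_x '[sum_proj K (sum_basis o x) x, o]).
Proof. by congr complex.Re; apply: eq_bigr => x _; rewrite sum_dot_basis. Qed.

(** Computes a dimension from guessed projections of the trace vectors; each guess is verified by
    membership and orthogonality. *)
Lemma vn_dim_candidates (o : H) (w : X -> {ffun X -> H}) : (forall x, K (w x)) ->
  (forall x k, K k -> sum_dot (sum_basis o x - w x) k = 0) ->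
  vn_dim o K = complex.Re (\sum_x '[w x x, o]).
Proof.
move=> Kw hw; rewrite vn_dimE; congr complex.Re; apply: eq_bigr => x _.
by rewrite (sum_proj_unique (Kw x) (hw x)).
Qed.

End Proj.

End SumInner.

Section Approximation.
Context {R : realType} {H : hilbertType R}.
Local Notation nm := hnorm.

Lemma sub_hclosure (S : set H) : S `<=` closure S.
Proof.
move=> s Ss; apply/hclosureP => e e0; exists s => //.
by rewrite subrr hnorm0.
Qed.

Lemma hclosure_idem (S : set H) u :
  (forall e : R, 0 < e -> exists2 s, closure S s & nm (u - s) < e) -> closure S u.
Proof.
move=> h; apply/hclosureP => e e0.
have e2 : 0 < e / 2 by rewrite divr_gt0.
have [s /hclosureP cs hs] := h _ e2; have [t St ht] := cs _ e2.
exists t => //; have := hnorm_dist s u t; lra.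
Qed.

Lemma hclosure_submodule (S : set H) : submodule S -> submodule (closure S).
Proof.
move=> hS; split=> [|a u v /hclosureP cu /hclosureP cv].
  by apply: sub_hclosure; case: hS.
(* A factor that may be 0 is increased by 1 before dividing by it, here and in the later Lipschitz
   estimates. *)
apply/hclosureP => e e0; pose c := cabs a + 1.
have c0 : 0 < c by rewrite ltr_wpDl // cabs_ge0.
have e2 : 0 < e / 2 by rewrite divr_gt0.
have [s Ss hs] := cu _ (divr_gt0 e2 c0); have [t St ht] := cv _ e2.
exists (a *: s + t); first exact: (proj2 hS).
rewrite opprD addrACA -scalerBr.
have := hnormD (a *: (u - s)) (v - t); rewrite hnormZ.
have := cabs_ge0 a; move: hs; rewrite ltr_pdivlMr // /c.
have := hnorm_ge0 (u - s); lra.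
Qed.

End Approximation.

Section LipschitzClosure.
Context {R : realType} {H H1 H2 : hilbertType R}.
Local Notation nm := hnorm.

Lemma lipschitz_closure (f : H -> H1) (S : set H) (S' : set H1) :
  lin f -> lipschitz_for nm nm f -> (forall s, S s -> closure S' (f s)) ->
  forall u, closure S u -> closure S' (f u).
Proof.
move=> lf [c c0 hc] hS u /hclosureP cu; apply: hclosure_idem => e e0.
have c1 : 0 < c + 1 by rewrite ltr_wpDl.
have [s Ss hs] := cu _ (divr_gt0 e0 c1); exists (f s); first exact: hS.
rewrite -(linB lf); have := hc (u - s); move: hs; rewrite ltr_pdivlMr //.
have := hnorm_ge0 (u - s); lra.
Qed.

Lemma cabs_small (z : R[i]) : (forall e : R, 0 < e -> cabs z < e) -> z = 0.
Proof.
move=> h; apply/eqP; rewrite -cabs_eq0 eq_le cabs_ge0 andbT leNgt.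
by apply/negP => /h; rewrite ltxx.
Qed.

Lemma hnorm_small (u : H) : (forall e : R, 0 < e -> nm u < e) -> u = 0.
Proof.
move=> h; apply: hnorm_eq0; apply/eqP; rewrite eq_le hnorm_ge0 andbT leNgt.
by apply/negP => /h; rewrite ltxx.
Qed.

(** Carries scalar identities from a set to its closure. The two target spaces may differ, so that
    inner products can be compared across the embedding of L^2(A (x) A°). *)
Lemma closure_dot_eq (f : H -> H1) (g : H -> H2) (S : set H) (a : H1) (b : H2) :
  lin f -> lipschitz_for nm nm f -> lin g -> lipschitz_for nm nm g ->
  (forall s, S s -> '[f s, a] = '[g s, b]) ->
  forall u, closure S u -> '[f u, a] = '[g u, b].
Proof.
move=> lf [c c0 hc] lg [d d0 hd] hS u /hclosureP cu.
apply/eqP; rewrite -subr_eq0; apply/eqP/cabs_small => e e0.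
pose k := c * nm a + d * nm b + 1.
have k1 : 0 <= c * nm a by rewrite mulr_ge0 ?hnorm_ge0.
have k2 : 0 <= d * nm b by rewrite mulr_ge0 ?hnorm_ge0.
have k0 : 0 < k by rewrite ltr_wpDl // addr_ge0.
have [s Ss hs] := cu _ (divr_gt0 e0 k0).
have -> : '[f u, a] - '[g u, b] = '[f (u - s), a] - '[g (u - s), b].
  rewrite (linB lf) (linB lg) hdotBl (hdotBl (g u)) (hS s Ss).
  by rewrite opprB subrKA.
apply: (le_lt_trans (cabsD _ _)); rewrite cabsN.
move: hs; rewrite ltr_pdivlMr // /k => hs.
have h1 := hdot_cs (f (u - s)) a.
have h2 := hdot_cs (g (u - s)) b.
have h3 := ler_wpM2r (hnorm_ge0 a) (hc (u - s)).
have h4 := ler_wpM2r (hnorm_ge0 b) (hd (u - s)).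
have h5 := hnorm_ge0 (u - s); lra.
Qed.

Lemma hdot_ext (u v : H) : (forall w, '[u, w] = '[v, w]) -> u = v.
Proof.
move=> h; apply/eqP; rewrite -subr_eq0; apply/eqP/hnorm_eq0.
by rewrite /hnorm /ipnorm hdotBl h subrr sqrtr0.
Qed.

Lemma lin_id : lin (@id H).
Proof. by []. Qed.

Lemma lipschitz_id : lipschitz_for nm nm (@id H).
Proof. by exists 1 => // v; rewrite mul1r. Qed.

Lemma lin_combo a (f g : H -> H1) : lin f -> lin g ->
  lin (fun u => a *: f u + g u).
Proof.
move=> lf lg b u v /=; rewrite lf lg scalerDr scalerDr !scalerA mulrC.
by rewrite addrACA.
Qed.

Lemma lipschitz_combo a (f g : H -> H1) :
  lipschitz_for nm nm f -> lipschitz_for nm nm g ->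
  lipschitz_for nm nm (fun u => a *: f u + g u).
Proof.
move=> [c c0 hc] [d d0 hd]; exists (cabs a * c + d).
  by rewrite addr_ge0 // mulr_ge0 ?cabs_ge0.
move=> u; have := hnormD (a *: f u) (g u); rewrite hnormZ.
have := ler_wpM2l (cabs_ge0 a) (hc u); have := hd u; lra.
Qed.

End LipschitzClosure.

Lemma lipschitz_comp (R : realType) (U V W : zmodType) (N : U -> R) (N' : V -> R)
    (N'' : W -> R) (f : U -> V) (g : V -> W) :
  lipschitz_for N N' f -> lipschitz_for N' N'' g -> lipschitz_for N N'' (g \o f).
Proof.
move=> [c c0 hc] [d d0 hd]; exists (d * c) => [|u]; first exact: mulr_ge0.
by rewrite (le_trans (hd _)) // -mulrA ler_wpM2l.
Qed.

Lemma lin_comp (R : realType) (U V W : lmodType R[i]) (f : U -> V) (g : V -> W) :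
  lin f -> lin g -> lin (g \o f).
Proof. by move=> lf lg a u v /=; rewrite lf lg. Qed.

(** * Extension of bounded linear maps by continuity *)

Section Extension.
Context {R : realType} {H1 H2 : hilbertType R} {I : Type}.
Context (u : I -> H1) (v : I -> H2).
Local Notation nm := hnorm.

(* Extension by continuity of the map u k |-> v k. *)
Definition extend (xi : H1) : H2 :=
  xget 0 [set eta | forall e : R, 0 < e ->
                      exists k, nm (xi - u k) < e /\ nm (eta - v k) < e].

Context (c : R).
Hypotheses (c0 : 0 <= c) (hc : forall k, nm (v k) <= c * nm (u k)).
Hypothesis hlin : forall a k l,
  exists m, u m = a *: u k + u l /\ v m = a *: v k + v l.
Local Notation D := (closure (range u)).

(** By [hlin] with a = -1, differences are again among the pairs (u k, v k). In particular v k
    depends only on u k, although I is a bare index type. *)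
Let hcB k l : nm (v k - v l) <= c * nm (u k - u l).
Proof.
have [m [um vm]] := hlin (-1) l k; rewrite !scaleN1r in um vm.
by rewrite -![_ k - _]addrC -um -vm.
Qed.

(** If u (k n) tends to xi, then v (k n) is Cauchy by [hcB]; its limit is a valid value. *)
Lemma extendP xi : D xi -> forall e : R, 0 < e ->
  exists k, nm (xi - u k) < e /\ nm (extend xi - v k) < e.
Proof.
move=> /hclosureP Dxi.
apply: (@xgetPex _ 0 [set eta | forall e : R, 0 < e ->
  exists k, nm (xi - u k) < e /\ nm (eta - v k) < e]).
have pos n : 0 < n.+1%:R^-1 :> R by rewrite invr_gt0 ltr0n.
have /choice[k hk] (n : nat) : exists k, nm (xi - u k) < n.+1%:R^-1.
  by have [_ [k _ <-] hk] := Dxi _ (pos n); exists k.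
have small e : 0 < e -> exists n0, forall n, (n0 <= n)%N -> n.+1%:R^-1 < e :> R.
  move=> e0; exists (Num.truncn e^-1) => n hn.
  rewrite invf_plt ?posrE ?ltr0n //.
  by apply: (lt_le_trans (truncnS_gt _)); rewrite ler_nat.
have c1 : 0 < c + 1 by rewrite ltr_wpDl.
have [|eta _ heta] := @hcomplete R H2 (v \o k) (fun=> Logic.I).
  move=> e e0; have e2 : 0 < e / 2 / (c + 1) by rewrite !divr_gt0.
  have [n0 hn0] := small _ e2; exists n0 => n m hn hm /=.
  have h1 := lt_trans (hk n) (hn0 n hn); have h2 := lt_trans (hk m) (hn0 m hm).
  move: h1 h2; rewrite !ltr_pdivlMr // => h1 h2.
  have h3 := hcB (k n) (k m); have h4 := hnorm_dist xi (u (k n)) (u (k m)).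
  rewrite (hnormBC (u (k n)) xi) in h4.
  have h5 := ler_wpM2l c0 h4.
  have h6 := hnorm_ge0 (xi - u (k n)).
  have h7 := hnorm_ge0 (xi - u (k m)).
  lra.
exists eta => e e0; have [n1 h1] := small _ e0; have [n2 h2] := heta _ e0.
exists (k (maxn n1 n2)); split.
  exact: lt_trans (hk _) (h1 _ (leq_maxl _ _)).
by rewrite (hnormBC); exact: h2 _ (leq_maxr _ _).
Qed.

Lemma extend_unique xi eta : (forall e : R, 0 < e ->
  exists k, nm (xi - u k) < e /\ nm (eta - v k) < e) -> extend xi = eta.
Proof.
move=> h.
have Dxi : D xi.
  by apply/hclosureP => e /h[k [hk _]]; exists (u k) => //; exists k.
(* Four approximation errors enter below, two of them multiplied by c. *)
have c2 : 0 < 2 + 2 * c by rewrite ltr_pwDl // mulr_ge0.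
apply/eqP; rewrite -subr_eq0; apply/eqP/hnorm_small => e e0.
have e1 : 0 < e / (2 + 2 * c) by rewrite divr_gt0.
have [k [hk1 hk2]] := h _ e1; have [l [hl1 hl2]] := extendP Dxi e1.
have h1 := hnorm_dist (v l) (extend xi) eta.
have h2 := hnorm_dist (v k) (v l) eta.
have h3 := hcB l k; have h4 := hnorm_dist xi (u l) (u k).
rewrite (hnormBC (u l) xi) in h4; rewrite (hnormBC (v k) eta) in h2.
have h5 := ler_wpM2l c0 h4.
move: hk1 hk2 hl1 hl2; rewrite !ltr_pdivlMr // => hk1 hk2 hl1 hl2.
have h6 := ler_wpM2l c0 (ltW hk1); have h7 := ler_wpM2l c0 (ltW hl1).
rewrite -(@ltr_pM2r _ (2 + 2 * c)) //.
have h8 : nm (extend xi - eta) * (2 + 2 * c) <= (nm (extend xi - v l) +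
    (c * (nm (xi - u l) + nm (xi - u k)) + nm (eta - v k))) * (2 + 2 * c).
  by apply: ler_wpM2r; [exact: ltW|lra].
lra.
Qed.

Lemma extend_id k : extend (u k) = v k.
Proof.
by apply: extend_unique => e e0; exists k; rewrite !subrr !hnorm0.
Qed.

Lemma extend_lin a xi eta : D xi -> D eta ->
  extend (a *: xi + eta) = a *: extend xi + extend eta.
Proof.
move=> Dxi Deta; apply: extend_unique => e e0; pose d := cabs a + 1.
have d0 : 0 < d by rewrite ltr_wpDl // cabs_ge0.
have e2 : 0 < e / 2 by rewrite divr_gt0.
have [k [hk1 hk2]] := extendP Dxi (divr_gt0 e2 d0).
have [l [hl1 hl2]] := extendP Deta e2.
have [m [um vm]] := hlin a k l; exists m; rewrite um vm {um vm}.
move: hk1 hk2; rewrite !ltr_pdivlMr // /d => hk1 hk2.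
rewrite !opprD; split; rewrite addrACA -scalerBr.
  have := hnormD (a *: (xi - u k)) (eta - u l); rewrite hnormZ.
  have := hnorm_ge0 (xi - u k); lra.
have := hnormD (a *: (extend xi - v k)) (extend eta - v l).
rewrite hnormZ; have := hnorm_ge0 (extend xi - v k); lra.
Qed.

Lemma extend_norm xi : D xi -> nm (extend xi) <= c * nm xi.
Proof.
move=> Dxi; rewrite leNgt; apply/negP => hlt.
have d0 : 0 < 1 + c by rewrite ltr_pwDl.
have e0 : 0 < (nm (extend xi) - c * nm xi) / (1 + c).
  by rewrite divr_gt0 // subr_gt0.
have [k []] := extendP Dxi e0; rewrite !ltr_pdivlMr // => h1 h2.
have h3 := hc k; have h4 := hnormD (v k) (extend xi - v k).
have h5 := hnormB xi (xi - u k); rewrite subrKC in h4; rewrite subKr in h5.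
have h6 := ler_wpM2l c0 h5; have h7 := ler_wpM2l c0 (ltW h1).
have h8 : nm (extend xi) - c * nm xi <= c * nm (xi - u k) + nm (extend xi - v k).
  lra.
have h9 := ler_wpM2l (ltW d0) h8; lra.
Qed.

Lemma extend_closure xi : D xi -> closure (range v) (extend xi).
Proof.
move=> Dxi; apply/hclosureP => e e0; have [k [_ hk]] := extendP Dxi e0.
by exists (v k) => //; exists k.
Qed.

End Extension.

(** * The standard representation *)

Section TracialAlgebra.
Context {R : realType} {M : tracialVNA R}.
Implicit Types (x y z : M) (a : R[i]).
Local Notation star := (@vn_star R M).
Local Notation tau := (@vn_tau R M).

Lemma vn_ext x y : (forall xi eta, '[vn_rep x xi, eta] = '[vn_rep y xi, eta]) -> x = y.
Proof.
by move=> h; apply: vn_repI; apply/funext => xi; apply: hdot_ext => w; exact: h.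
Qed.

Lemma vn_repZ a x xi : vn_rep (a *: x) xi = a *: vn_rep x xi.
Proof.
have h := vn_rep_linear 0 (0 : M) 0 xi.
have h0 : vn_rep (0 : M) xi = 0.
  apply: (addrI (vn_rep (0 : M) xi)); rewrite addr0.
  by have := vn_rep_linear 1 (0 : M) 0 xi; rewrite !scale1r addr0.
by have := vn_rep_linear a x 0 xi; rewrite h0 !addr0.
Qed.

Lemma starK : involutive star.
Proof.
move=> x; apply: vn_ext => xi eta.
by rewrite [RHS]vn_rep_star [LHS]hdot_conj -vn_rep_star -hdot_conj.
Qed.

Lemma starM x y : star (x * y) = star y * star x.
Proof.
apply: vn_ext => xi eta.
by rewrite vn_repM !vn_rep_star !starK vn_repM.
Qed.

Lemma starL a x y : star (a *: x + y) = a^* *: star x + star y.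
Proof.
apply: vn_ext => xi eta.
rewrite vn_rep_star starK vn_rep_linear hdotDr hdotZr.
by rewrite vn_rep_linear hdotDl hdotZl !vn_rep_star !starK.
Qed.

Lemma star1 : star 1 = 1.
Proof. by have := starM (star 1) 1; rewrite mulr1 !starK mulr1. Qed.

Lemma starD x y : star (x + y) = star x + star y.
Proof. by have := starL 1 x y; rewrite rmorph1 !scale1r. Qed.

Lemma star0 : star 0 = 0.
Proof. by apply: (addrI (star 0)); rewrite -starD !addr0. Qed.

Lemma starZ a x : star (a *: x) = a^* *: star x.
Proof. by rewrite -[a *: x]addr0 starL star0 addr0. Qed.

Lemma star_sum (I : Type) (r : seq I) (F : I -> M) :
  star (\sum_(k <- r) F k) = \sum_(k <- r) star (F k).
Proof.
elim: r => [|k r ih]; first by rewrite !big_nil star0.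
by rewrite !big_cons starD ih.
Qed.

Lemma tauD x y : tau (x + y) = tau x + tau y.
Proof. by have := vn_tau_linear 1 x y; rewrite scale1r mul1r. Qed.

Lemma tau0 : tau 0 = 0.
Proof. by apply: (addrI (tau 0)); rewrite -tauD !addr0. Qed.

Lemma tauZ a x : tau (a *: x) = a * tau x.
Proof. by rewrite -[a *: x]addr0 vn_tau_linear tau0 addr0. Qed.

Lemma tau_sum (I : Type) (r : seq I) (F : I -> M) :
  tau (\sum_(k <- r) F k) = \sum_(k <- r) tau (F k).
Proof.
elim: r => [|k r ih]; first by rewrite !big_nil tau0.
by rewrite !big_cons tauD ih.
Qed.

Lemma op_ge0_starM x : op_ge0 (@vn_rep R M) (star x * x).
Proof. by move=> xi; rewrite vn_repM vn_rep_star starK hdot_ge0. Qed.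

Lemma tau_starM_ge0 x : 0 <= tau (star x * x).
Proof. exact/vn_tau_ge0/op_ge0_starM. Qed.

(** Faithfulness of the trace gives x^* x = 0, and then every x xi has norm 0. *)
Lemma tau_starM_eq0 x : tau (star x * x) = 0 -> x = 0.
Proof.
move=> /(vn_tau_faithful (op_ge0_starM x)) h; apply: vn_ext => xi eta.
have : '[vn_rep x xi, vn_rep x xi] = '[vn_rep (0 : M) xi, xi].
  by rewrite -h vn_repM [RHS]vn_rep_star starK.
have -> : vn_rep (0 : M) xi = 0 by rewrite -(scale0r 0) vn_repZ scale0r.
rewrite hdot0l -hnormKC => /(@complexI _ _ 0) /eqP; rewrite sqrf_eq0 => /eqP.
by move=> /hnorm_eq0 ->.
Qed.

(** Positivity at 1 + x and at 1 + i x makes tau x + tau x^* and i (tau x - tau x^* ) real, and the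
    two conditions together determine tau x^*. *)
Lemma tau_star x : tau (star x) = (tau x)^*.
Proof.
have h1 := tau_starM_ge0 (1 + x); have h2 := tau_starM_ge0 (1 + 'i *: x).
have h0 := tau_starM_ge0 x.
rewrite starD star1 mulrDl mul1r mulrDr mulr1 !tauD vn_tau1 in h1.
rewrite starD starZ star1 mulrDl mul1r mulrDr mulr1 -scalerAl -scalerAr in h2.
rewrite !tauD !tauZ vn_tau1 mulrA [('i)^* * 'i]mulrC -normCK normCi expr1n mul1r in h2.
have {h1} r1 : tau x + tau (star x) \is Num.real.
  have -> : tau x + tau (star x) = (1 + tau x + (tau (star x) + tau (star x * x)))
    - (1 + tau (star x * x)) by ring.
  by rewrite rpredB // ?ger0_real // addr_ge0.
have {h2} r2 : 'i * tau x + 'i^* * tau (star x) \is Num.real.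
  have -> : 'i * tau x + 'i^* * tau (star x) =
    (1 + 'i * tau x + ('i^* * tau (star x) + tau (star x * x)))
    - (1 + tau (star x * x)) by ring.
  by rewrite rpredB // ?ger0_real // addr_ge0.
move/CrealP: r1; move/CrealP: r2; rewrite !rmorphD !rmorphM /= conjCK conjCi.
have i0 : ('i : R[i]) != 0 := neq0Ci _.
move: (tau x) (tau (star x)) => u v h2 h1.
have {h2} h2 : v^* - u^* = u - v.
  by apply: (mulfI i0); move: h2; rewrite !mulNr !mulrBr addrC.
have : v + v = u^* + u^*.
  have -> : v + v = (u + v) - (u - v) by ring.
  by rewrite -h1 -h2; ring.
move=> /eqP; rewrite -!mulr2n -subr_eq0 -mulrnBl mulrn_eq0 /= subr_eq0.
by move=> /eqP.
Qed.

Definition tau_form x y : R[i] := tau (star y * x).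

Lemma tau_form_inner_product : inner_product tau_form.
Proof.
split.
- by move=> a u v w; rewrite /tau_form mulrDr -scalerAr vn_tau_linear.
- by move=> u v; rewrite /tau_form -tau_star starM starK.
- exact: tau_starM_ge0.
Qed.

Definition norm2 x : R := ipnorm tau_form x.

Lemma norm2_star x : norm2 (star x) = norm2 x.
Proof. by rewrite /norm2 /ipnorm /tau_form starK vn_tau_tracial. Qed.

Lemma norm2_sqrtC x : (norm2 x)%:C = sqrtC (tau (star x * x)).
Proof.
have n0 : 0 <= (norm2 x)%:C by rewrite lecR ipnorm_ge0.
apply/eqP; rewrite -(@eqrXn2 _ 2) ?sqrtC_ge0 ?tau_starM_ge0 // sqrtCK.
by rewrite -rmorphXn /= (ipnormKC tau_form_inner_product).
Qed.

End TracialAlgebra.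

Section L2.
Context {R : realType} {Q : tracialVNA R} {L : L2space Q}.
Implicit Types (x y c : Q) (xi eta : L).
Local Notation hat := (@l2_hat R Q L).
Local Notation star := (@vn_star R Q).
Local Notation nm := hnorm.

Lemma hat_lin : lin (hat : Q -> l2_space L).
Proof. exact: l2_hat_linear. Qed.

Lemma act_lin x : lin (@l2_act R Q L x).
Proof. by case: (bounded_op_lipschitz (l2_act_bounded L x)). Qed.

Lemma act_lipschitz x : lipschitz_for nm nm (@l2_act R Q L x).
Proof. by case: (bounded_op_lipschitz (l2_act_bounded L x)). Qed.

Lemma hat_closure xi : closure (range hat) xi.
Proof. by apply/hclosureP => e e0; apply: dense_approx => //; exact: l2_hat_dense. Qed.

Lemma norm_hat x : nm (hat x) = norm2 x.
Proof. by rewrite /norm2 /hnorm /ipnorm l2_hat_dot. Qed.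

Lemma l2_ext_dot (H1 H2 : hilbertType R) (f : L -> H1) (g : L -> H2) a b :
  lin f -> lipschitz_for nm nm f -> lin g -> lipschitz_for nm nm g ->
  (forall x, '[f (hat x), a] = '[g (hat x), b]) ->
  forall xi, '[f xi, a] = '[g xi, b].
Proof.
move=> lf cf lg cg h xi.
by refine (closure_dot_eq lf cf lg cg _ (@hat_closure xi)) => _ [x _ <-].
Qed.

Lemma l2_ext (H1 : hilbertType R) (f g : L -> H1) :
  lin f -> lipschitz_for nm nm f -> lin g -> lipschitz_for nm nm g ->
  (forall x, f (hat x) = g (hat x)) -> f =1 g.
Proof.
move=> lf cf lg cg h xi; apply: hdot_ext => a.
by apply: l2_ext_dot => // x; rewrite h.
Qed.

Lemma act1 xi : l2_act 1 xi = xi.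
Proof.
apply: (l2_ext (act_lin 1) (act_lipschitz 1) lin_id lipschitz_id) => x.
by rewrite l2_act_hat mul1r.
Qed.

Lemma actM x y xi : l2_act (x * y) xi = l2_act x (l2_act y xi).
Proof.
apply: (l2_ext (act_lin _) (act_lipschitz _)
  (lin_comp (act_lin y) (act_lin x))
  (lipschitz_comp (act_lipschitz y) (act_lipschitz x))) => z /=.
by rewrite !l2_act_hat mulrA.
Qed.

Lemma act_dot x xi eta : '[l2_act x xi, eta] = '[xi, l2_act (star x) eta].
Proof.
(* Density is used once in each variable. *)
suff h y : '[l2_act (star x) eta, hat y] = '[eta, l2_act x (hat y)].
  apply: (l2_ext_dot (act_lin x) (act_lipschitz x) lin_id lipschitz_id) => y.
  by rewrite hdot_conj -h -hdot_conj.
apply: (l2_ext_dot (act_lin _) (act_lipschitz _) lin_id lipschitz_id) => z.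
by rewrite !l2_act_hat !l2_hat_dot starM mulrA.
Qed.

Lemma actL a x y xi : l2_act (a *: x + y) xi = a *: l2_act x xi + l2_act y xi.
Proof.
apply: (l2_ext (act_lin _) (act_lipschitz _)
  (lin_combo a (act_lin x) (act_lin y))
  (lipschitz_combo a (act_lipschitz x) (act_lipschitz y))) => z.
by rewrite !l2_act_hat mulrDl -scalerAl l2_hat_linear.
Qed.

Lemma actD x y xi : l2_act (x + y) xi = l2_act x xi + l2_act y xi.
Proof. by have := actL 1 x y xi; rewrite !scale1r. Qed.

Lemma act0 xi : l2_act 0 xi = 0.
Proof. by apply: (addrI (l2_act 0 xi)); rewrite -actD !addr0. Qed.

Lemma actZ a x xi : l2_act (a *: x) xi = a *: l2_act x xi.
Proof. by have := actL a x 0 xi; rewrite act0 !addr0. Qed.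

Lemma act_sum (I : Type) (r : seq I) (F : I -> Q) xi :
  l2_act (\sum_(k <- r) F k) xi = \sum_(k <- r) l2_act (F k) xi.
Proof.
elim: r => [|k r ih]; first by rewrite !big_nil act0.
by rewrite !big_cons actD ih.
Qed.

Definition ract c : L -> L := extend hat (fun x => hat (x * c)).

(** By traciality the involution is isometric in the 2-norm, so right multiplication by c is bounded
    because left multiplication by c^* is. *)
Lemma ract_data c : exists2 d : R, 0 <= d &
  (forall x, nm (hat (x * c)) <= d * nm (hat x)) /\
  (forall a x y, exists z, hat z = a *: hat x + hat y /\
     hat (z * c) = a *: hat (x * c) + hat (y * c)).
Proof.
have [d d0 hd] := act_lipschitz (star c); exists d => //; split=> [x|a x y].
  have := hd (hat (star x)).
  by rewrite l2_act_hat -starM !norm_hat !norm2_star.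
exists (a *: x + y); rewrite l2_hat_linear; split=> //.
by rewrite mulrDl -scalerAl l2_hat_linear.
Qed.

Lemma ract_hat c x : ract c (hat x) = hat (x * c).
Proof. by have [d d0 [h1 h2]] := ract_data c; exact: (extend_id d0 h1 h2). Qed.

Lemma ract_lin c : lin (ract c).
Proof.
have [d d0 [h1 h2]] := ract_data c => a xi eta.
by apply: (extend_lin d0 h1 h2); exact: hat_closure.
Qed.

Lemma ract_lipschitz c : lipschitz_for nm nm (ract c).
Proof.
have [d d0 [h1 h2]] := ract_data c; exists d => // xi.
by apply: (extend_norm d0 h1 h2); exact: hat_closure.
Qed.

Lemma ract_act c x xi : ract c (l2_act x xi) = l2_act x (ract c xi).
Proof.
apply: (l2_ext (lin_comp (act_lin x) (ract_lin c))
  (lipschitz_comp (act_lipschitz x) (ract_lipschitz c))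
  (lin_comp (ract_lin c) (act_lin x))
  (lipschitz_comp (ract_lipschitz c) (act_lipschitz x))) => z /=.
by rewrite l2_act_hat !ract_hat l2_act_hat mulrA.
Qed.

Lemma ract_dot c xi eta : '[ract c xi, eta] = '[xi, ract (star c) eta].
Proof.
suff h y : '[ract (star c) eta, hat y] = '[eta, ract c (hat y)].
  apply: (l2_ext_dot (ract_lin c) (ract_lipschitz c) lin_id lipschitz_id) => y.
  by rewrite hdot_conj -h -hdot_conj.
apply: (l2_ext_dot (ract_lin _) (ract_lipschitz _) lin_id lipschitz_id) => z.
rewrite !ract_hat !l2_hat_dot starM mulrA.
by rewrite vn_tau_tracial mulrA.
Qed.

End L2.

(** * Trace and dimension *)

Section Modular.
Context {R : realType} {Q : tracialVNA R} (L : L2space Q) (C : set Q).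
Hypothesis hC : unital_star_subalgebra C.
Local Notation hat := (@l2_hat R Q L).
Local Notation star := (@vn_star R Q).
Local Notation nm := hnorm.
Local Notation o := (hat 1).
Local Notation H0 := (closure (hat @` C)).

Lemma subalg_submodule : submodule C.
Proof.
have [h1 hl _ _] := hC; split=> //.
by rewrite -(subrr 1) addrC -scaleN1r; exact: hl.
Qed.

Lemma hat_subalg_submodule : submodule (hat @` C).
Proof.
have [h0 hl] := subalg_submodule; split=> [|a _ _ [x Cx <-] [y Cy <-]].
  by exists 0 => //; rewrite (lin0 hat_lin).
by exists (a *: x + y); [exact: hl|exact: l2_hat_linear].
Qed.

Lemma H0_submodule : submodule H0.
Proof. exact/hclosure_submodule/hat_subalg_submodule. Qed.

Lemma H0_hat x : C x -> H0 (hat x).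
Proof. by move=> Cx; apply: sub_hclosure; exists x. Qed.

Lemma H0_one : H0 o.
Proof. by apply: H0_hat; case: hC. Qed.

Lemma H0_ract c xi : C c -> H0 xi -> H0 (ract c xi).
Proof.
move=> Cc; apply: (lipschitz_closure (ract_lin c) (ract_lipschitz c)).
by move=> _ [x Cx <-]; rewrite ract_hat; apply: H0_hat; case: hC => _ _ + _; apply.
Qed.

Lemma H0_act c xi : C c -> H0 xi -> H0 (l2_act c xi).
Proof.
move=> Cc; apply: (lipschitz_closure (act_lin c) (act_lipschitz c)).
by move=> _ [x Cx <-]; rewrite l2_act_hat; apply: H0_hat; case: hC => _ _ + _; apply.
Qed.

(** Modularity gives S (hat t) = (S o) t for t in C. Replacing T o by hat t and then S o by hat s
    turns <S (T o), o> into tau (t s), and the right side adds up the two errors. *)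
Lemma trace_approx (S T : L -> L) (cS d : R) s t : lin S ->
  (forall v, nm (S v) <= cS * nm v) -> 0 <= cS ->
  (forall c v, C c -> S (ract c v) = ract c (S v)) ->
  C t -> nm (T o - hat t) <= d -> nm (S o - hat s) <= d ->
  cabs ('[S (T o), o] - vn_tau (t * s)) <= d * (cS * nm o + nm (T o) + d).
Proof.
move=> lS hS cS0 rS Ct ht hs.
have e1 : '[S (hat t), o] = '[S o, hat (star t)].
  by rewrite -{1}[t]mul1r -ract_hat rS // ract_dot ract_hat mul1r.
have e2 : vn_tau (t * s) = '[hat s, hat (star t)] by rewrite l2_hat_dot starK.
have -> : '[S (T o), o] - vn_tau (t * s) =
    '[S (T o - hat t), o] + '[S o - hat s, hat (star t)].
  by rewrite e2 (linB lS) !hdotBl e1 subrKA.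
apply: (le_trans (cabsD _ _)).
have h1 := hdot_cs (S (T o - hat t)) o.
have h2 := hdot_cs (S o - hat s) (hat (star t)).
have h3 : nm (hat (star t)) <= nm (T o) + d.
  rewrite norm_hat norm2_star -(@norm_hat _ _ L).
  by have := hnormB (T o) (T o - hat t); rewrite subKr; lra.
have h4 := ler_wpM2r (hnorm_ge0 o) (hS (T o - hat t)).
have h5 : cS * nm (T o - hat t) * nm o <= cS * d * nm o.
  by rewrite ler_wpM2r ?hnorm_ge0 // ler_wpM2l.
have h6 : nm (S o - hat s) * nm (hat (star t)) <= d * (nm (T o) + d).
  by apply: ler_pM => //; exact: hnorm_ge0.
lra.
Qed.

(* A trace property without adjoints: both sides are limits of
   tau (t * s) = tau (s * t) as hat t and hat s tend to T o and S o. *)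
Lemma trace_comm (S T : L -> L) : lin S -> lin T ->
  lipschitz_for nm nm S -> lipschitz_for nm nm T ->
  (forall c v, C c -> S (ract c v) = ract c (S v)) ->
  (forall c v, C c -> T (ract c v) = ract c (T v)) ->
  H0 (S o) -> H0 (T o) -> '[S (T o), o] = '[T (S o), o].
Proof.
move=> lS lT [c c0 hc] [d d0 hd] rS rT /hclosureP aS /hclosureP aT.
apply/eqP; rewrite -subr_eq0; apply/eqP/cabs_small => e e0.
(* The sum of the error factors of [trace_approx] for (S, T) and for (T, S), where the tolerance m
   chosen below, at most 1, has been replaced by 1. *)
pose k := c * nm o + nm (T o) + 1 + (d * nm o + nm (S o) + 1).
have k1 : 0 <= c * nm o by rewrite mulr_ge0 ?hnorm_ge0.
have k2 : 0 <= d * nm o by rewrite mulr_ge0 ?hnorm_ge0.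
have k3 := hnorm_ge0 (T o); have k4 := hnorm_ge0 (S o).
have k0 : 0 < k by rewrite /k; lra.
pose m := Num.min 1 (e / (2 * k)).
have m0 : 0 < m by rewrite /m lt_min ltr01 divr_gt0 // mulr_gt0.
have m1 : m <= 1 by rewrite /m ge_min lexx.
have mk : m * k <= e / 2.
  have : m <= e / (2 * k) by rewrite /m ge_min lexx orbT.
  by rewrite ler_pdivlMr ?mulr_gt0 //; lra.
have [_ [s Cs <-] /ltW hs] := aS _ m0; have [_ [t Ct <-] /ltW ht] := aT _ m0.
have h1 := trace_approx lS hc c0 rS Ct ht hs.
have h2 := trace_approx lT hd d0 rT Cs hs ht.
rewrite [vn_tau (s * t)]vn_tau_tracial in h2.
have -> : '[S (T o), o] - '[T (S o), o] = ('[S (T o), o] - vn_tau (t * s))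
  - ('[T (S o), o] - vn_tau (t * s)) by rewrite opprB subrKA.
apply: (le_lt_trans (cabsD _ _)); rewrite cabsN.
move: mk; rewrite /k.
have h3 : m * (c * nm o + nm (T o) + m) <= m * (c * nm o + nm (T o) + 1).
  by rewrite ler_wpM2l ?(ltW m0) // lerD2l.
have h4 : m * (d * nm o + nm (S o) + m) <= m * (d * nm o + nm (S o) + 1).
  by rewrite ler_wpM2l ?(ltW m0) // lerD2l.
lra.
Qed.

Definition ract_sum (X : finType) c (v : {ffun X -> L}) : {ffun X -> L} :=
  [ffun x => ract c (v x)].

(** The operators act on all of L^2(Q)^X. The last clause keeps their matrix entries in L^2(C),
    where they can be approximated by elements of C, as [trace_comm] requires. *)
Definition modular (X Y : finType) (T : {ffun X -> L} -> {ffun Y -> L}) : Prop :=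
  [/\ lin T, lipschitz_for (ipnorm (@sum_dot _ _ _)) (ipnorm (@sum_dot _ _ _)) T,
      forall c v, C c -> T (ract_sum c v) = ract_sum c (T v) &
      forall x y, H0 (T (sum_basis o x) y)].

Lemma sum_basisE (X : finType) (v : {ffun X -> L}) :
  v = \sum_x sum_basis (v x) x.
Proof.
apply/ffunP => x; rewrite sum_ffunE (bigD1 x) //= ffunE eqxx big1 ?addr0 //.
by move=> y yx; rewrite ffunE eq_sym (negbTE yx).
Qed.

Lemma sum_basis_lin (X : finType) (x : X) : lin (fun xi : L => sum_basis xi x).
Proof.
by move=> a u v; apply/ffunP => y; rewrite !ffunE; case: eqP => // _;
  rewrite scaler0 addr0.
Qed.

Lemma entry_lin (X Y : finType) (T : {ffun X -> L} -> {ffun Y -> L}) x y :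
  lin T -> lin (fun xi : L => T (sum_basis xi x) y).
Proof.
move=> lT a u v; have e := sum_basis_lin x a u v; rewrite /= in e.
by rewrite e lT !ffunE.
Qed.

Lemma sum_basis_norm (X : finType) (x : X) (xi : L) :
  ipnorm (@sum_dot _ _ _) (sum_basis xi x) = nm xi.
Proof.
by rewrite /ipnorm sum_dot_basis ffunE eqxx.
Qed.

Lemma entry_lipschitz (X Y : finType) (T : {ffun X -> L} -> {ffun Y -> L}) x y :
  lipschitz_for (ipnorm (@sum_dot _ _ _)) (ipnorm (@sum_dot _ _ _)) T ->
  lipschitz_for nm nm (fun xi : L => T (sum_basis xi x) y).
Proof.
move=> [c c0 hc]; exists c => // xi; apply: le_trans (coord_norm_le _ y) _.
by rewrite -(sum_basis_norm x).
Qed.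

Lemma entry_ract (X Y : finType) (T : {ffun X -> L} -> {ffun Y -> L}) x y c xi :
  T (ract_sum c (sum_basis xi x)) = ract_sum c (T (sum_basis xi x)) ->
  T (sum_basis (ract c xi) x) y = ract c (T (sum_basis xi x) y).
Proof.
have -> : sum_basis (ract c xi) x = ract_sum c (sum_basis xi x).
  by apply/ffunP => z; rewrite !ffunE; case: eqP => // _; rewrite (lin0 (ract_lin c)).
by move=> ->; rewrite ffunE.
Qed.

(** Expanding both composites over coordinates leaves double sums of products of matrix entries,
    which [trace_comm] matches term by term. *)
Lemma trace_sum_comm (X Y : finType) (T : {ffun X -> L} -> {ffun Y -> L})
    (S : {ffun Y -> L} -> {ffun X -> L}) : modular T -> modular S ->
  \sum_x '[S (T (sum_basis o x)) x, o] = \sum_y '[T (S (sum_basis o y)) y, o].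
Proof.
move=> [lT cT rT hT] [lS cS rS hS].
have eS x : '[S (T (sum_basis o x)) x, o] =
    \sum_y '[S (sum_basis (T (sum_basis o x) y) y) x, o].
  rewrite {1}[T _]sum_basisE (lin_sum lS) sum_ffunE.
  by rewrite hdot_suml.
have eT y : '[T (S (sum_basis o y)) y, o] =
    \sum_x '[T (sum_basis (S (sum_basis o y) x) x) y, o].
  rewrite {1}[S _]sum_basisE (lin_sum lT) sum_ffunE.
  by rewrite hdot_suml.
rewrite (eq_bigr _ (fun x _ => eS x)) (eq_bigr _ (fun y _ => eT y)) exchange_big.
apply: eq_bigr => y _; apply: eq_bigr => x _.
apply: (@trace_comm (fun xi => S (sum_basis xi y) x) (fun xi => T (sum_basis xi x) y)).
- exact: entry_lin.
- exact: entry_lin.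
- exact: entry_lipschitz.
- exact: entry_lipschitz.
- by move=> c v Cc; apply: entry_ract; exact: rS.
- by move=> c v Cc; apply: entry_ract; exact: rT.
- exact: hS.
- exact: hT.
Qed.

Section DimIso.
Context {X Y : finType} {V : lmodType R[i]} (D : set V).
Context (f : V -> {ffun X -> L}) (g : V -> {ffun Y -> L}) (r : Q -> V -> V).
Local Notation nX := (ipnorm (@sum_dot R L X)).
Local Notation nY := (ipnorm (@sum_dot R L Y)).
Hypotheses (hD : submodule D) (lf : lin f) (lg : lin g).
Hypothesis hr : forall c v, C c -> D v ->
  [/\ D (r c v), f (r c v) = ract_sum c (f v) & g (r c v) = ract_sum c (g v)].
Hypothesis fH0 : forall v x, D v -> H0 (f v x).
Hypothesis gH0 : forall v y, D v -> H0 (g v y).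
Hypothesis gf : exists2 c : R, 0 <= c & forall v, D v -> nY (g v) <= c * nX (f v).
Hypothesis fg : exists2 c : R, 0 <= c & forall v, D v -> nX (f v) <= c * nY (g v).

Lemma image_submodule (Z : finType) (h : V -> {ffun Z -> L}) :
  lin h -> submodule (h @` D).
Proof.
move=> lh; split; first by exists 0; [case: hD|rewrite (lin0 lh)].
move=> a _ _ [v Dv <-] [w Dw <-]; exists (a *: v + w); last by rewrite lh.
exact: (proj2 hD).
Qed.

(** By [fg], a Cauchy sequence of the g v is Cauchy for the f v; by [gf], the limit found there is a
    limit here. *)
Lemma image_complete : complete_for nX (f @` D) -> complete_for nY (g @` D).
Proof.
move=> cK u /[dup] Ku; have [c c0 hc] := fg; have [d d0 hd] := gf.
have /choice[v hv] n : exists v, D v /\ g v = u n by have [v] := Ku n; exists v.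
move=> _ cau; have c1 : 0 < c + 1 by rewrite ltr_wpDl.
have [||_ [l Dl <-] hl] := cK (fun n => f (v n)).
- by move=> n; exists (v n) => //; case: (hv n).
- move=> e e0; have [n0 hn0] := cau _ (divr_gt0 e0 c1).
  exists n0 => n m hn hm; have [Dn gn] := hv n; have [Dm gm] := hv m.
  rewrite -(linB lf); have := hc _ (submoduleB hD Dn Dm); rewrite (linB lg) gn gm.
  have := hn0 n m hn hm; rewrite ltr_pdivlMr //.
  have := ipnorm_ge0 (@sum_dot R L Y) (u n - u m); lra.
exists (g l); first by exists l.
have d1 : 0 < d + 1 by rewrite ltr_wpDl.
move=> e e0; have [n0 hn0] := hl _ (divr_gt0 e0 d1).
exists n0 => n hn; have [Dn gn] := hv n.
rewrite -gn -(linB lg); have := hd _ (submoduleB hD Dn Dl); rewrite (linB lf).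
have := hn0 n hn; rewrite ltr_pdivlMr //.
have := ipnorm_ge0 (@sum_dot R L X) (f (v n) - f l); lra.
Qed.

End DimIso.

Lemma ract_sum_dot (X : finType) c (v w : {ffun X -> L}) :
  sum_dot (ract_sum c v) w = sum_dot v (ract_sum (star c) w).
Proof. by apply: eq_bigr => x _; rewrite !ffunE ract_dot. Qed.

Lemma ract_sum_lin (X : finType) c : lin (@ract_sum X c).
Proof. by move=> a u v; apply/ffunP => x; rewrite !ffunE ract_lin. Qed.

(** C is closed under the involution, so the orthogonal complement of a C-submodule is a C-submodule
    as well. *)
Lemma sum_proj_ract (X : finType) (K : set {ffun X -> L}) c v :
  submodule K -> complete_for (ipnorm (@sum_dot R L X)) K ->
  (forall d w, C d -> K w -> K (ract_sum d w)) -> C c ->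
  sum_proj K (ract_sum c v) = ract_sum c (sum_proj K v).
Proof.
move=> hK cK rK Cc; have [Kp hp] := sum_projP hK cK v.
apply: sum_proj_unique => //; first exact: rK.
move=> k Kk; rewrite -(linB (ract_sum_lin c)) ract_sum_dot; apply: hp.
by apply: rK => //; case: hC => _ _ _; apply.
Qed.

(* For f, g : D -> H^X, H^Y with equivalent norms on D, the operators
   T := g f^-1 P_{f D} and S := f g^-1 P_{g D} satisfy S T = P_{f D} and
   T S = P_{g D}, so no polar decomposition is needed. *)
Section DimIsoMap.
Context {X Y : finType} {V : lmodType R[i]} (D : set V).
Context (f : V -> {ffun X -> L}) (g : V -> {ffun Y -> L}) (r : Q -> V -> V).
Local Notation nX := (ipnorm (@sum_dot R L X)).
Local Notation nY := (ipnorm (@sum_dot R L Y)).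
Hypotheses (hD : submodule D) (lf : lin f) (lg : lin g).
Hypothesis hr : forall c v, C c -> D v ->
  [/\ D (r c v), f (r c v) = ract_sum c (f v) & g (r c v) = ract_sum c (g v)].
Hypothesis gH0 : forall v y, D v -> H0 (g v y).
Hypothesis gf : exists2 c : R, 0 <= c & forall v, D v -> nY (g v) <= c * nX (f v).
Hypothesis cf : complete_for nX (f @` D).

Definition transfer (u : {ffun X -> L}) : {ffun Y -> L} :=
  xget 0 [set w | exists2 v, D v & f v = sum_proj (f @` D) u /\ w = g v].

(** By [gf], two vectors of D with the same image under f have the same image under g, so the choice
    in [transfer] is immaterial. *)
Lemma transferE u v : D v -> f v = sum_proj (f @` D) u -> transfer u = g v.
Proof.
move=> Dv fv.
have [w Dw [fw ->]] : [set w | exists2 v, D v &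
  f v = sum_proj (f @` D) u /\ w = g v] (transfer u).
  by apply: xgetPex; exists (g v); exists v.
have [c c0 hc] := gf.
apply/eqP; rewrite -subr_eq0 -(linB lg); apply/eqP/sum_norm_eq0.
apply/eqP; rewrite eq_le ipnorm_ge0 andbT.
have := hc _ (submoduleB hD Dw Dv).
by rewrite (linB lf) fw fv subrr (ipnorm0 sum_dot_inner_product) mulr0.
Qed.

Lemma transferP u : exists2 v, D v & f v = sum_proj (f @` D) u /\ transfer u = g v.
Proof.
have [[v Dv fv] _] := sum_projP (image_submodule hD lf) cf u.
by exists v => //; split=> //; exact: transferE.
Qed.

Lemma transfer_modular : modular transfer.
Proof.
have sK := image_submodule hD lf.
split.
- move=> a u v; have [s Ds [fs ->]] := transferP u; have [t Dt [ft ->]] := transferP v.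
  rewrite -lg; apply: transferE; first exact: (proj2 hD).
  by rewrite lf fs ft (sum_proj_lin sK cf).
- have [c c0 hc] := gf; exists c => // u; have [s Ds [fs ->]] := transferP u.
  apply: le_trans (hc _ Ds) _; rewrite fs ler_wpM2l //.
  exact: sum_proj_norm.
- move=> c u Cc; have [s Ds [fs ->]] := transferP u.
  have [Drs frs <-] := hr Cc Ds; apply: transferE => //.
  rewrite frs fs sum_proj_ract // => d _ Cd [v Dv <-].
  by have [Drv <- _] := hr Cd Dv; exists (r d v).
- by move=> x y; have [s Ds [_ ->]] := transferP (sum_basis o x); exact: gH0.
Qed.

End DimIsoMap.

Lemma vn_dim_iso (X Y : finType) (V : lmodType R[i]) (D : set V)
    (f : V -> {ffun X -> L}) (g : V -> {ffun Y -> L}) (r : Q -> V -> V) :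
  submodule D -> lin f -> lin g ->
  (forall c v, C c -> D v ->
    [/\ D (r c v), f (r c v) = ract_sum c (f v) & g (r c v) = ract_sum c (g v)]) ->
  (forall v x, D v -> H0 (f v x)) -> (forall v y, D v -> H0 (g v y)) ->
  (exists2 c : R, 0 <= c & forall v, D v ->
    ipnorm (@sum_dot R L Y) (g v) <= c * ipnorm (@sum_dot R L X) (f v)) ->
  (exists2 c : R, 0 <= c & forall v, D v ->
    ipnorm (@sum_dot R L X) (f v) <= c * ipnorm (@sum_dot R L Y) (g v)) ->
  complete_for (ipnorm (@sum_dot R L X)) (f @` D) ->
  vn_dim o (f @` D) = vn_dim o (g @` D).
Proof.
move=> hD lf lg hr fH0 gH0 gf fg cf.
have cg := image_complete hD lf lg gf fg cf.
have hr' c v : C c -> D v ->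
  [/\ D (r c v), g (r c v) = ract_sum c (g v) & f (r c v) = ract_sum c (f v)].
  by move=> Cc Dv; have [] := hr c v Cc Dv.
have mT := transfer_modular hD lf lg hr gH0 gf cf.
have mS := transfer_modular hD lg lf hr' fH0 fg cg.
have TS u : transfer D g f (transfer D f g u) = sum_proj (f @` D) u.
  have [v Dv [fv ->]] := transferP hD lf lg gf cf u; rewrite -fv.
  apply: (transferE hD lg lf fg) => //.
  by rewrite sum_proj_id //; exact: (image_submodule hD lg).
have ST u : transfer D f g (transfer D g f u) = sum_proj (g @` D) u.
  have [v Dv [gv ->]] := transferP hD lg lf fg cg u; rewrite -gv.
  apply: (transferE hD lf lg gf) => //.
  by rewrite sum_proj_id //; exact: (image_submodule hD lf).
rewrite !vn_dimE; congr complex.Re.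
have := trace_sum_comm mT mS.
by under eq_bigr do rewrite TS; under [in X in _ = X -> _]eq_bigr do rewrite ST.
Qed.

End Modular.

(** * Derivations *)

Section StarHom.
Context {R : realType} {M Q : tracialVNA R} (h : M -> Q).
Hypothesis hh : star_hom h.

Lemma star_hom_lin : lin h.
Proof. by case: hh. Qed.

Lemma star_homM x y : h (x * y) = h x * h y.
Proof. by case: hh. Qed.

Lemma star_hom1 : h 1 = 1.
Proof. by case: hh. Qed.

Lemma star_hom_star x : h (vn_star x) = vn_star (h x).
Proof. by case: hh. Qed.

End StarHom.

Section Generation.
Context {R : realType} {M : tracialVNA R}.
Implicit Types (F S A : set M).

Lemma star_algebra_gen_subalg F : unital_star_subalgebra (star_algebra_gen F).
Proof.
split.
- by move=> S [].
- by move=> a x y hx hy S hS FS; case: (hS) => _ hl _ _; apply: hl; [exact: hx|exact: hy].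
- by move=> x y hx hy S hS FS; case: (hS) => _ _ hm _; apply: hm; [exact: hx|exact: hy].
- by move=> x hx S hS FS; case: (hS) => _ _ _; apply; exact: hx.
Qed.

Lemma sub_star_algebra_gen F : F `<=` star_algebra_gen F.
Proof. by move=> x Fx S _; apply. Qed.

End Generation.

(** * Algebraic tensor products and the enveloping algebra *)

Section AlgTensor.
Context {R : realType} {M P Q : tracialVNA R} (i : M -> Q) (j : P -> Q).
Hypothesis ht : is_vn_tensor i j.
Context (A : set M) (B : set P).

Lemma tensor_inl : star_hom i.
Proof. by case: ht => -[]. Qed.

Lemma tensor_inr : star_hom j.
Proof. by case: ht => -[]. Qed.

Lemma tensorC x y : i x * j y = j y * i x.
Proof. by case: ht. Qed.

Lemma tensor_tau x y : vn_tau (i x * j y) = vn_tau x * vn_tau y.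
Proof. by case: ht. Qed.

Lemma tensor_taul x : vn_tau (i x) = vn_tau x.
Proof.
by have := tensor_tau x 1; rewrite (star_hom1 tensor_inr) mulr1 vn_tau1 mulr1.
Qed.

Lemma tensor_taur y : vn_tau (j y) = vn_tau y.
Proof.
by have := tensor_tau 1 y; rewrite (star_hom1 tensor_inl) mul1r vn_tau1 mul1r.
Qed.

Lemma alg_tensor_elem a b : A a -> B b -> alg_tensor i j A B (i a * j b).
Proof.
by move=> Aa Bb; exists 1, (fun=> a), (fun=> b); split=> //; rewrite big_ord1.
Qed.

Lemma alg_tensor_ind (S : set Q) : submodule S ->
  (forall a b, A a -> B b -> S (i a * j b)) -> alg_tensor i j A B `<=` S.
Proof.
move=> hS h _ [n [a [b [Aa Bb ->]]]]; apply: (submodule_sum hS) => k.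
exact: h.
Qed.

Lemma alg_tensor_submodule : submodule A -> submodule (alg_tensor i j A B).
Proof.
move=> hA; split.
  exists 0, (fun=> 0), (fun=> 0); split; try by case.
  by rewrite big_ord0.
move=> c _ _ [n [a [b [Aa Bb ->]]]] [n' [a' [b' [Aa' Bb' ->]]]].
exists (n + n')%N.
exists (fun k => match fintype.split k with inl k => c *: a k | inr k => a' k end).
exists (fun k => match fintype.split k with inl k => b k | inr k => b' k end).
split.
- by move=> k; case: fintype.split => // l; exact: (submoduleZ hA).
- by move=> k; case: fintype.split.
rewrite big_split_ord scaler_sumr; congr (_ + _); apply: eq_bigr => k _.
  have -> : fintype.split (lshift n' k) = inl k by rewrite -[lshift _ _]/(unsplit (inl k)) unsplitK.
  by rewrite (linZ (star_hom_lin tensor_inl)) scalerAl.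
by have -> : fintype.split (rshift n k) = inr k by rewrite -[rshift _ _]/(unsplit (inr k)) unsplitK.
Qed.

Lemma alg_tensor_subalg : unital_star_subalgebra A -> unital_star_subalgebra B ->
  unital_star_subalgebra (alg_tensor i j A B).
Proof.
move=> hA hB; have hT := alg_tensor_submodule (subalg_submodule hA).
have [A1 _ AM Astar] := hA; have [B1 _ BM Bstar] := hB.
split.
- rewrite -[1]mulr1 -{1}(star_hom1 tensor_inl) -(star_hom1 tensor_inr).
  exact: alg_tensor_elem.
- exact: (proj2 hT).
- move=> _ _ [n [a [b [Aa Bb ->]]]] [n' [a' [b' [Aa' Bb' ->]]]].
  rewrite mulr_suml; apply: (submodule_sum hT) => k.
  rewrite mulr_sumr; apply: (submodule_sum hT) => l.
  rewrite mulrA -[i (a k) * _ * _]mulrA -tensorC mulrA -(star_homM tensor_inl).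
  rewrite -mulrA -(star_homM tensor_inr); apply: alg_tensor_elem; [exact: AM|exact: BM].
- move=> _ [n [a [b [Aa Bb ->]]]]; rewrite star_sum.
  apply: (submodule_sum hT) => k; rewrite starM -(star_hom_star tensor_inl).
  rewrite -(star_hom_star tensor_inr) -tensorC; apply: alg_tensor_elem.
    exact: Astar.
  exact: Bstar.
Qed.

End AlgTensor.

Section Enveloping.
Context {R : realType} {M : tracialVNA R} (E : enveloping M).
Implicit Types (x y z : M) (A : set M).
Local Notation T := (env_tensor E).
Local Notation H := (env_L2 E).
Local Notation hat := (@l2_hat R _ H).
Local Notation o := (env_one E).
Local Notation nm := hnorm.

Lemma opp_lin : lin (@env_opp R M E).
Proof. by case: (env_oppP E). Qed.

Lemma oppM x y : env_opp E (x * y) = env_opp E y * env_opp E x.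
Proof. by case: (env_oppP E). Qed.

Lemma opp_star x : env_opp E (vn_star x) = vn_star (env_opp E x).
Proof. by case: (env_oppP E). Qed.

Lemma opp_tau x : vn_tau (env_opp E x) = vn_tau x.
Proof. by case: (env_oppP E). Qed.

Lemma opp1 : env_opp E 1 = 1.
Proof.
have [_ [g gK Kg] _ _ _] := env_oppP E.
by rewrite -[LHS]mul1r -{1}(Kg 1) -oppM mul1r Kg.
Qed.

Lemma tensM x y x' y' : T x y * T x' y' = T (x * x') (y' * y).
Proof.
have ht := env_tensorP E; have hl := tensor_inl ht; have hr := tensor_inr ht.
rewrite /env_tensor oppM (star_homM hl) (star_homM hr) mulrA.
by rewrite -[_ * env_inr _ * _]mulrA -(tensorC ht) !mulrA.
Qed.

Lemma tens_star x y : vn_star (T x y) = T (vn_star x) (vn_star y).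
Proof.
have ht := env_tensorP E.
rewrite /env_tensor starM -(star_hom_star (tensor_inl ht)).
by rewrite -(star_hom_star (tensor_inr ht)) -opp_star -(tensorC ht).
Qed.

Lemma tens_tau x y : vn_tau (T x y) = vn_tau x * vn_tau y.
Proof. by rewrite (tensor_tau (env_tensorP E)) opp_tau. Qed.

Lemma tens_linl y : lin (fun x => T x y).
Proof.
move=> a u v; rewrite /env_tensor (star_hom_lin (tensor_inl (env_tensorP E))).
by rewrite mulrDl scalerAl.
Qed.

Lemma tens_linr x : lin (fun y => T x y).
Proof.
move=> a u v; rewrite /env_tensor opp_lin.
by rewrite (star_hom_lin (tensor_inr (env_tensorP E))) mulrDr scalerAr.
Qed.

Lemma tens11 : T 1 1 = 1.
Proof.
have ht := env_tensorP E.
by rewrite /env_tensor opp1 (star_hom1 (tensor_inl ht)) (star_hom1 (tensor_inr ht)) mulr1.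
Qed.

Lemma opp_subalg A : unital_star_subalgebra A ->
  unital_star_subalgebra (@env_opp R M E @` A).
Proof.
move=> [A1 Al AM As]; split.
- by exists 1 => //; exact: opp1.
- move=> a _ _ [x Ax <-] [y Ay <-]; exists (a *: x + y); last exact: opp_lin.
  exact: Al.
- by move=> _ _ [x Ax <-] [y Ay <-]; exists (y * x); [exact: AM|exact: oppM].
- by move=> _ [x Ax <-]; exists (vn_star x); [exact: As|exact: opp_star].
Qed.

Lemma env_sub_subalg A : unital_star_subalgebra A -> unital_star_subalgebra (@env_sub R M E A).
Proof.
by move=> hA; apply: (alg_tensor_subalg (env_tensorP E)) => //; exact: opp_subalg.
Qed.

Lemma env_sub_elem A x y : A x -> A y -> @env_sub R M E A (T x y).
Proof. by move=> Ax Ay; apply: alg_tensor_elem => //; exists y. Qed.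

Lemma env_sub_ind A (S : set (env_alg E)) : submodule S ->
  (forall a b, A a -> A b -> S (T a b)) -> @env_sub R M E A `<=` S.
Proof. by move=> hS h; apply: alg_tensor_ind => // a _ Aa [b Ab <-]; exact: h. Qed.

Lemma norm_tensl x : nm (hat (T x 1)) = norm2 x.
Proof.
rewrite norm_hat /norm2 /ipnorm /tau_form tens_star tensM tens_tau.
by rewrite star1 mulr1 vn_tau1 mulr1.
Qed.

Lemma norm_tensr x : nm (hat (T 1 x)) = norm2 x.
Proof.
rewrite norm_hat /norm2 /ipnorm /tau_form tens_star tensM tens_tau.
by rewrite star1 mulr1 vn_tau1 mul1r vn_tau_tracial.
Qed.

(** x |-> x (x) 1 is isometric from the 2-norm into L^2(M (x) M°), where left multiplication is
    bounded. *)
Lemma norm2_mull x : exists2 c : R, 0 <= c & forall y, norm2 (x * y) <= c * norm2 y.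
Proof.
have [c c0 hc] := act_lipschitz (L := H) (T x 1); exists c => // y.
have := hc (hat (T y 1)); rewrite l2_act_hat tensM mulr1.
by rewrite !norm_tensl.
Qed.

Lemma norm2_mulr x : exists2 c : R, 0 <= c & forall y, norm2 (y * x) <= c * norm2 y.
Proof.
have [c c0 hc] := norm2_mull (vn_star x); exists c => // y.
by rewrite -norm2_star starM -[norm2 y]norm2_star.
Qed.

End Enveloping.

Lemma tau_mul_le (R : realType) (M : tracialVNA R) (x y : M) :
  cabs (vn_tau (x * y)) <= norm2 x * norm2 y.
Proof.
have := cauchy_schwarz (@tau_form_inner_product R M) y (vn_star x).
by rewrite /tau_form starK -[ipnorm _ (vn_star x)]/(norm2 _) norm2_star mulrC.
Qed.

(** * Derivations and the domain of their adjoint *)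

Section Derivations.
Context {R : realType} {M : tracialVNA R} (E : enveloping M) (A : set M).
Hypothesis hA : unital_star_subalgebra A.
Implicit Types (x y : M) (delta : M -> env_L2 E).
Local Notation T := (env_tensor E).
Local Notation H := (env_L2 E).
Local Notation hat := (@l2_hat R _ H).
Local Notation o := (env_one E).
Local Notation nm := hnorm.
Local Notation H0 := (@env_L2_sub R M E A).
Local Notation C := (@env_sub R M E A).

Let hC : unital_star_subalgebra C := env_sub_subalg E hA.
Let A1 : A 1. Proof. by case: hA. Qed.
Let AM x y : A x -> A y -> A (x * y). Proof. by case: hA => _ _ + _; apply. Qed.
Let Astar x : A x -> A (vn_star x). Proof. by case: hA => _ _ _; apply. Qed.
Let hAm : submodule A := subalg_submodule hA.
Let hH0 : submodule H0 := @H0_submodule R _ H C hC.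

Lemma derivation_values delta x : derivation A delta -> A x -> H0 (delta x).
Proof. by case=> h _ _; exact: h. Qed.

Lemma derivationL delta (a : R[i]) x y : derivation A delta -> A x -> A y ->
  delta (a *: x + y) = a *: delta x + delta y.
Proof. by case=> _ h _; exact: h. Qed.

Lemma derivationM delta x y : derivation A delta -> A x -> A y ->
  delta (x * y) = l2_act (T x 1) (delta y) + l2_act (T 1 y) (delta x).
Proof. by case=> _ _ h; exact: h. Qed.

Lemma derivationD delta x y : derivation A delta -> A x -> A y ->
  delta (x + y) = delta x + delta y.
Proof. by move=> d Ax Ay; have := derivationL 1 d Ax Ay; rewrite !scale1r. Qed.

Lemma derivation0 delta : derivation A delta -> delta 0 = 0.
Proof.
move=> d; have A0 : A 0 by case: hAm.
by apply: (addrI (delta 0)); rewrite -derivationD // !addr0.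
Qed.

Lemma derivationZ delta a x : derivation A delta -> A x ->
  delta (a *: x) = a *: delta x.
Proof.
move=> d Ax; have A0 : A 0 by case: hAm.
by rewrite -[a *: x]addr0 (derivationL _ d) // (derivation0 d) addr0.
Qed.

Lemma derivation1 delta : derivation A delta -> delta 1 = 0.
Proof.
move=> d; apply: (addrI (delta 1)); rewrite addr0.
by have := derivationM d A1 A1; rewrite mulr1 tens11 !act1.
Qed.

Lemma derivation_submodule : submodule (derivation (E := E) A).
Proof.
split; first split.
- by move=> x _; case: hH0.
- by move=> a x y _ _; rewrite /= /cst /= scaler0 addr0.
- by move=> x y _ _; rewrite /= /cst /bimod_act !(lin0 (act_lin _)) addr0.
move=> a d d' hd hd'; split.
- by move=> x Ax; apply: (proj2 hH0); exact: derivation_values.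
- move=> b x y Ax Ay.
  change (a *: d (b *: x + y) + d' (b *: x + y) =
    b *: (a *: d x + d' x) + (a *: d y + d' y)).
  rewrite (derivationL _ hd) // (derivationL _ hd') // !scalerDr !scalerA [b * a]mulrC.
  by rewrite addrACA.
- move=> x y Ax Ay; rewrite /bimod_act.
  change (a *: d (x * y) + d' (x * y) = l2_act (T x 1) (a *: d y + d' y) +
    l2_act (T 1 y) (a *: d x + d' x)).
  rewrite (derivationM hd) // (derivationM hd') // !(act_lin _ a) scalerDr.
  by rewrite addrACA.
Qed.

(** Leibniz' rule makes the points at which evaluation is bounded by N, uniformly over P, a
    subalgebra. N is left open: it is the norm of [phi X] in one application and that of [split_der]
    in another. F may be infinite. *)
Lemma derivation_bound (F : set M) (P : set (M -> H)) (N : (M -> H) -> R) :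
  A = star_algebra_gen F -> (forall x, F x -> F (vn_star x)) ->
  P `<=` derivation (E := E) A -> (forall delta, 0 <= N delta) ->
  (forall x, F x -> exists2 c : R, 0 <= c & forall delta, P delta ->
     nm (delta x) <= c * N delta) ->
  forall x, A x -> exists2 c : R, 0 <= c & forall delta, P delta ->
     nm (delta x) <= c * N delta.
Proof.
move=> AF Fstar PD N0 hF.
pose bd x := A x /\ exists2 c : R, 0 <= c & forall delta, P delta ->
     nm (delta x) <= c * N delta.
have bdL a x y : bd x -> bd y -> bd (a *: x + y).
  move=> [Ax [c c0 hc]] [Ay [d d0 hd]]; split; first exact: (proj2 hAm).
  exists (cabs a * c + d) => [|dl Pd]; first by rewrite addr_ge0 ?mulr_ge0 ?cabs_ge0.
  rewrite (derivationL _ (PD _ Pd)) //.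
  have := hnormD (a *: dl x) (dl y); rewrite hnormZ.
  have := ler_wpM2l (cabs_ge0 a) (hc _ Pd); have := hd _ Pd; lra.
have bdM x y : bd x -> bd y -> bd (x * y).
  move=> [Ax [c c0 hc]] [Ay [d d0 hd]]; split; first exact: AM.
  have [k k0 hk] := act_lipschitz (L := H) (T x 1).
  have [l l0 hl] := act_lipschitz (L := H) (T 1 y).
  exists (k * d + l * c) => [|dl Pd]; first by rewrite addr_ge0 ?mulr_ge0.
  rewrite (derivationM (PD _ Pd)) //.
  have := hnormD (l2_act (T x 1) (dl y)) (l2_act (T 1 y) (dl x)).
  have := hk (dl y); have := hl (dl x).
  have := ler_wpM2l k0 (hd _ Pd); have := ler_wpM2l l0 (hc _ Pd); lra.
have FA x : F x -> A x by rewrite AF; exact: sub_star_algebra_gen.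
have FB x : F x -> bd x by move=> Fx; split; [exact: FA|exact: hF].
(* A derivation need not respect the involution; asking for the bound at x and at x^* yields a
   *-subalgebra. *)
pose S x := bd x /\ bd (vn_star x).
suff AS : A `<=` S by move=> x /AS[[_]].
rewrite AF => x; apply; last by move=> y Fy; split; apply: FB => //; exact: Fstar.
have bd1 : bd 1.
  split=> //; exists 0 => // dl Pd; rewrite (derivation1 (PD _ Pd)) hnorm0.
  by rewrite mul0r.
split.
- by rewrite /S star1.
- by move=> a u v [? ?] [? ?]; rewrite /S starL; split; exact: bdL.
- by move=> u v [? ?] [? ?]; rewrite /S starM; split; exact: bdM.
- by move=> u [? ?]; rewrite /S starK.
Qed.

Definition der_bounded delta (zeta : H) : Prop :=
  exists2 c : R, 0 <= c & forall x, A x -> cabs '[delta x, zeta] <= c * norm2 x.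

Lemma dom_adjointP delta zeta : dom_adjoint A delta zeta <-> der_bounded delta zeta.
Proof.
split=> [[c hc]|[c c0 hc]].
  (* Evaluation at 1, whose 2-norm is 1, shows that c is real and nonnegative. *)
  have c0 : 0 <= c.
    by have := hc 1 A1; rewrite star1 mulr1 vn_tau1 sqrtC1 mulr1; apply: le_trans.
  exists (complex.Re c) => [|x /hc]; first exact: Re_ge0.
  by rewrite -cabsE -norm2_sqrtC -{1}(ge0_ReE c0) -rmorphM /= lecR.
exists c%:C => x /hc; rewrite -lecR cabsE rmorphM /= norm2_sqrtC.
by [].
Qed.

Lemma der_boundedL delta zeta zeta' a : der_bounded delta zeta ->
  der_bounded delta zeta' -> der_bounded delta (a *: zeta + zeta').
Proof.
move=> [c c0 hc] [d d0 hd]; exists (cabs a * c + d) => [|x Ax].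
  by rewrite addr_ge0 ?mulr_ge0 ?cabs_ge0.
rewrite hdotDr hdotZr; have := cabsD (a^* * '[delta x, zeta]) '[delta x, zeta'].
rewrite cabsM cabs_conj; have := ler_wpM2l (cabs_ge0 a) (hc x Ax).
have := hd x Ax; lra.
Qed.

Lemma der_bounded_combo delta delta' zeta a : der_bounded delta zeta ->
  der_bounded delta' zeta -> der_bounded (a *: delta + delta') zeta.
Proof.
move=> [c c0 hc] [d d0 hd]; exists (cabs a * c + d) => [|x Ax].
  by rewrite addr_ge0 ?mulr_ge0 ?cabs_ge0.
change (cabs '[a *: delta x + delta' x, zeta] <= (cabs a * c + d) * norm2 x).
rewrite hdotDl hdotZl; have := cabsD (a * '[delta x, zeta]) '[delta' x, zeta].
rewrite cabsM; have := ler_wpM2l (cabs_ge0 a) (hc x Ax).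
have := hd x Ax; lra.
Qed.

Lemma der_bounded0 delta : der_bounded delta 0.
Proof. by exists 0 => // x _; rewrite hdot0r cabs0 mul0r. Qed.

(* Voiculescu: 1 (x) 1 in dom(delta^* ) forces A (x) A° in dom(delta^* ). *)
Lemma der_bounded_tensor delta a b : derivation A delta -> A a -> A b ->
  der_bounded delta o -> der_bounded delta (hat (T a b)).
Proof.
move=> hd Aa Ab [c c0 hc]; set a' := vn_star a; set b' := vn_star b.
have Aa' : A a' by exact: Astar.
have Ab' : A b' by exact: Astar.
have [k k0 hk] := norm2_mull E a'; have [l l0 hl] := norm2_mulr E b'.
have n1 := hnorm_ge0 (delta a'); have n2 := hnorm_ge0 (delta b').
exists (c * (k * l) + nm (delta b') * k + nm (delta a') * l) => [|x Ax].
  by rewrite !addr_ge0 ?mulr_ge0.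
have Axb : A (x * b') by exact: AM.
have e1 : hat (T a b) = l2_act (T a b) o by rewrite l2_act_hat mulr1.
(* Leibniz' rule on a' x b', solved for the middle term. Paired with 1 (x) 1, the first term is
   bounded by hypothesis and the other two by Cauchy-Schwarz, as x has moved into the other
   argument. *)
have e2 : l2_act (T a' b') (delta x) = delta (a' * (x * b'))
    - l2_act (T (a' * x) 1) (delta b') - l2_act (T 1 (x * b')) (delta a').
  rewrite (derivationM hd) // (derivationM hd Ax) // (linD (act_lin _)) -!actM.
  rewrite !tensM !mulr1.
  by rewrite addrAC addrK [X in X - _]addrC addrK.
rewrite e1 hdot_conj act_dot -hdot_conj tens_star -/a' -/b' e2 !hdotBl.
rewrite !act_dot !tens_star !star1 !l2_act_hat !mulr1.
have h1 := hc _ (AM Aa' Axb).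
have h2 := hdot_cs (delta b') (hat (T (vn_star (a' * x)) 1)).
have h3 := hdot_cs (delta a') (hat (T 1 (vn_star (x * b')))).
rewrite norm_tensl norm2_star in h2; rewrite norm_tensr norm2_star in h3.
apply: le_trans (cabsD _ _) _; rewrite cabsN.
apply: le_trans (lerD (cabsD _ _) (lexx _)) _; rewrite cabsN.
have h4 := ler_wpM2l n2 (hk x); have h5 := ler_wpM2l n1 (hl x).
have h6 : c * norm2 (a' * (x * b')) <= c * (k * l) * norm2 x.
  rewrite -mulrA ler_wpM2l //; apply: le_trans (hk _) _.
  by rewrite -mulrA ler_wpM2l.
lra.
Qed.

Lemma der_bounded_hat delta z : derivation A delta -> C z ->
  der_bounded delta o -> der_bounded delta (hat z).
Proof.
move=> hd Cz ho; move: z Cz; apply: env_sub_ind.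
  split; first by rewrite /= (lin0 hat_lin); exact: der_bounded0.
  by move=> a u v hu hv /=; rewrite hat_lin; exact: der_boundedL.
by move=> a b Aa Ab; exact: der_bounded_tensor.
Qed.

Definition rder c delta : M -> H := fun x => ract c (delta x).

Lemma rder_derivation c delta : C c -> derivation A delta -> derivation A (rder c delta).
Proof.
move=> Cc hd; split.
- by move=> x Ax; apply: H0_ract => //; exact: derivation_values.
- by move=> a x y Ax Ay; rewrite /rder (derivationL _ hd) // ract_lin.
- move=> x y Ax Ay; rewrite /rder (derivationM hd) // (linD (ract_lin c)).
  by rewrite !ract_act.
Qed.

(** <delta x c, 1 (x) 1> = <delta x, c^*>, and c^* is in the domain of the adjoint by
    [der_bounded_hat]. Hence the derivations in question form a right module over A (x) A°. *)
Lemma rder_Der11 c delta : C c -> Der11 A delta -> Der11 A (rder c delta).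
Proof.
move=> Cc [hd /dom_adjointP ho]; split; first exact: rder_derivation.
apply/dom_adjointP.
have Cs : C (vn_star c) by case: hC => _ _ _; apply.
have [k k0 hk] := der_bounded_hat hd Cs ho; exists k => // x Ax.
by rewrite /rder ract_dot ract_hat mul1r; exact: hk.
Qed.

Lemma Der11_submodule : submodule (Der11 (E := E) A).
Proof.
split.
  split; first by case: derivation_submodule.
  by apply/dom_adjointP; exists 0 => // x _; rewrite /= hdot0l cabs0 mul0r.
move=> a d d' [hd /dom_adjointP bd] [hd' /dom_adjointP bd']; split.
  exact: (proj2 derivation_submodule).
by apply/dom_adjointP; exact: der_bounded_combo.
Qed.

Definition inner (xi : H) : M -> H := fun x => l2_act (T x 1 - T 1 x) xi.

Lemma innerE xi x : inner xi x = l2_act (T x 1) xi - l2_act (T 1 x) xi.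
Proof. by rewrite /inner actD -scaleN1r actZ scaleN1r. Qed.

Lemma innerB xi eta : inner (xi - eta) = inner xi - inner eta.
Proof.
apply/funext => x.
change (inner (xi - eta) x = inner xi x - inner eta x).
by rewrite /inner (linB (act_lin _)).
Qed.

Lemma inner_derivation xi : H0 xi -> derivation A (inner xi).
Proof.
move=> Hxi; split.
- move=> x Ax; rewrite innerE; apply: (submoduleB hH0);
  by apply: H0_act => //; apply: env_sub_elem.
- move=> a x y Ax Ay; rewrite /inner (tens_linl E 1) (tens_linr E 1) opprD.
  by rewrite addrACA -scalerBr actL.
- move=> x y Ax Ay; rewrite !innerE /bimod_act !(linB (act_lin _)) -!actM !tensM.
  by rewrite !mulr1 !mul1r addrC addrA subrK addrC.
Qed.

(** For z = a (x) b° the pairing of [x, z] with 1 (x) 1 is tau(x a) tau(b) - tau(a) tau(b x), and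
    [tau_mul_le] bounds both terms. *)
Lemma inner_hat_Der11 z : C z -> Der11 A (inner (hat z)).
Proof.
move=> Cz; split; first by apply: inner_derivation; exact: H0_hat.
apply/dom_adjointP; move: z Cz; apply: env_sub_ind.
  split => [|a u v [c c0 hc] [d d0 hd]].
    exists 0 => // x _; rewrite /inner (lin0 hat_lin) (lin0 (act_lin _)).
    by rewrite hdot0l cabs0 mul0r.
  exists (cabs a * c + d) => [|x Ax]; first by rewrite addr_ge0 ?mulr_ge0 ?cabs_ge0.
  rewrite /inner hat_lin act_lin hdotDl hdotZl.
  apply: le_trans (cabsD _ _) _; rewrite cabsM.
  have := ler_wpM2l (cabs_ge0 a) (hc x Ax); have := hd x Ax; rewrite /inner; lra.
move=> a b Aa Ab.
exists (norm2 a * cabs (vn_tau b) + cabs (vn_tau a) * norm2 b).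
  by rewrite addr_ge0 ?mulr_ge0 ?cabs_ge0 ?ipnorm_ge0.
move=> x Ax; rewrite innerE !l2_act_hat !tensM hdotBl !l2_hat_dot !star1 !mul1r !mulr1.
rewrite !tens_tau; apply: le_trans (cabsD _ _) _; rewrite cabsN !cabsM.
have h1 := ler_wpM2r (cabs_ge0 (vn_tau b)) (tau_mul_le x a).
have h2 := ler_wpM2l (cabs_ge0 (vn_tau a)) (tau_mul_le b x).
lra.
Qed.

End Derivations.

Lemma le_mul_lt (R : realFieldType) (a b c e : R) :
  0 <= c -> 0 <= b -> a <= c * b -> b < e / (c + 1) -> a < e.
Proof.
move=> c0 b0 h; have c1 : 0 < c + 1 by rewrite ltr_wpDl.
rewrite ltr_pdivlMr //; lra.
Qed.

Section Limits.
Context {R : realType} {H H1 : hilbertType R}.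
Local Notation nm := hnorm.

Lemma cvg_for_unique (u : nat -> H) (l l' : H) :
  cvg_for nm u l -> cvg_for nm u l' -> l = l'.
Proof.
move=> h h'; apply/eqP; rewrite -subr_eq0; apply/eqP/hnorm_small => e e0.
have e2 : 0 < e / 2 by rewrite divr_gt0.
have [n1 h1] := h _ e2; have [n2 h2] := h' _ e2.
have := h1 (maxn n1 n2) (leq_maxl _ _); have := h2 (maxn n1 n2) (leq_maxr _ _).
have := hnorm_dist (u (maxn n1 n2)) l l'; rewrite (hnormBC l (u _)); lra.
Qed.

Lemma cvg_forL (a : R[i]) (u v : nat -> H) l l' : cvg_for nm u l -> cvg_for nm v l' ->
  cvg_for nm (fun n => a *: u n + v n) (a *: l + l').
Proof.
move=> hu hv e e0; pose c := cabs a + 1.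
have c0 : 0 < c by rewrite ltr_wpDl // cabs_ge0.
have e2 : 0 < e / 2 by rewrite divr_gt0.
have [n1 h1] := hu _ (divr_gt0 e2 c0); have [n2 h2] := hv _ e2.
exists (maxn n1 n2) => n; rewrite geq_max => /andP[/h1 + /h2].
rewrite opprD addrACA -scalerBr ltr_pdivlMr // /c.
have := hnormD (a *: (u n - l)) (v n - l'); rewrite hnormZ.
have := hnorm_ge0 (u n - l); lra.
Qed.

Lemma cvg_for_map (f : H -> H1) (u : nat -> H) l : lin f -> lipschitz_for nm nm f ->
  cvg_for nm u l -> cvg_for nm (f \o u) (f l).
Proof.
move=> lf [c c0 hc] h e e0; have c1 : 0 < c + 1 by rewrite ltr_wpDl.
have [n0 hn0] := h _ (divr_gt0 e0 c1); exists n0 => n /hn0.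
rewrite ltr_pdivlMr //= -(linB lf); have := hc (u n - l).
have := hnorm_ge0 (u n - l); lra.
Qed.

Lemma cvg_for_closed (S : set H) (u : nat -> H) l :
  (forall n, closure S (u n)) -> cvg_for nm u l -> closure S l.
Proof.
move=> Su h; apply: hclosure_idem => e /h[n0 hn0]; exists (u n0) => //.
by rewrite hnormBC; exact: hn0.
Qed.

Lemma sum_norm_bound (X : finType) (T : Type) (D : set T) (N : T -> R)
    (f : T -> {ffun X -> H}) : (forall t, 0 <= N t) ->
  (forall x, exists2 c : R, 0 <= c & forall t, D t -> nm (f t x) <= c * N t) ->
  exists2 c : R, 0 <= c & forall t, D t -> ipnorm (@sum_dot R H X) (f t) <= c * N t.
Proof.
move=> N0 h.
have /choice[c hc] x : exists c : R, 0 <= c /\ forall t, D t -> nm (f t x) <= c * N t.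
  by have [c c0 hc] := h x; exists c.
exists (\sum_x c x) => [|t Dt]; first by apply: sumr_ge0 => x _; case: (hc x).
apply: le_trans (sum_norm_le _) _; rewrite mulr_suml; apply: ler_sum => x _.
by case: (hc x) => _; apply.
Qed.

End Limits.

(** * The closure of the derivations with 1 (x) 1 in the domain of the adjoint *)

Section Closure.
Context {R : realType} {M : tracialVNA R} (E : enveloping M) (A : set M).
Hypothesis hA : unital_star_subalgebra A.
Context (X : {fset M}).
Hypothesis genX : sa_generating A X.
Local Notation H := (env_L2 E).
Implicit Types (x y : M) (delta : M -> H).
Local Notation T := (env_tensor E).
Local Notation hat := (@l2_hat R _ H).
Local Notation o := (env_one E).
Local Notation nm := hnorm.
Local Notation H0 := (@env_L2_sub R M E A).
Local Notation C := (@env_sub R M E A).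
Local Notation nX := (ipnorm (@sum_dot R H X)).
Local Notation phiX := (@phi R M E X).
Local Notation DX := (@Der11_closure R M E A X).

Let hC : unital_star_subalgebra C := env_sub_subalg E hA.
Let hH0 : submodule H0 := @H0_submodule R _ H C hC.
Let subX x : x \in X -> A x.
Proof. by case: genX => _ -> Xx; exact: sub_star_algebra_gen. Qed.

Lemma phi_lin : lin phiX.
Proof. by move=> a d d'; apply/ffunP => x; rewrite !ffunE. Qed.

Lemma der_norm2E delta : der_norm2 X delta = (nX (phiX delta) ^+ 2)%:C.
Proof.
rewrite sum_norm_sqr rmorph_sum; apply: eq_bigr => x _.
by rewrite rmorphXn /= hnormE ffunE.
Qed.

Lemma Der11_closureP delta : DX delta <-> derivation A delta /\
  forall e : R, 0 < e -> exists2 delta', Der11 A delta' &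
    nX (phiX (delta - delta')) < e.
Proof.
split=> -[hd h]; split=> // e e0.
  have e2 : 0 < (e ^+ 2)%:C by rewrite ltcR exprn_gt0.
  have [d' hd' hlt] := h _ e2; exists d' => //.
  move: hlt; rewrite (der_norm2E (delta - d')) ltcR.
  by rewrite ltr_pXn2r ?nnegrE ?ipnorm_ge0 // ltW.
have e2 : 0 < complex.Re e by rewrite -ltcR ge0_ReE // ltW.
have [|d' hd' hlt] := h (Num.sqrt (complex.Re e)); first by rewrite sqrtr_gt0.
exists d' => //; rewrite (der_norm2E (delta - d')) -(ge0_ReE (ltW e0)) ltcR.
rewrite -(sqr_sqrtr (ltW e2)) ltr_pXn2r ?nnegrE ?ipnorm_ge0 ?sqrtr_ge0 //.
Qed.

Lemma derivation_bound_gen x : A x -> exists2 c : R, 0 <= c &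
  forall delta, derivation A delta -> nm (delta x) <= c * nX (phiX delta).
Proof.
have [Xs AX] := genX.
move: x; apply: (derivation_bound hA AX Xs) => //.
  by move=> d; exact: ipnorm_ge0.
move=> x Xx; exists 1 => // d _; rewrite mul1r.
have := coord_norm_le (phiX d) [` Xx]%fset; by rewrite ffunE.
Qed.

Lemma Der11_sub_closure : Der11 A `<=` DX.
Proof.
move=> d hd; apply/Der11_closureP; split; first by case: hd.
move=> e e0; exists d => //; rewrite subrr (lin0 phi_lin).
by rewrite (ipnorm0 sum_dot_inner_product).
Qed.

Lemma Der11_closure_submodule : submodule DX.
Proof.
have sD := derivation_submodule E hA; have sD1 := Der11_submodule E hA.
split; first by apply: Der11_sub_closure; case: sD1.
move=> a u v /Der11_closureP[du cu] /Der11_closureP[dv cv]; apply/Der11_closureP.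
split; first exact: (proj2 sD).
move=> e e0; pose c := cabs a + 1.
have c0 : 0 < c by rewrite ltr_wpDl // cabs_ge0.
have e2 : 0 < e / 2 by rewrite divr_gt0.
have [u' hu' lu] := cu _ (divr_gt0 e2 c0); have [v' hv' lv] := cv _ e2.
exists (a *: u' + v'); first exact: (proj2 sD1).
rewrite opprD addrACA -scalerBr phi_lin; move: lu; rewrite ltr_pdivlMr // /c.
have := ipnormD (@sum_dot_inner_product R H X) (a *: phiX (u - u')) (phiX (v - v')).
rewrite (ipnormZ (@sum_dot_inner_product R H X)).
have := ipnorm_ge0 (@sum_dot R H X) (phiX (u - u')); lra.
Qed.

Lemma phi_ract c delta : phiX (rder c delta) = ract_sum c (phiX delta).
Proof. by apply/ffunP => x; rewrite !ffunE. Qed.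

Lemma Der11_closure_rder c delta : C c -> DX delta -> DX (rder c delta).
Proof.
move=> Cc /Der11_closureP[hd cl]; apply/Der11_closureP.
split; first exact: rder_derivation.
have [k k0 hk] := ract_lipschitz (L := H) c.
have [l l0 hl] : exists2 l : R, 0 <= l & forall d : M -> H, True ->
    nX (phiX (rder c d)) <= l * nX (phiX d).
  apply: sum_norm_bound => [d|x]; first exact: ipnorm_ge0.
  exists k => // d _; rewrite ffunE; apply: le_trans (hk _) _.
  rewrite ler_wpM2l //; have := coord_norm_le (phiX d) x; by rewrite ffunE.
have l1 : 0 < l + 1 by rewrite ltr_wpDl.
move=> e e0; have [d' hd' hlt] := cl _ (divr_gt0 e0 l1); exists (rder c d').
  exact: rder_Der11.
have -> : rder c delta - rder c d' = rder c (delta - d').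
  apply/funext => x; change (ract c (delta x) - ract c (d' x) = ract c (delta x - d' x)).
  by rewrite (linB (ract_lin c)).
by apply: le_mul_lt (hl (delta - d') Logic.I) hlt => //; exact: ipnorm_ge0.
Qed.

Lemma inner_bound x : exists2 c : R, 0 <= c & forall xi : H, nm (inner xi x) <= c * nm xi.
Proof. exact: act_lipschitz. Qed.

(** The inner derivation depends continuously on xi in the norm of the generators, and the vectors
    hat z treated in [inner_hat_Der11] are dense. *)
Lemma inner_Der11_closure xi : H0 xi -> DX (inner xi).
Proof.
move=> Hxi; apply/Der11_closureP; split; first exact: inner_derivation.
move=> e e0.
have [l l0 hl] : exists2 l : R, 0 <= l & forall xi : H, True ->
    nX (phiX (inner xi)) <= l * nm xi.
  apply: sum_norm_bound => [z|x]; first exact: hnorm_ge0.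
  by have [c c0 hc] := inner_bound (val x); exists c => // z _; rewrite ffunE.
have l1 : 0 < l + 1 by rewrite ltr_wpDl.
move/hclosureP: Hxi => /(_ _ (divr_gt0 e0 l1)) [_ [z Cz <-] hz].
exists (inner (hat z)); first exact: inner_hat_Der11.
rewrite -innerB; apply: le_mul_lt (hl (xi - hat z) Logic.I) hz => //.
exact: hnorm_ge0.
Qed.

(** By [derivation_bound_gen], convergence on the generators forces pointwise convergence on A;
    Leibniz' rule and the linearity relation pass to the limit. *)
Lemma Der11_closure_complete : complete_for nX (phiX @` DX).
Proof.
move=> u Ku cau.
have /choice[d hd] n : exists d, DX d /\ phiX d = u n by have [d] := Ku n; exists d.
have dd n : derivation A (d n) by have [/Der11_closureP[]] := hd n.
have sD := derivation_submodule E hA.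
have /choice[l hl] x : exists l, A x -> cvg_for nm (fun n => d n x) l.
  (* Outside A the value is arbitrary; 0 is taken. *)
  have [Ax|nAx] := pselect (A x); last by exists 0.
  have [|l _ hl] := @hcomplete R H (fun n => d n x) (fun=> Logic.I); last by exists l.
  have [c c0 hc] := derivation_bound_gen Ax.
  have c1 : 0 < c + 1 by rewrite ltr_wpDl.
  move=> e e0; have [n0 hn0] := cau _ (divr_gt0 e0 c1); exists n0 => n m hn hm.
  have := hn0 n m hn hm; have [_ <-] := hd n; have [_ <-] := hd m.
  rewrite -(linB phi_lin); apply: le_mul_lt => //; first exact: ipnorm_ge0.
  exact: hc _ (submoduleB sD (dd n) (dd m)).
have [A1 AL AM _] := hA.
have dl : derivation A l.
  split.
  - move=> x Ax; apply: cvg_for_closed (hl x Ax) => n.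
    exact: derivation_values.
  - move=> a x y Ax Ay; apply: (cvg_for_unique (hl _ (AL a x y Ax Ay))).
    suff -> : (fun n => d n (a *: x + y)) = (fun n => a *: d n x + d n y).
      exact: cvg_forL (hl x Ax) (hl y Ay).
    by apply/funext => n; exact: derivationL.
  - move=> x y Ax Ay; apply: (cvg_for_unique (hl _ (AM x y Ax Ay))).
    have h1 := cvg_for_map (act_lin (T x 1)) (act_lipschitz _) (hl y Ay).
    have h2 := cvg_for_map (act_lin (T 1 y)) (act_lipschitz _) (hl x Ax).
    have := cvg_forL 1 h1 h2; rewrite scale1r; congr cvg_for.
    by apply/funext => n /=; rewrite scale1r (derivationM (dd n)).
have cl : cvg_for nX u (phiX l).
  move=> e e0; have [r r0 hr] := @sum_norm_lt R H X e e0.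
  have /choice[n0 hn0] (x : X) := hl (val x) (subX (valP x)) r r0.
  exists (\max_x n0 x)%N => n hn; apply: hr => x.
  have [_ <-] := hd n; rewrite !ffunE.
  by apply: hn0; apply: leq_trans hn; exact: leq_bigmax.
exists (phiX l) => //; exists l => //; apply/Der11_closureP; split=> // e e0.
have e2 : 0 < e / 2 by rewrite divr_gt0.
have [n0 hn0] := cl _ e2; have [/Der11_closureP[_ cn] un] := hd n0.
have [d' hd' hlt] := cn _ e2; exists d' => //.
have := hn0 n0 (leqnn _); rewrite -un (ipnormBC sum_dot_inner_product).
have := ipnorm_dist (@sum_dot_inner_product R H X) (phiX (d n0)) (phiX l) (phiX d').
rewrite -!(linB phi_lin); move: hlt; lra.
Qed.

End Closure.

(** * Splitting off the inner part on B *)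

Definition bilin (R : realType) (U V W : lmodType R[i]) (F : U -> V -> W) : Prop :=
  (forall y, lin (F^~ y)) /\ (forall x, lin (F x)).

(** * Orthonormal bases and the Casimir tensor of a finite dimensional algebra *)

Section FiniteDimensional.
Context {R : realType} {B : tracialVNA R}.
Implicit Types (x y : B).
Local Notation star := (@vn_star R B).
Local Notation tf := (@tau_form R B).
Local Notation tip := (@tau_form_inner_product R B).

Definition orthonormal_seq (s : seq B) : Prop :=
  uniq s /\ {in s &, forall x y, tf x y = (x == y)%:R}.

Definition seq_proj (s : seq B) x : B := \sum_(b <- s) tf x b *: b.

Lemma seq_proj_lin s : lin (seq_proj s).
Proof.
move=> a x y; rewrite /seq_proj scaler_sumr -big_split /=; apply: eq_bigr => b _.
by rewrite (ip_linear tip) scalerDl scalerA.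
Qed.

Lemma tau_form_suml (s : seq B) (F : B -> B) y :
  tf (\sum_(b <- s) F b) y = \sum_(b <- s) tf (F b) y.
Proof. by rewrite /tau_form mulr_sumr tau_sum. Qed.

Lemma seq_proj_dot s x y : orthonormal_seq s -> y \in s -> tf (seq_proj s x) y = tf x y.
Proof.
move=> [us os] ys; rewrite /seq_proj tau_form_suml (bigD1_seq y) //= (ip_Zl tip).
rewrite (os y y ys ys) eqxx mulr1 big_seq_cond big1 ?addr0 // => b /andP[bs by_].
by rewrite (ip_Zl tip) (os b y bs ys) (negbTE by_) mulr0.
Qed.

(** A vector is added only if its component orthogonal to s is nonzero, so l may be linearly
    dependent. *)
Lemma gram_schmidt (l : seq B) : exists s, orthonormal_seq s /\ {in l, forall x, seq_proj s x = x}.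
Proof.
elim: l => [|x l [s [os hs]]]; first by exists [::]; split=> //; split.
pose y := x - seq_proj s x.
have yorth b : b \in s -> tf y b = 0.
  by move=> bs; rewrite /y (ip_Bl tip) seq_proj_dot // subrr.
have [y0|yn] := eqVneq y 0.
  exists s; split=> // z; rewrite inE => /orP[/eqP ->|]; last exact: hs.
  by apply/esym/eqP; rewrite -subr_eq0 -/y y0.
pose n := norm2 y.
have nn : n != 0.
  apply: contra_neq yn => n0; apply: tau_starM_eq0.
  by rewrite -[LHS](ipnormKC tip) -/(norm2 y) -/n n0 expr0n.
have n2 : tf y y = n%:C ^+ 2 by rewrite -rmorphXn /= (ipnormKC tip).
have nC : n%:C != 0 :> R[i] by rewrite -(inj_eq (@complexI R)) in nn.
pose y' := n%:C^-1 *: y.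
have c' : (n%:C^-1)^* = n%:C^-1 :> R[i] by rewrite -fmorphV conj_real.
have yy' : tf y' y' = 1.
  rewrite (ip_Zl tip) (ip_Zr tip) n2 c' mulrA -invfM -expr2 mulVf //.
  by rewrite expf_neq0.
have y'orth b : b \in s -> tf y' b = 0.
  by move=> bs; rewrite (ip_Zl tip) yorth // mulr0.
have y'orth' b : b \in s -> tf b y' = 0.
  by move=> bs; rewrite (ip_conj tip) y'orth // rmorph0.
have [us hos] := os.
have y's : y' \notin s.
  apply/negP => /y'orth h; have := oner_neq0 R[i]; by rewrite -yy' h eqxx.
exists (y' :: s); split; first split.
- by rewrite /= y's.
- move=> a b; rewrite !inE => /orP[/eqP ->|ha] /orP[/eqP ->|hb].
  + by rewrite yy' eqxx.
  + rewrite y'orth //; case: eqP => // e; by rewrite e hb in y's.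
  + rewrite y'orth' //; case: eqP => // e; by rewrite -e ha in y's.
  + exact: hos.
have proj0 z : tf (seq_proj s z) y' = 0.
  rewrite /seq_proj tau_form_suml big_seq big1 // => b bs.
  by rewrite (ip_Zl tip) y'orth' // mulr0.
move=> z; rewrite inE /seq_proj big_cons -/(seq_proj s z) => /orP[/eqP ->|zl].
  have -> : tf x y' = n%:C.
    rewrite -[x](subrK (seq_proj s x)) (ip_Dl tip) proj0 addr0 (ip_Zr tip) n2 c'.
    by rewrite expr2 mulKf.
  by rewrite scalerA divff // scale1r subrK.
by rewrite -{1}(hs z zl) proj0 scale0r add0r hs.
Qed.

Lemma orthonormal_basis : finite_dimensional B ->
  exists (m : nat) (b : 'I_m -> B),
    (forall s t : 'I_m, vn_tau (star (b t) * b s) = (s == t)%:R) /\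
    forall x, x = \sum_s vn_tau (star (b s) * x) *: b s.
Proof.
move=> [n [v hv]].
have [s [[us os] hs]] := gram_schmidt [seq v k | k <- enum 'I_n].
have hall x : seq_proj s x = x.
  have [c ->] := hv x; rewrite (lin_sum (seq_proj_lin s)); apply: eq_bigr => k _.
  rewrite (linZ (seq_proj_lin s)) hs //; apply: map_f; exact: mem_enum.
exists (size s), (fun k => tnth (in_tuple s) k); split=> [k l|x].
  rewrite -[LHS]/(tf _ _) os ?mem_tnth // !(tnth_nth 0) /= nth_uniq //.
by rewrite -{1}(hall x) /seq_proj big_tnth.
Qed.

Section Casimir.
Context (m : nat) (b : 'I_m -> B).
Hypothesis orth : forall s t : 'I_m, vn_tau (star (b t) * b s) = (s == t)%:R.
Hypothesis span : forall x, x = \sum_s vn_tau (star (b s) * x) *: b s.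

(** Left multiplication by y on the b_s and right multiplication by y on the b_t^* have transposed
    matrices, with the common entries tau(b_t^* y b_s). *)
Lemma casimir_swap (V : lmodType R[i]) (F : B -> B -> V) y : bilin F ->
  \sum_s F (y * b s) (star (b s)) = \sum_s F (b s) (star (b s) * y).
Proof.
move=> [Fl Fr].
have e1 s : F (y * b s) (star (b s)) =
    \sum_t vn_tau (star (b t) * (y * b s)) *: F (b t) (star (b s)).
  rewrite {1}[y * b s]span (lin_sum (Fl _)); apply: eq_bigr => t _.
  by rewrite (linZ (Fl _)).
rewrite (eq_bigr _ (fun s _ => e1 s)) exchange_big; apply: eq_bigr => t _.
have -> : star (b t) * y = \sum_s vn_tau (star (b t) * (y * b s)) *: star (b s).
  rewrite -{1}[star (b t) * y]starK [star (star (b t) * y)]span star_sum.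
  apply: eq_bigr => s _; rewrite starZ -tau_star starM !starK mulrA.
  by rewrite -!mulrA.
by rewrite (lin_sum (Fr _)); apply: eq_bigr => s _; rewrite (linZ (Fr _)).
Qed.

Lemma casimir_star (V : lmodType R[i]) (F : B -> B -> V) : bilin F ->
  \sum_s F (star (b s)) (b s) = \sum_s F (b s) (star (b s)).
Proof.
move=> [Fl Fr].
have e1 s : F (star (b s)) (b s) =
    \sum_t vn_tau (star (b t) * star (b s)) *: F (b t) (b s).
  rewrite {1}[star (b s)]span (lin_sum (Fl _)); apply: eq_bigr => t _.
  by rewrite (linZ (Fl _)).
rewrite (eq_bigr _ (fun s _ => e1 s)) exchange_big; apply: eq_bigr => t _.
rewrite [in RHS](span (star (b t))) (lin_sum (Fr _)); apply: eq_bigr => s _.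
by rewrite (linZ (Fr _)) vn_tau_tracial.
Qed.

Lemma mul_bilin : bilin (fun x y : B => x * y).
Proof.
split=> [y a u v|x a u v]; first by rewrite mulrDl scalerAl.
by rewrite mulrDr scalerAr.
Qed.

Definition casimir : B := \sum_s b s * star (b s).

Lemma casimir_central y : y * casimir = casimir * y.
Proof.
have /= h := casimir_swap y mul_bilin.
rewrite /casimir mulr_sumr mulr_suml.
under eq_bigr do rewrite mulrA; rewrite h.
by apply: eq_bigr => s _; rewrite mulrA.
Qed.

Lemma casimir_selfadj : star casimir = casimir.
Proof.
rewrite /casimir star_sum; apply: eq_bigr => s _; by rewrite starM starK.
Qed.

(** tau(x^* c x) is the sum of the squared 2-norms of the b_s^* x, so all of these vanish; expanding
    1 in the basis gives x = 0. *)
Lemma casimir_inj x : casimir * x = 0 -> x = 0.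
Proof.
move=> cx.
have h : \sum_s tf (star (b s) * x) (star (b s) * x) = 0.
  have : vn_tau (star x * (casimir * x)) = 0 by rewrite cx mulr0 tau0.
  rewrite /casimir mulr_suml mulr_sumr tau_sum => h; rewrite -[RHS]h; apply: eq_bigr => s _.
  by rewrite /tau_form starM starK !mulrA.
have h0 s : star (b s) * x = 0.
  apply: tau_starM_eq0; apply/eqP.
  have /eqP := h; rewrite psumr_eq0 => [/allP/(_ s (mem_index_enum s))|t _] //.
  exact: tau_starM_ge0.
rewrite -[x]mul1r -[1]star1 [in LHS](span 1) star_sum mulr_suml.
by apply: big1 => s _; rewrite starZ -scalerAl h0 scaler0.
Qed.

(** An injective linear map of a finite dimensional space is onto. G is the matrix of left
    multiplication by the Casimir element on row vectors of coordinates, and d is the preimage of 1;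
    cancellation then makes d central and self-adjoint. *)
Lemma casimir_inv : exists2 d, casimir * d = 1 & (forall y, y * d = d * y) /\ star d = d.
Proof.
pose c := casimir.
pose G : 'M[R[i]]_m := \matrix_(s, t) vn_tau (star (b t) * (c * b s)).
pose v (r : 'rV[R[i]]_m) : B := \sum_s r 0 s *: b s.
have vE r t : vn_tau (star (b t) * v r) = r 0 t.
  rewrite /v mulr_sumr tau_sum (bigD1 t) //= -scalerAr tauZ orth eqxx mulr1.
  by rewrite big1 ?addr0 // => s st; rewrite -scalerAr tauZ orth (negbTE st) mulr0.
have cv r : c * v r = v (r *m G).
  rewrite [LHS]span; apply: eq_bigr => t _; congr (_ *: _).
  rewrite /v !mulr_sumr tau_sum mxE; apply: eq_bigr => s _.
  by rewrite mxE -!scalerAr tauZ.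
have freeG : row_free G.
  apply: inj_row_free => r rG.
  have : v r = 0.
    by apply: casimir_inj; rewrite -/c cv rG /v big1 // => s _; rewrite mxE scale0r.
  move=> vr; apply/rowP => t; rewrite mxE -vE vr mulr0 tau0 //.
have uG : G \in unitmx by rewrite -row_free_unit.
pose r1 : 'rV[R[i]]_m := \row_t vn_tau (star (b t) * 1).
have v1 : v r1 = 1.
  by rewrite [RHS]span; apply: eq_bigr => s _; rewrite mxE.
have cd : c * v (r1 *m invmx G) = 1 by rewrite cv mulmxKV // v1.
move: (v _) cd => d cd.
have canc x y : c * x = c * y -> x = y.
  move=> e; apply/eqP; rewrite -subr_eq0; apply/eqP/casimir_inj.
  by rewrite mulrBr -/c e subrr.
have dcen y : y * d = d * y.
  apply: canc; rewrite [RHS]mulrA cd mul1r mulrA /c -(casimir_central y).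
  by rewrite -mulrA cd mulr1.
exists d => //; split=> //; apply: canc; rewrite cd.
by rewrite /c -{1}casimir_selfadj -starM -dcen -/c cd star1.
Qed.

End Casimir.

(* \sum_s e s (x) f s is a self-adjoint separability idempotent; the bilinear
   maps F stand for linear maps on B (x) B. *)
Lemma separability_idempotent : finite_dimensional B ->
  exists (m : nat) (e f : 'I_m -> B),
  [/\ \sum_s e s * f s = 1,
      forall (V : lmodType R[i]) (F : B -> B -> V) y, bilin F ->
        \sum_s F (y * e s) (f s) = \sum_s F (e s) (f s * y) &
      forall (V : lmodType R[i]) (F : B -> B -> V), bilin F ->
        \sum_s F (star (e s)) (star (f s)) = \sum_s F (e s) (f s)].
Proof.
move=> /orthonormal_basis[m [b [orth span]]].
have [d cd [dc ds]] := casimir_inv orth span.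
(* The factor d normalises the sum of the products to 1; being central and self-adjoint, it is
   compatible with the two symmetries of the Casimir tensor. *)
exists m, (fun s => b s * d), (fun s => star (b s)).
have bil (V : lmodType R[i]) (F : B -> B -> V) : bilin F ->
    bilin (fun x y => F (x * d) y).
  move=> [Fl Fr]; split=> [y a u v|x]; last exact: Fr.
  by rewrite mulrDl -scalerAl Fl.
split.
- rewrite -cd mulr_suml; apply: eq_bigr => s _.
  by rewrite -!mulrA dc.
- move=> V F y hF; rewrite -(casimir_swap span y (bil _ _ hF)).
  by apply: eq_bigr => s _; rewrite mulrA.
- move=> V F hF; rewrite -(casimir_star span (bil _ _ hF)).
  by apply: eq_bigr => s _; rewrite starM starK ds dc.
Qed.

End FiniteDimensional.

Lemma sum_option (V : nmodType) (Z : finType) (F : option Z -> V) :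
  \sum_u F u = F None + \sum_z F (Some z).
Proof.
rewrite (bigD1 None) //= (reindex_omap Some id) => [|[z|]] //=.
by congr (_ + _); apply: eq_bigl => z; rewrite eqxx.
Qed.

(** * Splitting the derivations of an algebra along a finite dimensional subalgebra *)

Section Reduction.
Context {R : realType} {B Q : tracialVNA R} (E : enveloping Q) (j : B -> Q).
Hypotheses (hj : star_hom j) (jtau : forall b, vn_tau (j b) = vn_tau b).
Context (A : set Q).
Hypotheses (hA : unital_star_subalgebra A) (jA : forall b, A (j b)).
Context (m : nat) (e f : 'I_m -> B).
Hypothesis ef1 : \sum_s e s * f s = 1.
Hypothesis ef_swap : forall (V : lmodType R[i]) (F : B -> B -> V) y, bilin F ->
  \sum_s F (y * e s) (f s) = \sum_s F (e s) (f s * y).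
Hypothesis ef_star : forall (V : lmodType R[i]) (F : B -> B -> V), bilin F ->
  \sum_s F (vn_star (e s)) (vn_star (f s)) = \sum_s F (e s) (f s).
Local Notation H := (env_L2 E).
Local Notation T := (env_tensor E).
Local Notation hat := (@l2_hat R _ H).
Local Notation o := (env_one E).
Local Notation nm := hnorm.
Local Notation H0 := (@env_L2_sub R Q E A).
Local Notation C := (@env_sub R Q E A).
Implicit Types (xi eta : H) (delta : Q -> H).

Let hC : unital_star_subalgebra C := env_sub_subalg E hA.
Let hH0 : submodule H0 := @H0_submodule R _ H C hC.

(* Acts on the left as the projection onto the B-central vectors. *)
Definition cproj : env_alg E := \sum_s T (j (e s)) (j (f s)).

Let tens_bilin : bilin (fun x y : B => T (j x) (j y)).
Proof.
split=> [y a u v|x a u v]; rewrite (star_hom_lin hj).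
  exact: tens_linl.
exact: tens_linr.
Qed.

Lemma cproj_sub : C cproj.
Proof.
apply: (submodule_sum (subalg_submodule hC)) => s; exact: env_sub_elem.
Qed.

Lemma cproj_central b : T (j b) 1 * cproj = T 1 (j b) * cproj.
Proof.
rewrite /cproj !mulr_sumr.
have := ef_swap b tens_bilin; rewrite /=.
under eq_bigr do rewrite (star_homM hj); under [in X in _ = X]eq_bigr do rewrite (star_homM hj).
by under [in X in _ -> X]eq_bigr do rewrite tensM mulr1;
   under [in X in _ -> _ = X]eq_bigr do rewrite tensM mul1r.
Qed.

Lemma cproj_star : vn_star cproj = cproj.
Proof.
rewrite /cproj star_sum -(ef_star tens_bilin); apply: eq_bigr => s _.
by rewrite tens_star -!(star_hom_star hj).
Qed.

Lemma cproj_tau : vn_tau cproj = \sum_s vn_tau (e s) * vn_tau (f s).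
Proof. by rewrite /cproj tau_sum; apply: eq_bigr => s _; rewrite tens_tau !jtau. Qed.

Definition central xi : Prop :=
  forall b, l2_act (T (j b) 1) xi = l2_act (T 1 (j b)) xi.

Lemma cproj_act_central xi : central (l2_act cproj xi).
Proof. by move=> b; rewrite -!actM cproj_central. Qed.

(** On a central vector the right action of f s can be exchanged for the left one, so p acts as the
    sum of the e s * f s, which is 1. *)
Lemma cproj_fix xi : central xi -> l2_act cproj xi = xi.
Proof.
move=> cxi; rewrite /cproj act_sum.
have h s : l2_act (T (j (e s)) (j (f s))) xi = l2_act (T (j (e s * f s)) 1) xi.
  have -> : T (j (e s)) (j (f s)) = T (j (e s)) 1 * T 1 (j (f s)).
    by rewrite tensM !mulr1.
  by rewrite actM -cxi -actM tensM mulr1 (star_homM hj).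
rewrite (eq_bigr _ (fun s _ => h s)) -act_sum -[in RHS](act1 xi); congr l2_act.
rewrite -(lin_sum (tens_linl E 1)) -(lin_sum (star_hom_lin hj)) ef1 (star_hom1 hj).
exact: tens11.
Qed.

Lemma cproj_idem xi : l2_act cproj (l2_act cproj xi) = l2_act cproj xi.
Proof. exact/cproj_fix/cproj_act_central. Qed.

Lemma cproj_dot xi eta : '[l2_act cproj xi, eta] = '[xi, l2_act cproj eta].
Proof. by rewrite act_dot cproj_star. Qed.

Definition ccompl xi : H := xi - l2_act cproj xi.

Lemma ccompl_lin : lin ccompl.
Proof.
move=> a xi eta; rewrite /ccompl act_lin opprD addrACA -scalerBr //.
Qed.

Lemma ccompl_H0 xi : H0 xi -> H0 (ccompl xi).
Proof.
by move=> h; apply: (submoduleB hH0) => //; apply: H0_act => //; exact: cproj_sub.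
Qed.

Lemma cproj_ccompl xi : l2_act cproj (ccompl xi) = 0.
Proof. by rewrite (linB (act_lin _)) cproj_idem subrr. Qed.

Lemma inner_ccompl xi b : inner (ccompl xi) (j b) = inner xi (j b).
Proof.
have h : inner (l2_act cproj xi) (j b) = 0.
  by rewrite innerE cproj_act_central subrr.
rewrite innerB; change (inner xi (j b) - inner (l2_act cproj xi) (j b) = inner xi (j b)).
by rewrite h subr0.
Qed.

(** The sum is the usual primitive of a derivation on a separable algebra. A primitive is unique up
    to central vectors, and [ccompl] selects the one annihilated by p. *)
Definition inner_part delta : H :=
  ccompl (\sum_s l2_act (T (j (e s)) 1) (delta (j (f s)))).

(** With xi the sum of the e_s . delta(f_s), the swap rule turns b . xi into the sum of the e_s .
    delta(f_s b). By Leibniz' rule, subtracting xi . b leaves the sum of the e_s f_s . delta(b). *)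
Lemma inner_partE delta b : derivation A delta ->
  inner (inner_part delta) (j b) = delta (j b).
Proof.
move=> hd; rewrite inner_ccompl innerE !(lin_sum (act_lin _)).
have bil : bilin (fun x y : B => l2_act (T (j x) 1) (delta (j y))).
  split=> [y a u v|x a u v]; rewrite (star_hom_lin hj).
    by rewrite (tens_linl E 1) actL.
  by rewrite (derivationL _ hd) // act_lin.
have := ef_swap b bil; rewrite /= => h.
have -> : \sum_s l2_act (T (j b) 1) (l2_act (T (j (e s)) 1) (delta (j (f s)))) =
    \sum_s l2_act (T (j (e s)) 1) (delta (j (f s * b))).
  by rewrite -h; apply: eq_bigr => s _; rewrite -actM tensM mulr1 (star_homM hj).
rewrite -sumrB.
have h1 s : l2_act (T (j (e s)) 1) (delta (j (f s * b))) -
    l2_act (T 1 (j b)) (l2_act (T (j (e s)) 1) (delta (j (f s)))) =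
    l2_act (T (j (e s * f s)) 1) (delta (j b)).
  rewrite (star_homM hj (f s)) (derivationM hd) // (linD (act_lin _)) -!actM !tensM.
  by rewrite !mulr1 !mul1r -(star_homM hj) addrK.
rewrite (eq_bigr _ (fun s _ => h1 s)) -act_sum -[RHS]act1; congr l2_act.
rewrite -(lin_sum (tens_linl E 1)) -(lin_sum (star_hom_lin hj)) ef1 (star_hom1 hj).
exact: tens11.
Qed.

Lemma inner_part_lin : lin inner_part.
Proof.
move=> a d d'; rewrite /inner_part -ccompl_lin scaler_sumr -big_split /=.
congr ccompl; apply: eq_bigr => s _.
change (l2_act (T (j (e s)) 1) (a *: d (j (f s)) + d' (j (f s))) =
  a *: l2_act (T (j (e s)) 1) (d (j (f s))) + l2_act (T (j (e s)) 1) (d' (j (f s)))).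
exact: act_lin.
Qed.

Lemma inner_part_inner xi : inner_part (inner xi) = ccompl xi.
Proof.
have h s : l2_act (T (j (e s)) 1) (inner xi (j (f s))) =
    l2_act (T (j (e s * f s)) 1) xi - l2_act (T (j (e s)) (j (f s))) xi.
  by rewrite innerE (linB (act_lin _)) -!actM !tensM !mulr1 -(star_homM hj).
rewrite /inner_part (eq_bigr _ (fun s _ => h s)) sumrB -!act_sum -/cproj.
rewrite -(lin_sum (tens_linl E 1)) -(lin_sum (star_hom_lin hj)) ef1 (star_hom1 hj).
by rewrite tens11 act1 -/(ccompl xi) {1}/ccompl cproj_ccompl subr0.
Qed.

Lemma inner_part_zero delta : (forall b, delta (j b) = 0) -> inner_part delta = 0.
Proof.
move=> h; rewrite /inner_part big1 ?(lin0 ccompl_lin) // => s _.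
by rewrite h (lin0 (act_lin _)).
Qed.

Lemma inner_part_H0 delta : derivation A delta -> H0 (inner_part delta).
Proof.
move=> hd; apply: ccompl_H0; apply: (submodule_sum hH0) => s.
by apply: H0_act => //; [apply: env_sub_elem => //; case: hA|exact: derivation_values].
Qed.

Lemma inner_part_rder c delta : inner_part (rder c delta) = ract c (inner_part delta).
Proof.
rewrite /inner_part /ccompl (linB (ract_lin c)) ract_act (lin_sum (ract_lin c)).
have h : \sum_s l2_act (T (j (e s)) 1) (rder c delta (j (f s))) =
    \sum_s ract c (l2_act (T (j (e s)) 1) (delta (j (f s)))).
  by apply: eq_bigr => s _; rewrite ract_act.
by rewrite h.
Qed.

Lemma inner_rder c xi x : inner (ract c xi) x = ract c (inner xi x).
Proof. by rewrite /inner ract_act. Qed.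

Lemma inner_linl x : lin (fun xi => inner xi x).
Proof. exact: act_lin. Qed.

Definition reduced_part delta : Q -> H := delta - inner (inner_part delta).

Lemma reduced_part_zero delta b : derivation A delta -> reduced_part delta (j b) = 0.
Proof.
move=> hd; change (delta (j b) - inner (inner_part delta) (j b) = 0).
by rewrite inner_partE // subrr.
Qed.

Context (Z : finType) (xs : Z -> Q).
Hypothesis xsA : forall z, A (xs z).
Hypothesis xs_star : forall z, exists z', vn_star (xs z) = xs z'.
Hypothesis A_gen : A = star_algebra_gen (range xs `|` range j).
Context (Y : {fset Q}).
Hypothesis genY : sa_generating A Y.
Local Notation D := (@Der11_closure R Q E A Y).

(** The coordinate [None] holds the vector of the inner part, the coordinates [Some z] the values of
    the reduced part at the generators outside B. These are the coordinates in which the direct sum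
    is visible. *)
Definition split_der delta : {ffun option Z -> H} :=
  [ffun u => if u is Some z then reduced_part delta (xs z) else inner_part delta].

Lemma split_der_lin : lin split_der.
Proof.
move=> a d d'; apply/ffunP => -[z|]; rewrite !ffunE; last exact: inner_part_lin.
rewrite /reduced_part inner_part_lin.
change (a *: d (xs z) + d' (xs z) -
  inner (a *: inner_part d + inner_part d') (xs z) =
  a *: (d (xs z) - inner (inner_part d) (xs z)) +
  (d' (xs z) - inner (inner_part d') (xs z))).
rewrite (inner_linl (xs z)) opprD addrACA -scalerBr //.
Qed.

Lemma split_der_bound : exists2 c : R, 0 <= c & forall delta, D delta ->
  ipnorm (@sum_dot _ _ _) (split_der delta) <= c * ipnorm (@sum_dot _ _ _) (phi Y delta).
Proof.
pose N delta := ipnorm (@sum_dot _ _ _) (@phi R Q E Y delta).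
have bd x : A x -> exists2 c : R, 0 <= c & forall delta, D delta -> nm (delta x) <= c * N delta.
  move=> Ax; have [c c0 hc] := derivation_bound_gen E hA genY Ax.
  by exists c => // d [hd _]; exact: hc.
have bx : exists2 c : R, 0 <= c & forall delta, D delta -> nm (inner_part delta) <= c * N delta.
  have [k k0 hk] : lipschitz_for nm nm ccompl.
    have [k k0 hk] := act_lipschitz (L := H) cproj; exists (1 + k); first lra.
    move=> xi; apply: le_trans (hnormB _ _) _; rewrite mulrDl mul1r lerD2l.
    exact: hk.
  have /choice[c hc] s : exists c : R, 0 <= c /\ forall delta, D delta ->
      nm (l2_act (T (j (e s)) 1) (delta (j (f s)))) <= c * N delta.
    have [c c0 hc] := bd _ (jA (f s)).
    have [l l0 hl] := act_lipschitz (L := H) (T (j (e s)) 1).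
    exists (l * c); split=> [|d Dd]; first exact: mulr_ge0.
    by apply: le_trans (hl _) _; rewrite -mulrA ler_wpM2l // hc.
  exists (k * \sum_s c s) => [|d Dd].
    by rewrite mulr_ge0 // sumr_ge0 // => s _; case: (hc s).
  apply: le_trans (hk _) _; rewrite -mulrA ler_wpM2l //.
  apply: le_trans (hnorm_sum _ _) _; rewrite mulr_suml; apply: ler_sum => s _.
  by case: (hc s) => _; apply.
apply: sum_norm_bound => [d|[z|]]; first exact: ipnorm_ge0.
- have [c c0 hc] := bd _ (xsA z); have [k k0 hk] := inner_bound E (xs z).
  have [l l0 hl] := bx; exists (c + k * l) => [|d Dd].
    by rewrite addr_ge0 // mulr_ge0.
  rewrite ffunE; apply: le_trans (hnormB _ _) _; rewrite mulrDl; apply: lerD.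
    exact: hc.
  by apply: le_trans (hk _) _; rewrite -mulrA ler_wpM2l // hl.
- by have [c c0 hc] := bx; exists c => // d Dd; rewrite ffunE; exact: hc.
Qed.

(** [derivation_bound] is applied to the generating set formed by the xs z and the whole image of B:
    on the latter delta is inner, and on the former it differs from an inner derivation by a
    coordinate of [split_der]. *)
Lemma split_der_bound_inv : exists2 c : R, 0 <= c & forall delta, D delta ->
  ipnorm (@sum_dot _ _ _) (phi Y delta) <= c * ipnorm (@sum_dot _ _ _) (split_der delta).
Proof.
pose N delta := ipnorm (@sum_dot _ _ _) (split_der delta).
have bd x : A x -> exists2 c : R, 0 <= c & forall delta, D delta -> nm (delta x) <= c * N delta.
  move: x; apply: (derivation_bound hA A_gen).
  - move=> x [[z _ <-]|[b _ <-]].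
      by have [z' ->] := xs_star z; left; exists z'.
    by right; exists (vn_star b) => //; rewrite (star_hom_star hj).
  - by move=> d [].
  - by move=> d; exact: ipnorm_ge0.
  have bx delta : nm (inner_part delta) <= N delta.
    by have := coord_norm_le (split_der delta) None; rewrite ffunE.
  move=> x [[z _ <-]|[b _ <-]].
    have [k k0 hk] := inner_bound E (xs z); exists (1 + k) => [|d Dd].
      by rewrite addr_ge0.
    have -> : d (xs z) = reduced_part d (xs z) + inner (inner_part d) (xs z).
      change (d (xs z) = d (xs z) - inner (inner_part d) (xs z) + inner (inner_part d) (xs z)).
      by rewrite subrK.
    apply: le_trans (hnormD _ _) _; rewrite mulrDl mul1r; apply: lerD.
      by have := coord_norm_le (split_der d) (Some z); rewrite ffunE.
    by apply: le_trans (hk _) _; rewrite ler_wpM2l.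
  have [k k0 hk] := inner_bound E (j b); exists k => // d [hd _].
  by rewrite -(inner_partE b hd); apply: le_trans (hk _) _; rewrite ler_wpM2l.
apply: sum_norm_bound => [d|x]; first exact: ipnorm_ge0.
have [_ eA] := genY.
have Ax : A (val x) by rewrite eA; apply: sub_star_algebra_gen; exact: valP.
by have [c c0 hc] := bd _ Ax; exists c => // d Dd; rewrite ffunE; exact: hc.
Qed.

Let hD : submodule D := Der11_closure_submodule E hA Y.

Lemma stein_dim_on_split : stein_dim_on E A Y = vn_dim o (split_der @` D).
Proof.
apply: (vn_dim_iso (r := @rder R Q E) hC hD (@phi_lin R Q E Y) split_der_lin).
- move=> c d Cc Dd; split.
  + exact: Der11_closure_rder.
  + exact: phi_ract.
  apply/ffunP => -[z|]; rewrite !ffunE; last exact: inner_part_rder.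
  rewrite /reduced_part inner_part_rder.
  change (ract c (d (xs z)) - inner (ract c (inner_part d)) (xs z) =
    ract c (d (xs z) - inner (inner_part d) (xs z))).
  by rewrite inner_rder (linB (ract_lin c)).
- move=> d x [hd _]; rewrite ffunE; apply: (derivation_values hd).
  by case: genY => _ ->; apply: sub_star_algebra_gen; exact: valP.
- move=> d [z|] [hd _]; rewrite ffunE; last exact: inner_part_H0.
  change (H0 (d (xs z) - inner (inner_part d) (xs z))).
  apply: (submoduleB hH0); first exact: derivation_values.
  by apply: (derivation_values (A := A)) => //; apply: inner_derivation => //; exact: inner_part_H0.
- exact: split_der_bound.
- exact: split_der_bound_inv.
- exact: Der11_closure_complete.
Qed.

(* w z is the projection of the trace vector at coordinate z; the coordinate
   None contributes 1 - tau (cproj). *)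
Lemma stein_dim_on_reduced (w : Z -> {ffun option Z -> H}) :
  (forall z, (split_der @` D) (w z)) ->
  (forall z delta, D delta ->
     sum_dot (sum_basis o (Some z) - w z) (split_der delta) = 0) ->
  stein_dim_on E A Y = 1 - complex.Re (\sum_s vn_tau (e s) * vn_tau (f s))
    + complex.Re (\sum_z '[w z (Some z), o]).
Proof.
move=> Dw ow; rewrite stein_dim_on_split.
have sK : submodule (split_der @` D) := image_submodule hD split_der_lin.
have cK := image_complete hD (@phi_lin R Q E Y) split_der_lin split_der_bound
  split_der_bound_inv (Der11_closure_complete hA genY).
have Ho : H0 o := @H0_one R _ H C hC.
pose w' u : {ffun option Z -> H} :=
  if u is Some z then w z else sum_basis (ccompl o) None.
(* The candidate at [None] is (1 - p) applied to 1 (x) 1; it comes from an inner derivation, whose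
   reduced part is zero. *)
have e0 : split_der (inner (ccompl o)) = sum_basis (ccompl o) None.
  apply/ffunP => -[z|]; rewrite !ffunE /=.
    change (inner (ccompl o) (xs z) - inner (inner_part (inner (ccompl o))) (xs z) = 0).
    by rewrite inner_part_inner {2}/ccompl cproj_ccompl subr0 subrr.
  by rewrite inner_part_inner {1}/ccompl cproj_ccompl subr0.
rewrite (vn_dim_candidates sK cK (w := w')).
- rewrite sum_option /= ReD !ffunE eqxx; congr (_ + _).
  rewrite hdotBl !l2_act_hat !l2_hat_dot star1 !mul1r mulr1 vn_tau1 cproj_tau.
  by rewrite ReD ReN.
- move=> [z|]; first exact: Dw.
  by exists (inner (ccompl o)) => //; apply: inner_Der11_closure => //; exact: ccompl_H0.
- move=> [z|] _ [d Dd <-]; first exact: ow.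
  (* The remainder p (1 (x) 1) is orthogonal to every inner part, since p annihilates those. *)
  have -> : sum_basis o None - w' None = sum_basis (l2_act cproj o) None.
    apply/ffunP => u; rewrite !ffunE; case: eqP => // _; last by rewrite subrr.
    by rewrite subKr.
  rewrite (ip_conj sum_dot_inner_product) sum_dot_basis ffunE -cproj_dot cproj_ccompl.
  by rewrite hdot0l rmorph0.
Qed.

End Reduction.

(** * The tensor product *)

Section Embedding.
Context {R : realType} {M B MB : tracialVNA R} (i : M -> MB) (j : B -> MB).
Hypothesis ht : is_vn_tensor i j.
Context (EM : enveloping M) (EMB : enveloping MB) (A : set M).
Hypothesis hA : unital_star_subalgebra A.
Local Notation HM := (env_L2 EM).
Local Notation H := (env_L2 EMB).
Local Notation TM := (env_tensor EM).
Local Notation T := (env_tensor EMB).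
Local Notation hatM := (@l2_hat R _ HM).
Local Notation hat := (@l2_hat R _ H).
Local Notation nm := hnorm.
Local Notation CM := (@env_sub R M EM A).
Local Notation HA := (@env_L2_sub R M EM A).
Implicit Types (xi eta : HM) (zeta : H).

Let hi : star_hom i := tensor_inl ht.
Let hj : star_hom j := tensor_inr ht.
Let hCM : unital_star_subalgebra CM := env_sub_subalg EM hA.
Let hHA : submodule HA := @H0_submodule R _ HM CM hCM.

(* The span of the pairs (x (x) y°, i x (x) (i y)°), x and y in A. *)
Definition emb_graph (p : env_alg EM * env_alg EMB) : Prop :=
  forall S : set (env_alg EM * env_alg EMB), submodule S ->
    (forall a b, A a -> A b -> S (TM a b, T (i a) (i b))) -> S p.

Lemma emb_graphL (c : R[i]) p q : emb_graph p -> emb_graph q -> emb_graph (c *: p + q).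
Proof. by move=> hp hq S hS h; apply: (proj2 hS); [exact: hp|exact: hq]. Qed.

Lemma emb_graph_elem a b : A a -> A b -> emb_graph (TM a b, T (i a) (i b)).
Proof. by move=> Aa Ab S hS; apply. Qed.

Lemma emb_graph_fst z : CM z -> exists w, emb_graph (z, w).
Proof.
move: z; apply: env_sub_ind.
  split=> [|c z z' [w hw] [w' hw']]; first by exists 0 => S [].
  by exists (c *: w + w'); have := emb_graphL c hw hw'.
by move=> a b Aa Ab; exists (T (i a) (i b)); exact: emb_graph_elem.
Qed.

Lemma emb_graph_sub p : emb_graph p -> CM p.1.
Proof.
move=> hp; apply: (hp [set p | CM p.1]); last first.
  by move=> a b Aa Ab /=; exact: env_sub_elem.
split=> [|c u v]; first by case: (subalg_submodule hCM).
exact: (proj2 (subalg_submodule hCM)).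
Qed.

Lemma emb_graph_sub' p (S : set MB) : unital_star_subalgebra S -> (forall a, A a -> S (i a)) ->
  emb_graph p -> env_sub S p.2.
Proof.
move=> hS hAS hp; apply: (hp [set p | env_sub S p.2]); last first.
  by move=> a b Aa Ab /=; apply: env_sub_elem; exact: hAS.
have hm := subalg_submodule (env_sub_subalg EMB hS).
split=> [|c u v]; first by case: hm.
exact: (proj2 hm).
Qed.

(** Equal inner products on both sides make the graph that of an isometry, so different
    representations of the same tensor never have to be compared. *)
Lemma emb_graph_tau p q : emb_graph p -> emb_graph q ->
  vn_tau (vn_star p.1 * q.1) = vn_tau (vn_star p.2 * q.2).
Proof.
move=> hp hq.
apply: (hp [set p | vn_tau (vn_star p.1 * q.1) = vn_tau (vn_star p.2 * q.2)]).
  split=> [|c u v hu hv] /=; first by rewrite !star0 !mul0r !tau0.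
  by rewrite !starL !mulrDl -!scalerAl !vn_tau_linear hu hv.
move=> a b Aa Ab /=.
apply: (hq [set q | vn_tau (vn_star (TM a b) * q.1) =
  vn_tau (vn_star (T (i a) (i b)) * q.2)]).
  split=> [|c u v hu hv] /=; first by rewrite !mulr0 !tau0.
  by rewrite !mulrDr -!scalerAr !vn_tau_linear hu hv.
move=> a' b' Aa' Ab' /=; rewrite !tens_star !tensM !tens_tau.
by rewrite -!(star_hom_star hi) -!(star_homM hi) !(tensor_taul ht).
Qed.

Definition emb_index := {p : env_alg EM * env_alg EMB | emb_graph p}.
Local Notation src := (fun k : emb_index => hatM (sval k).1).
Local Notation tgt := (fun k : emb_index => hat (sval k).2).

Lemma src_range : range src = hatM @` CM.
Proof.
apply/seteqP; split=> [_ [[p hp] _ <-]|_ [z Cz <-]].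
  by exists p.1 => //; exact: emb_graph_sub.
have [w hw] := emb_graph_fst Cz.
by exists (exist _ (z, w) hw).
Qed.

Lemma src_tgt_norm k : nm (tgt k) <= 1 * nm (src k).
Proof.
case: k => p hp; rewrite mul1r !norm_hat /norm2 /ipnorm /tau_form /=.
by rewrite (emb_graph_tau hp hp).
Qed.

Lemma src_tgt_lin (a : R[i]) k l :
  exists m, src m = a *: src k + src l /\ tgt m = a *: tgt k + tgt l.
Proof.
case: k l => [p hp] [q hq]; exists (exist _ (a *: p + q) (emb_graphL a hp hq)) => /=.
by rewrite !hat_lin.
Qed.

Lemma HA_complete : complete_for (ipnorm (hdot HM)) HA.
Proof.
move=> u Hu cau; have [l _ hl] := hcomplete (fun n => Logic.I : [set: HM] (u n)) cau.
by exists l => //; exact: cvg_for_closed hl.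
Qed.

Definition hA_proj : HM -> HM := ip_proj (hdot HM) HA.

Let hip := @hdot_inner_product R HM.
Lemma hA_projP xi : HA (hA_proj xi) /\ forall k, HA k -> '[xi - hA_proj xi, k] = 0.
Proof. exact: (ip_projP hip hHA HA_complete). Qed.

Lemma hA_proj_id xi : HA xi -> hA_proj xi = xi.
Proof. exact: (ip_proj_id hip hHA HA_complete (@hnorm_eq0 R HM)). Qed.

Lemma hA_proj_lin : lin hA_proj.
Proof. exact: (ip_proj_linear hip hHA HA_complete (@hnorm_eq0 R HM)). Qed.

Lemma hA_proj_norm xi : nm (hA_proj xi) <= nm xi.
Proof. exact: (ip_proj_norm hip hHA HA_complete). Qed.

(* xi |-> xi (x) 1 on L^2(A (x) A°), extended by 0 on the orthogonal
   complement. *)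
Definition emb (xi : HM) : H := extend src tgt (hA_proj xi).

Let HA_src xi : closure (range src) xi = HA xi.
Proof. by rewrite src_range. Qed.

Lemma embE xi : HA xi -> emb xi = extend src tgt xi.
Proof. by move=> hxi; rewrite /emb hA_proj_id. Qed.

Lemma emb_lin : lin emb.
Proof.
move=> a xi eta; rewrite /emb hA_proj_lin.
apply: (extend_lin ler01 src_tgt_norm src_tgt_lin); rewrite HA_src;
  exact: (proj1 (hA_projP _)).
Qed.

Lemma emb_norm xi : nm (emb xi) <= nm xi.
Proof.
apply: le_trans (hA_proj_norm xi); rewrite -[leRHS]mul1r.
apply: (extend_norm ler01 src_tgt_norm src_tgt_lin); rewrite HA_src.
exact: (proj1 (hA_projP _)).
Qed.

Lemma emb_lipschitz : lipschitz_for nm nm emb.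
Proof. by exists 1 => // xi; rewrite mul1r emb_norm. Qed.

Lemma emb_graph_emb p : emb_graph p -> emb (hatM p.1) = hat p.2.
Proof.
move=> hp; rewrite embE; last by apply: H0_hat; exact: emb_graph_sub.
exact: (extend_id ler01 src_tgt_norm src_tgt_lin (exist _ p hp)).
Qed.

Lemma emb_tensor a b : A a -> A b -> emb (hatM (TM a b)) = hat (T (i a) (i b)).
Proof. by move=> Aa Ab; exact: (emb_graph_emb (emb_graph_elem Aa Ab)). Qed.

Lemma emb_one : emb (env_one EM) = env_one EMB.
Proof.
have A1 : A 1 by case: hA.
by have := emb_tensor A1 A1; rewrite (star_hom1 hi) !tens11.
Qed.

Lemma emb_H0 (S : set MB) xi : unital_star_subalgebra S -> (forall a, A a -> S (i a)) ->
  env_L2_sub S (emb xi).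
Proof.
move=> hS hAS; have [Hp _] := hA_projP xi.
have : closure (range tgt) (emb xi).
  by apply: (extend_closure ler01 src_tgt_norm src_tgt_lin); rewrite HA_src.
move=> /hclosureP h; apply/hclosureP => e /h[_ [[p hp] _ <-] hlt].
exists (hat p.2) => //; exists p.2 => //; exact: emb_graph_sub'.
Qed.

Lemma emb_dot xi eta : HA xi -> HA eta -> '[emb xi, emb eta] = '[xi, eta].
Proof.
move=> hxi heta.
have h z : CM z -> '[emb eta, emb (hatM z)] = '[eta, hatM z].
  move=> Cz; apply: (closure_dot_eq emb_lin emb_lipschitz lin_id lipschitz_id _ heta).
  move=> _ [z' Cz' <-]; have [w hw] := emb_graph_fst Cz.
  have [w' hw'] := emb_graph_fst Cz'.
  rewrite (emb_graph_emb hw) (emb_graph_emb hw') !l2_hat_dot.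
  by rewrite -(emb_graph_tau hw hw').
apply: (closure_dot_eq emb_lin emb_lipschitz lin_id lipschitz_id _ hxi).
move=> _ [z Cz <-]; rewrite hdot_conj h // -hdot_conj //.
Qed.

Lemma emb_act a b xi : A a -> A b -> HA xi ->
  emb (l2_act (TM a b) xi) = l2_act (T (i a) (i b)) (emb xi).
Proof.
move=> Aa Ab hxi; apply: hdot_ext => w.
have A_M x y : A x -> A y -> A (x * y) by case: hA => _ _ + _; apply.
apply: (closure_dot_eq (lin_comp (act_lin _) emb_lin)
  (lipschitz_comp (act_lipschitz _) emb_lipschitz)
  (lin_comp emb_lin (act_lin _))
  (lipschitz_comp emb_lipschitz (act_lipschitz _)) _ hxi) => /= _ [z Cz <-].
congr '[_, w].
move: z Cz; apply: env_sub_ind.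
  split=> [|c u v hu hv] /=.
    by rewrite (lin0 hat_lin) !(lin0 (act_lin _)) (lin0 emb_lin) (lin0 (act_lin _)).
  by rewrite hat_lin act_lin emb_lin hu hv emb_lin act_lin.
move=> x y Ax Ay; rewrite l2_act_hat tensM !emb_tensor ?l2_act_hat ?tensM //.
- by rewrite !(star_homM hi).
- exact: A_M.
- exact: A_M.
Qed.

Lemma range_star_hom_subalg : unital_star_subalgebra (range j).
Proof.
split.
- by exists 1 => //; exact: star_hom1 hj.
- by move=> a _ _ [x _ <-] [y _ <-]; exists (a *: x + y) => //; exact: star_hom_lin.
- by move=> _ _ [x _ <-] [y _ <-]; exists (x * y) => //; exact: star_homM.
- by move=> _ [x _ <-]; exists (vn_star x) => //; exact: star_hom_star.
Qed.

(** A (x) A° and B (x) B° are independent for the trace: <xi (x) 1, 1 (x) q> = <xi, 1> <1, q>. With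
    q = p this produces the factor tau p. *)
Lemma emb_dot_slice xi q : HA xi -> env_sub (range j) q ->
  '[emb xi, hat q] = (vn_tau q)^* * '[xi, env_one EM].
Proof.
move=> hxi hq; rewrite -hdotZr.
apply: (closure_dot_eq emb_lin emb_lipschitz lin_id lipschitz_id _ hxi).
move=> _ [z Cz <-]; rewrite hdotZr.
move: q hq; apply: env_sub_ind.
  split=> [|c u v hu hv] /=; first by rewrite (lin0 hat_lin) hdot0r tau0 rmorph0 mul0r.
  rewrite hat_lin hdotDr hdotZr hu hv vn_tau_linear rmorphD rmorphM /=.
  by rewrite mulrDl mulrA.
move=> _ _ [c _ <-] [d _ <-]; move: z Cz; apply: env_sub_ind.
  split=> [|k u v hu hv] /=.
    by rewrite (lin0 hat_lin) (lin0 emb_lin) !hdot0l mulr0.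
  by rewrite hat_lin emb_lin !hdotDl !hdotZl hu hv mulrDr mulrCA.
move=> a b Aa Ab; rewrite emb_tensor // !l2_hat_dot star1 mul1r !tens_star tensM !tens_tau.
rewrite -!(star_hom_star hj) -(tensorC ht) !(tensor_tau ht) !tau_star rmorphM !(tensor_taur ht).
by rewrite mulrCA [_^* * _]mulrC; ring.
Qed.

Lemma emb_image_complete : complete_for (ipnorm (hdot H)) (emb @` HA).
Proof.
move=> u Hu cau.
have /choice[v hv] n : exists v, HA v /\ emb v = u n.
  by have [v] := Hu n; exists v.
have iso n m : nm (v n - v m) = nm (u n - u m).
  have [Hn <-] := hv n; have [Hm <-] := hv m; have Hd := submoduleB hHA Hn Hm.
  by rewrite -(linB emb_lin) /hnorm /ipnorm emb_dot.
have [n|e e0|l Hl hl] := @HA_complete v; first by case: (hv n).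
  have [n0 hn0] := cau _ e0; exists n0 => n m hn hm; move: (hn0 n m hn hm).
  by rewrite -/(hnorm _) -iso.
exists (emb l); first by exists l.
move=> e e0; have [n0 hn0] := hl _ e0; exists n0 => n hn.
have [Hn <-] := hv n; rewrite -(linB emb_lin).
exact: le_lt_trans (emb_norm _) (hn0 n hn).
Qed.

(** The image of an isometry of a complete space is complete: zeta is projected onto it and the
    projection pulled back. *)
Lemma emb_adjoint_exists zeta :
  exists xi, HA xi /\ forall k, HA k -> '[xi, k] = '[zeta, emb k].
Proof.
have hm : submodule (emb @` HA).
  split; first by exists 0; [case: hHA|exact: lin0 emb_lin].
  move=> a _ _ [u Hu <-] [v Hv <-]; exists (a *: u + v); last exact: emb_lin.
  exact: (proj2 hHA).
have [_ [xi Hxi <-] hp] :=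
  projection_exists (@hdot_inner_product R H) hm emb_image_complete zeta.
exists xi; split=> // k Hk; apply/esym/eqP; rewrite -subr_eq0 -(emb_dot Hxi Hk) -hdotBl.
by apply/eqP; apply: hp; exists k.
Qed.

Definition emb_adj (zeta : H) : HM :=
  xget 0 [set xi | HA xi /\ forall k, HA k -> '[xi, k] = '[zeta, emb k]].

Lemma emb_adjP zeta : HA (emb_adj zeta) /\
  forall k, HA k -> '[emb_adj zeta, k] = '[zeta, emb k].
Proof.
exact: (@xgetPex _ 0 [set xi | HA xi /\ forall k, HA k -> '[xi, k] = '[zeta, emb k]]
  (emb_adjoint_exists zeta)).
Qed.

Lemma HA_ext xi eta : HA xi -> HA eta -> (forall k, HA k -> '[xi, k] = '[eta, k]) -> xi = eta.
Proof.
move=> hx he h; apply/eqP; rewrite -subr_eq0; apply/eqP/hnorm_eq0.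
rewrite /hnorm /ipnorm hdotBl h; first by rewrite subrr sqrtr0.
exact: (submoduleB hHA).
Qed.

Lemma emb_adj_lin : lin emb_adj.
Proof.
move=> a u v; have [Hu hu] := emb_adjP u; have [Hv hv] := emb_adjP v.
have [Hw hw] := emb_adjP (a *: u + v).
apply: HA_ext => // [|k Hk]; first exact: (proj2 hHA).
by rewrite hw // !hdotDl !hdotZl hu // hv.
Qed.

Lemma emb_adj_norm zeta : nm (emb_adj zeta) <= nm zeta.
Proof.
have [Hz hz] := emb_adjP zeta; have [->|zn] := eqVneq (nm (emb_adj zeta)) 0.
  exact: hnorm_ge0.
have zp : 0 < nm (emb_adj zeta) by rewrite lt0r zn hnorm_ge0.
rewrite -(ler_pM2r zp) -expr2 -lecR hnormKC hz //.
have h1 := hdot_cs zeta (emb (emb_adj zeta)).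
rewrite -(hz _ Hz) -hnormKC lecR; rewrite -(hz _ Hz) -hnormKC in h1.
have := ler_wpM2l (hnorm_ge0 zeta) (emb_norm (emb_adj zeta)).
move: h1; rewrite cabs_real ger0_norm ?sqr_ge0 //; exact: le_trans.
Qed.

Lemma emb_adj_act a b zeta : A a -> A b ->
  emb_adj (l2_act (T (i a) (i b)) zeta) = l2_act (TM a b) (emb_adj zeta).
Proof.
move=> Aa Ab; have [Hz hz] := emb_adjP zeta.
have [Hw hw] := emb_adjP (l2_act (T (i a) (i b)) zeta).
have As x : A x -> A (vn_star x) by case: hA => _ _ _; apply.
apply: HA_ext => // [|k Hk].
  by apply: (H0_act hCM) => //; exact: env_sub_elem.
rewrite hw // !act_dot !tens_star hz; last first.
  by apply: (H0_act hCM) => //; apply: env_sub_elem; exact: As.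
by rewrite emb_act ?(star_hom_star hi) //; exact: As.
Qed.

End Embedding.

(** * Finite generation of tensor products *)

Section FinitelyGenerated.
Context {R : realType}.
Implicit Types (M B : tracialVNA R).

Lemma star_algebra_gen_mono M (F : set M) (S : set M) : unital_star_subalgebra S ->
  F `<=` S -> star_algebra_gen F `<=` S.
Proof. by move=> hS FS x; apply. Qed.

Lemma sa_generating_exists M (A : set M) : finitely_generated A ->
  exists X : {fset M}, sa_generating A X.
Proof.
move=> [F ->]; exists (F `|` [fset vn_star x | x in F])%fset; split.
  move=> x; rewrite !inE => /orP[Fx|/imfsetP[y /= Fy ->]].
    by apply/orP; right; apply/imfsetP; exists x.
  by rewrite starK Fy.
apply/seteqP; split; apply: star_algebra_gen_mono; try exact: star_algebra_gen_subalg.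
  by move=> x Fx; apply: sub_star_algebra_gen; rewrite /= inE Fx.
move=> x; rewrite /= inE => /orP[Fx|/imfsetP[y /= Fy ->]].
  exact: sub_star_algebra_gen.
have [_ _ _ hs] := star_algebra_gen_subalg [set` F].
by apply: hs; exact: sub_star_algebra_gen.
Qed.

Lemma finite_dimensional_generated B : finite_dimensional B ->
  finitely_generated [set: B].
Proof.
move=> [n [b hb]]; exists [fset b k | k in 'I_n]%fset.
apply/seteqP; split=> // x _; have [c ->] := hb x.
have hS := star_algebra_gen_subalg [set` [fset b k | k in 'I_n]%fset].
have hm := subalg_submodule hS.
apply: (submodule_sum hm) => k; apply: (submoduleZ hm).
by apply: sub_star_algebra_gen; apply/imfsetP; exists k.
Qed.

Lemma setT_subalg B : unital_star_subalgebra [set: B].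
Proof. by []. Qed.

(** From left to right: the preimages of the right side under i and j are *-subalgebras containing F
    and G. *)
Lemma alg_tensor_gen M B (MB : tracialVNA R) (i : M -> MB) (j : B -> MB)
    (F : set M) (G : set B) : is_vn_tensor i j ->
  alg_tensor i j (star_algebra_gen F) (star_algebra_gen G) =
  star_algebra_gen ((i @` F) `|` (j @` G)).
Proof.
move=> ht; have hi := tensor_inl ht; have hj := tensor_inr ht.
have hF := star_algebra_gen_subalg F; have hG := star_algebra_gen_subalg G.
pose S := star_algebra_gen ((i @` F) `|` (j @` G)).
have hS : unital_star_subalgebra S := star_algebra_gen_subalg _.
apply/seteqP; split.
  apply: (alg_tensor_ind (subalg_submodule hS)) => a b Fa Gb.
  have [S1 Sl SM Ss] := hS; apply: (SM).
    apply: (Fa (i @^-1` S)) => [|x Fx]; last first.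
      by apply: sub_star_algebra_gen; left; exists x.
    split; rewrite /preimage /=.
    - by rewrite (star_hom1 hi).
    - by move=> c x y hx hy; rewrite (star_hom_lin hi); exact: Sl.
    - by move=> x y hx hy; rewrite (star_homM hi); exact: SM.
    - by move=> x hx; rewrite (star_hom_star hi); exact: Ss.
  apply: (Gb (j @^-1` S)) => [|x Gx]; last first.
    by apply: sub_star_algebra_gen; right; exists x.
  split; rewrite /preimage /=.
  - by rewrite (star_hom1 hj).
  - by move=> c x y hx hy; rewrite (star_hom_lin hj); exact: Sl.
  - by move=> x y hx hy; rewrite (star_homM hj); exact: SM.
  - by move=> x hx; rewrite (star_hom_star hj); exact: Ss.
apply: star_algebra_gen_mono; first exact: (alg_tensor_subalg ht hF hG).
move=> _ [[x Fx <-]|[x Gx <-]].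
  rewrite -[i x]mulr1 -(star_hom1 hj); apply: alg_tensor_elem.
    exact: sub_star_algebra_gen.
  by case: hG.
rewrite -[j x]mul1r -(star_hom1 hi); apply: alg_tensor_elem; first by case: hF.
exact: sub_star_algebra_gen.
Qed.

Lemma alg_tensor_finitely_generated M B (MB : tracialVNA R) (i : M -> MB)
    (j : B -> MB) (A : set M) (A' : set B) : is_vn_tensor i j ->
  finitely_generated A -> finitely_generated A' ->
  finitely_generated (alg_tensor i j A A').
Proof.
move=> ht [F ->] [G ->]; rewrite alg_tensor_gen //.
exists ([fset i x | x in F] `|` [fset j x | x in G])%fset; congr star_algebra_gen.
apply/seteqP; split=> [_ [[x Fx <-]|[x Gx <-]]|x] /=.
- by rewrite inE; apply/orP; left; apply/imfsetP; exists x.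
- by rewrite inE; apply/orP; right; apply/imfsetP; exists x.
- rewrite inE => /orP[/imfsetP[y /= Fy ->]|/imfsetP[y /= Gy ->]].
    by left; exists y.
  by right; exists y.
Qed.

(** [stein_dim] is a choice among generating sets. The formulas for [stein_dim_on] hold for every
    such set, so one that realises the choice is enough. *)
Lemma stein_dim_witness M (E : enveloping M) (A : set M) : finitely_generated A ->
  exists2 X : {fset M}, sa_generating A X & stein_dim E A = stein_dim_on E A X.
Proof.
move=> /sa_generating_exists[X hX].
have [Y hY e] : [set s | exists2 X, sa_generating A X & s = stein_dim_on E A X] (stein_dim E A).
  by apply: xgetPex; exists (stein_dim_on E A X); exists X.
by exists Y.
Qed.

End FinitelyGenerated.

(** * Passing between derivations of A and of A (x) B *)

Section TensorDerivation.
Context {R : realType} {M B MB : tracialVNA R} (i : M -> MB) (j : B -> MB).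
Hypothesis ht : is_vn_tensor i j.
Context (EM : enveloping M) (EMB : enveloping MB) (A : set M).
Hypothesis hA : unital_star_subalgebra A.
Context (X : {fset M}) (Y : {fset MB}).
Local Notation AB := (alg_tensor i j A setT).
Hypotheses (genX : sa_generating A X) (genY : sa_generating AB Y).
Context (n : nat) (b : 'I_n -> B).
Hypothesis orth : forall s t : 'I_n, vn_tau (vn_star (b t) * b s) = (s == t)%:R.
Hypothesis span : forall x, x = \sum_s vn_tau (vn_star (b s) * x) *: b s.
Context (m : nat) (e f : 'I_m -> B).
Hypothesis ef1 : \sum_s e s * f s = 1.
Hypothesis ef_swap : forall (V : lmodType R[i]) (F : B -> B -> V) y, bilin F ->
  \sum_s F (y * e s) (f s) = \sum_s F (e s) (f s * y).
Hypothesis ef_star : forall (V : lmodType R[i]) (F : B -> B -> V), bilin F ->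
  \sum_s F (vn_star (e s)) (vn_star (f s)) = \sum_s F (e s) (f s).
Local Notation HM := (env_L2 EM).
Local Notation H := (env_L2 EMB).
Local Notation TM := (env_tensor EM).
Local Notation T := (env_tensor EMB).
Local Notation hatM := (@l2_hat R _ HM).
Local Notation hat := (@l2_hat R _ H).
Local Notation oM := (env_one EM).
Local Notation o := (env_one EMB).
Local Notation nm := hnorm.
Local Notation HA := (@env_L2_sub R M EM A).
Local Notation H0 := (@env_L2_sub R MB EMB AB).
Local Notation p := (cproj EMB j e f).
Local Notation U := (@emb R M MB i EM EMB A).
Local Notation Uadj := (@emb_adj R M MB i EM EMB A).

Let hi : star_hom i := tensor_inl ht.
Let hj : star_hom j := tensor_inr ht.
Let hAm : submodule A := subalg_submodule hA.
Let hAB : unital_star_subalgebra AB := alg_tensor_subalg ht hA (@setT_subalg R B).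
Let hABm : submodule AB := subalg_submodule hAB.
Let iAB a : A a -> AB (i a).
Proof.
by move=> Aa; rewrite -[i a]mulr1 -(star_hom1 hj); exact: alg_tensor_elem.
Qed.
Let A1 : A 1. Proof. by case: hA. Qed.
Let AM x y : A x -> A y -> A (x * y). Proof. by case: hA => _ _ + _; apply. Qed.
Let jAB c : AB (j c).
Proof. by rewrite -[j c]mul1r -(star_hom1 hi); exact: alg_tensor_elem. Qed.

Lemma coord_exists z : AB z -> exists c : {ffun 'I_n -> M},
  (forall s, A (c s)) /\ z = \sum_s i (c s) * j (b s).
Proof.
move: z; apply: alg_tensor_ind => [|a x Aa _].
  split; first exists 0.
    split=> [s|]; first by rewrite ffunE; case: hAm.
    by rewrite big1 // => s _; rewrite ffunE (lin0 (star_hom_lin hi)) mul0r.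
  move=> k _ _ [c [Ac ->]] [d [Ad ->]]; exists (k *: c + d); split=> [s|].
    by rewrite !ffunE; apply: (proj2 hAm).
  rewrite scaler_sumr -big_split /=; apply: eq_bigr => s _.
  by rewrite !ffunE (star_hom_lin hi) mulrDl scalerAl.
exists [ffun s => vn_tau (vn_star (b s) * x) *: a]; split=> [s|].
  by rewrite ffunE; exact: (submoduleZ hAm).
rewrite {1}(span x) (lin_sum (star_hom_lin hj)) mulr_sumr; apply: eq_bigr => s _.
by rewrite ffunE (linZ (star_hom_lin hj)) (linZ (star_hom_lin hi)) -scalerAr -scalerAl.
Qed.

(** Orthonormality of the b_s in B and multiplicativity of the trace. Coordinates over the basis are
    thereby unique and bounded in the 2-norm. *)
Lemma coord_norm (c : 'I_n -> M) :
  norm2 (\sum_s i (c s) * j (b s)) ^+ 2 = \sum_s norm2 (c s) ^+ 2.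
Proof.
apply: complexI; rewrite (ipnormKC tau_form_inner_product) rmorph_sum /=.
rewrite /tau_form star_sum mulr_suml tau_sum; apply: eq_bigr => t _.
rewrite (ipnormKC tau_form_inner_product) mulr_sumr tau_sum (bigD1 t) //=.
have h s : vn_tau (vn_star (i (c t) * j (b t)) * (i (c s) * j (b s))) =
    vn_tau (vn_star (c t) * c s) * (s == t)%:R.
  rewrite starM -(star_hom_star hi) -(star_hom_star hj) -(tensorC ht) -mulrA.
  rewrite [X in _ * X]mulrA -(tensorC ht) -mulrA -(star_homM hj) mulrA.
  by rewrite -(star_homM hi) (tensor_tau ht) orth.
rewrite h eqxx mulr1 big1 ?addr0 // => s st.
by rewrite h (negbTE st) mulr0.
Qed.

Definition coord (z : MB) : {ffun 'I_n -> M} :=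
  xget (0 : {ffun 'I_n -> M}) [set c : {ffun 'I_n -> M} |
    (forall s, A (c s)) /\ z = \sum_s i (c s) * j (b s)].

Lemma coordP z : AB z -> (forall s, A (coord z s)) /\
  z = \sum_s i (coord z s) * j (b s).
Proof.
move=> /coord_exists hz.
exact: (@xgetPex _ 0 [set c : {ffun 'I_n -> M} |
  (forall s, A (c s)) /\ z = \sum_s i (c s) * j (b s)] hz).
Qed.

Lemma coord_unique z (c : {ffun 'I_n -> M}) : (forall s, A (c s)) ->
  z = \sum_s i (c s) * j (b s) -> coord z = c.
Proof.
move=> Ac zc; have ABz : AB z.
  by rewrite zc; apply: (submodule_sum hABm) => s; exact: alg_tensor_elem.
have [Ad zd] := coordP ABz.
have : \sum_s i (coord z s - c s) * j (b s) = 0.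
  under eq_bigr do rewrite (linB (star_hom_lin hi)) mulrBl.
  by rewrite sumrB -zd -zc subrr.
move=> h0; have := coord_norm (fun s => coord z s - c s); rewrite h0.
rewrite /norm2 (ipnorm0 tau_form_inner_product) expr0n /= => /esym/eqP.
rewrite psumr_eq0 => [/allP h|s _]; last exact: sqr_ge0.
apply/ffunP => s; apply/eqP; rewrite -subr_eq0; apply/eqP/tau_starM_eq0.
rewrite -[LHS](ipnormKC tau_form_inner_product).
by have := h s (mem_index_enum s); rewrite sqrf_eq0 /= => /eqP ->; rewrite expr0n.
Qed.

Lemma coordL (k : R[i]) z w : AB z -> AB w -> coord (k *: z + w) = k *: coord z + coord w.
Proof.
move=> /coordP[Az ez] /coordP[Aw ew]; apply: coord_unique => [s|].
  by rewrite !ffunE; apply: (proj2 hAm).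
rewrite {1}ez {1}ew scaler_sumr -big_split /=; apply: eq_bigr => s _.
by rewrite !ffunE (star_hom_lin hi) mulrDl scalerAl.
Qed.

Lemma coord_elem a x : A a ->
  coord (i a * j x) = [ffun s => vn_tau (vn_star (b s) * x) *: a].
Proof.
move=> Aa; apply: coord_unique => [s|].
  by rewrite ffunE; exact: (submoduleZ hAm).
rewrite {1}(span x) (lin_sum (star_hom_lin hj)) mulr_sumr; apply: eq_bigr => s _.
by rewrite ffunE (linZ (star_hom_lin hj)) (linZ (star_hom_lin hi)) -scalerAr -scalerAl.
Qed.

Lemma coord_norm_le2 z s : AB z -> norm2 (coord z s) <= norm2 z.
Proof.
move=> /coordP[_ ez]; rewrite -(@ler_pXn2r _ 2) ?nnegrE ?ipnorm_ge0 //.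
rewrite {2}ez coord_norm (bigD1 s) //= lerDl sumr_ge0 // => t _.
exact: sqr_ge0.
Qed.

Lemma cproj_sub_range : env_sub (range j) p.
Proof.
by apply: cproj_sub => [|c]; [exact: range_star_hom_subalg ht|exists c].
Qed.

Lemma cproj_comm x y : T (i x) (i y) * p = p * T (i x) (i y).
Proof.
rewrite /cproj mulr_sumr mulr_suml; apply: eq_bigr => s _.
by rewrite !tensM !(tensorC ht).
Qed.

Lemma cproj_AB : env_sub AB p.
Proof. by apply: cproj_sub. Qed.

(* a (x) b |-> delta a (x) b z, where z = p (1 (x) 1) is B-central. *)
Definition tder (delta : M -> HM) : MB -> H := fun z =>
  \sum_s l2_act (T (j (b s)) 1 * p) (U (delta (coord z s))).

(** Recombining x from its coordinates removes the basis from the formula. *)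
Lemma tder_elem delta a x : derivation A delta -> A a ->
  tder delta (i a * j x) = l2_act (T (j x) 1 * p) (U (delta a)).
Proof.
move=> hd Aa; rewrite /tder coord_elem //.
have h s : l2_act (T (j (b s)) 1 * p) (U (delta ([ffun s => vn_tau (vn_star (b s) * x) *: a] s))) =
    l2_act ((T (j (vn_tau (vn_star (b s) * x) *: b s)) 1) * p) (U (delta a)).
  rewrite ffunE (derivationZ hA _ hd Aa) (linZ (emb_lin ht EMB hA)).
  rewrite (linZ (act_lin _)) -actZ.
  by rewrite (linZ (star_hom_lin hj)) (linZ (tens_linl EMB 1)) scalerAl.
rewrite (eq_bigr _ (fun s _ => h s)) -act_sum -mulr_suml.
by rewrite -(lin_sum (tens_linl EMB 1)) -(lin_sum (star_hom_lin hj)) -span.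
Qed.

Lemma tderL delta (k : R[i]) z w : derivation A delta -> AB z -> AB w ->
  tder delta (k *: z + w) = k *: tder delta z + tder delta w.
Proof.
move=> hd hz hw; rewrite /tder coordL // scaler_sumr -big_split; apply: eq_bigr => s _.
have [Az _] := coordP hz; have [Aw _] := coordP hw.
by rewrite !ffunE (derivationL _ hd) // (emb_lin ht EMB hA) act_lin.
Qed.

Lemma tder_values delta z : H0 (tder delta z).
Proof.
have hC := env_sub_subalg EMB hAB.
apply: (submodule_sum (@H0_submodule R _ H _ hC)) => s; apply: H0_act => //.
  have [_ _ hm _] := hC; apply: hm; last exact: cproj_AB.
  by apply: env_sub_elem => //; case: hAB.
exact: (emb_H0 ht hA hAB iAB).
Qed.

Lemma tder_derivation delta : derivation A delta -> derivation AB (tder delta).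
Proof.
move=> hd; have [_ _ ABM _] := hAB; split.
- by move=> z _; exact: tder_values.
- by move=> k z w hz hw; exact: tderL.
move=> z w hz hw; rewrite /bimod_act.
(* Leibniz' rule is tested on elementary tensors, first in z and then, by [S'], in w. *)
pose S w := [set z | AB z /\ tder delta (z * w) =
  l2_act (T z 1) (tder delta w) + l2_act (T 1 w) (tder delta z)].
suff: S w z by case.
have lt0 : tder delta 0 = 0.
  apply: (addrI (tder delta 0)); rewrite addr0.
  have AB0 : AB 0 by case: hABm.
  by have := tderL 1 hd AB0 AB0; rewrite !scale1r addr0.
move: z hz; apply: alg_tensor_ind => [|a x Aa _].
  split; first split.
  - by case: hABm.
  - by rewrite mul0r lt0 (lin0 (tens_linl EMB 1)) act0 (lin0 (act_lin _)) addr0.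
  move=> k z z' [hz ez] [hz' ez']; split; first exact: (proj2 hABm).
  rewrite mulrDl -scalerAl (tderL _ hd (ABM _ _ hz hw) (ABM _ _ hz' hw)) ez ez'.
  rewrite (tderL _ hd hz hz') (tens_linl EMB 1).
  by rewrite actL act_lin scalerDr addrACA.
split; first exact: alg_tensor_elem.
have hax : AB (i a * j x) by exact: alg_tensor_elem.
pose S' := [set w | AB w /\ tder delta (i a * j x * w) =
  l2_act (T (i a * j x) 1) (tder delta w) + l2_act (T 1 w) (tder delta (i a * j x))].
suff: S' w by case.
move: w hw; apply: alg_tensor_ind => [|a' x' Aa' _].
  split; first split.
  - by case: hABm.
  - by rewrite mulr0 lt0 (lin0 (tens_linr EMB 1)) act0 (lin0 (act_lin _)) addr0.
  move=> k z z' [hz ez] [hz' ez']; split; first exact: (proj2 hABm).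
  rewrite mulrDr -scalerAr (tderL _ hd (ABM _ _ hax hz) (ABM _ _ hax hz')) ez ez'.
  rewrite (tderL _ hd hz hz') (tens_linr EMB 1).
  by rewrite actL act_lin scalerDr addrACA.
split; first exact: alg_tensor_elem.
have -> : i a * j x * (i a' * j x') = i (a * a') * j (x * x').
  rewrite (star_homM hi) (star_homM hj) -!mulrA; congr (_ * _).
  by rewrite !mulrA (tensorC ht).
rewrite !(tder_elem _ hd (AM Aa Aa')) !(tder_elem _ hd Aa) !(tder_elem _ hd Aa').
rewrite (derivationM hd Aa Aa') (linD (emb_lin ht EMB hA)).
rewrite (emb_act ht EMB hA Aa A1 (derivation_values hd Aa')).
rewrite (emb_act ht EMB hA A1 Aa' (derivation_values hd Aa)).
rewrite (linD (act_lin _)) -!actM (star_hom1 hi); congr (l2_act _ _ + l2_act _ _).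
  have c1 : p * T (i a) 1 = T (i a) 1 * p.
    by have := cproj_comm a 1; rewrite (star_hom1 hi).
  rewrite -[LHS]mulrA c1 [LHS]mulrA [RHS]mulrA !tensM -(tensorC ht) (star_homM hj) !mulr1.
  by rewrite mulrA.
have c2 : p * T 1 (i a') = T 1 (i a') * p.
  by have := cproj_comm 1 a'; rewrite (star_hom1 hi).
have c3 : T (j (x * x')) 1 * T 1 (i a') = T (j x) (i a') * T (j x') 1.
  by rewrite !tensM !mulr1 !mul1r (star_homM hj).
(* Centrality of p moves x' from the left action to the right action, where Leibniz' rule requires
   it. *)
rewrite -[LHS]mulrA c2 [LHS]mulrA c3 -[LHS]mulrA (cproj_central EMB hj ef_swap x').
rewrite [LHS]mulrA [RHS]mulrA !tensM.
by rewrite !mulr1 !mul1r (tensorC ht).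
Qed.

(** Each summand of the pairing of [tder delta z] with 1 (x) 1 has the form <U (delta z_s), q s>,
    with z_s a coordinate of z and q s in B (x) B°. By [emb_dot_slice] it is a constant times <delta
    z_s, 1 (x) 1>. *)
Lemma tder_Der11 delta : Der11 A delta -> Der11 AB (tder delta).
Proof.
move=> [hd /(dom_adjointP hA) [c c0 hc]]; split; first exact: tder_derivation.
apply/(dom_adjointP hAB).
pose q s := vn_star (T (j (b s)) 1 * p).
have hq s : env_sub (range j) (q s).
  have [_ _ hm hs] := env_sub_subalg EMB (range_star_hom_subalg ht).
  apply: hs; apply: hm; last exact: cproj_sub_range.
  by apply: env_sub_elem; [exists (b s)|exists 1 => //; exact: star_hom1 hj].
exists (\sum_s cabs (vn_tau (q s)) * c).
  by apply: sumr_ge0 => s _; rewrite mulr_ge0 ?cabs_ge0.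
move=> z hz; have [Ac _] := coordP hz.
rewrite /tder hdot_suml; apply: le_trans (cabs_sum _ _ _) _; rewrite mulr_suml.
apply: ler_sum => s _; rewrite act_dot l2_act_hat mulr1 -/(q s).
rewrite (emb_dot_slice ht hA (derivation_values hd (Ac s)) (hq s)) cabsM cabs_conj.
rewrite -mulrA ler_wpM2l ?cabs_ge0 //; apply: le_trans (hc _ (Ac s)) _.
by rewrite ler_wpM2l // coord_norm_le2.
Qed.

Lemma tderB delta delta' : tder (delta - delta') = tder delta - tder delta'.
Proof.
apply/funext => z; change (tder (delta - delta') z = tder delta z - tder delta' z).
rewrite /tder -sumrB; apply: eq_bigr => s _.
change ((delta - delta') (coord z s)) with (delta (coord z s) - delta' (coord z s)).
by rewrite (linB (emb_lin ht EMB hA)) (linB (act_lin _)).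
Qed.

Lemma sub_gen (N : tracialVNA R) (D : set N) (F : {fset N}) (x : F) :
  sa_generating D F -> D (val x).
Proof. by case=> _ ->; apply: sub_star_algebra_gen; exact: valP. Qed.

Lemma tder_closure delta : Der11_closure A X delta -> Der11_closure AB Y (tder delta).
Proof.
move=> /Der11_closureP[hd cl]; apply/Der11_closureP; split; first exact: tder_derivation.
have [k k0 hk] : exists2 k : R, 0 <= k & forall d, derivation A d ->
    ipnorm (@sum_dot _ _ _) (phi Y (tder d)) <= k * ipnorm (@sum_dot _ _ _) (phi X d).
  apply: sum_norm_bound => [d|y]; first exact: ipnorm_ge0.
  have [Ac _] := coordP (sub_gen y genY).
  have /choice[c hc] s : exists c : R, 0 <= c /\ forall d, derivation A d ->
      nm (l2_act (T (j (b s)) 1 * p) (U (d (coord (val y) s)))) <=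
      c * ipnorm (@sum_dot _ _ _) (phi X d).
    have [c c0 hc] := derivation_bound_gen EM hA genX (Ac s).
    have [l l0 hl] := act_lipschitz (L := H) (T (j (b s)) 1 * p).
    exists (l * c); split=> [|d dd]; first exact: mulr_ge0.
    apply: le_trans (hl _) _; rewrite -mulrA ler_wpM2l //.
    exact: le_trans (emb_norm ht EMB hA _) (hc _ dd).
  exists (\sum_s c s) => [|d dd]; first by apply: sumr_ge0 => s _; case: (hc s).
  rewrite ffunE; apply: le_trans (hnorm_sum _ _) _; rewrite mulr_suml.
  by apply: ler_sum => s _; case: (hc s) => _; apply.
move=> r r0; have k1 : 0 < k + 1 by rewrite ltr_wpDl.
have [d' hd' hlt] := cl _ (divr_gt0 r0 k1); exists (tder d'); first exact: tder_Der11.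
rewrite -tderB; apply: le_mul_lt hlt => //; first exact: ipnorm_ge0.
by apply: hk; apply: (submoduleB (derivation_submodule EM hA)) => //; case: hd'.
Qed.

(* (id (x) tau (x) tau°) o delta: the slice map is the adjoint of emb. *)
Definition slice (delta : MB -> H) : M -> HM := fun a => Uadj (delta (i a)).

Lemma slice_derivation delta : derivation AB delta -> derivation A (slice delta).
Proof.
move=> hd; split.
- by move=> a _; case: (emb_adjP ht EM hA (delta (i a))).
- move=> k x y Ax Ay; rewrite /slice (star_hom_lin hi) (derivationL _ hd (iAB Ax) (iAB Ay)).
  exact: (emb_adj_lin ht EM hA).
- move=> x y Ax Ay; rewrite /slice (star_homM hi) (derivationM hd (iAB Ax) (iAB Ay)).
  rewrite (linD (emb_adj_lin ht EM hA)).
  have := emb_adj_act ht EM hA (delta (i y)) Ax A1; rewrite (star_hom1 hi) => ->.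
  by have := emb_adj_act ht EM hA (delta (i x)) A1 Ay; rewrite (star_hom1 hi) => ->.
Qed.

Lemma sliceB delta delta' : slice (delta - delta') = slice delta - slice delta'.
Proof.
apply/funext => a; change (Uadj (delta (i a) - delta' (i a)) =
  Uadj (delta (i a)) - Uadj (delta' (i a))).
exact: (linB (emb_adj_lin ht EM hA)).
Qed.

(** U fixes the trace vector, so the pairing of the slice at a with 1 (x) 1 is that of delta at i a;
    and i preserves the 2-norm. *)
Lemma slice_Der11 delta : Der11 AB delta -> Der11 A (slice delta).
Proof.
move=> [hd /(dom_adjointP hAB) [c c0 hc]]; split; first exact: slice_derivation.
apply/(dom_adjointP hA); exists c => // a Aa.
have Ho : HA oM := @H0_one R _ HM _ (env_sub_subalg EM hA).
have [_ h] := emb_adjP ht EM hA (delta (i a)).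
rewrite h // (emb_one ht EM EMB hA); apply: le_trans (hc _ (iAB Aa)) _.
rewrite /norm2 /ipnorm /tau_form -(star_hom_star hi) -(star_homM hi) (tensor_taul ht).
exact: lexx.
Qed.

Lemma slice_closure delta : Der11_closure AB Y delta -> Der11_closure A X (slice delta).
Proof.
move=> /Der11_closureP[hd cl]; apply/Der11_closureP; split; first exact: slice_derivation.
have [k k0 hk] : exists2 k : R, 0 <= k & forall d, derivation AB d ->
    ipnorm (@sum_dot _ _ _) (phi X (slice d)) <= k * ipnorm (@sum_dot _ _ _) (phi Y d).
  apply: sum_norm_bound => [d|x]; first exact: ipnorm_ge0.
  have [c c0 hc] := derivation_bound_gen EMB hAB genY (iAB (sub_gen x genX)).
  exists c => // d dd; rewrite ffunE.
  exact: le_trans (emb_adj_norm ht EM hA _) (hc _ dd).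
move=> r r0; have k1 : 0 < k + 1 by rewrite ltr_wpDl.
have [d' hd' hlt] := cl _ (divr_gt0 r0 k1); exists (slice d'); first exact: slice_Der11.
rewrite -sliceB; apply: le_mul_lt hlt => //; first exact: ipnorm_ge0.
by apply: hk; apply: (submoduleB (derivation_submodule EMB hAB)) => //; case: hd'.
Qed.

(** Since i a and j c commute, Leibniz' rule expands the value at their product in two ways;
    vanishing on B leaves one term in each. *)
Lemma reduced_part_central delta a : derivation AB delta -> A a ->
  central (E := EMB) j (reduced_part j e f delta (i a)).
Proof.
move=> hd Aa c; set d' := reduced_part j e f delta.
have hd' : derivation AB d'.
  apply: (submoduleB (derivation_submodule EMB hAB)) => //.
  by apply: inner_derivation => //; exact: inner_part_H0.
have d0 x : d' (j x) = 0 by exact: (reduced_part_zero hj jAB ef1 ef_swap).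
have := derivationM hd' (jAB c) (iAB Aa); have := derivationM hd' (iAB Aa) (jAB c).
rewrite (tensorC ht) d0 !(lin0 (act_lin _)) add0r addr0 => -> //.
Qed.

Local Notation DX := (@Der11_closure R M EM A X).
Local Notation DY := (@Der11_closure R MB EMB AB Y).
Local Notation gamma := (\sum_s vn_tau (e s) * vn_tau (f s)).

(** The candidates for [stein_dim_on_reduced] are p U (P x), with P x the projection of the trace
    vector at x onto the closure for A: [tder_closure] puts them in the closure, and [slice_closure]
    makes the remainders orthogonal. *)
Lemma stein_dim_on_tensor :
  stein_dim_on EMB AB Y = 1 - complex.Re gamma + complex.Re gamma * stein_dim_on EM A X.
Proof.
have sX := image_submodule (Der11_closure_submodule EM hA X) (@phi_lin R M EM X).
have cX := Der11_closure_complete hA genX (E := EM).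
pose P x := sum_proj (@phi R M EM X @` DX) (sum_basis oM x).
(* d x is a derivation in the closure for A whose values on X are the projection P x. *)
have /choice[d hd] x : exists d, DX d /\ phi X d = P x.
  by have [[d Dd e1] _] := sum_projP sX cX (sum_basis oM x); exists d.
have dd x : derivation A (d x) by case: (hd x) => -[].
pose xs (x : X) := i (val x).
have xsAB x : AB (xs x) by apply: iAB; exact: sub_gen.
have xs_star x : exists x', vn_star (xs x) = xs x'.
  have [Xs _] := genX; exists [` Xs _ (valP x)]%fset.
  by rewrite /xs -(star_hom_star hi).
have AB_gen : AB = star_algebra_gen (range xs `|` range j).
  have eT : [set: B] = star_algebra_gen setT.
    by apply/seteqP; split=> // x _; exact: sub_star_algebra_gen.
  have [_ eA] := genX; rewrite {1}eA {1}eT (alg_tensor_gen _ _ ht); congr star_algebra_gen.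
  congr (_ `|` _); apply/seteqP; split=> [_ [x Xx <-]|_ [x _ <-]].
    by exists [` Xx]%fset.
  by exists (val x) => //=; exact: valP.
have tj x c : tder (d x) (j c) = 0.
  rewrite -[j c]mul1r -(star_hom1 hi) tder_elem // (derivation1 hA) //.
  by rewrite (lin0 (emb_lin ht EMB hA)) (lin0 (act_lin _)).
have ti x a : A a -> tder (d x) (i a) = l2_act p (U (d x a)).
  by move=> Aa; rewrite -[i a]mulr1 -(star_hom1 hj) tder_elem // (star_hom1 hj) tens11 mul1r.
have [w wD] : exists w : X -> {ffun option X -> H},
    forall x, w x = split_der j e f xs (tder (d x)).
  by exists (fun x => split_der j e f xs (tder (d x))).
have wE x u : w x u = if u is Some z then l2_act p (U (P x z)) else 0.
  rewrite wD ffunE; case: u => [z|]; last exact: inner_part_zero.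
  change (tder (d x) (xs z) - inner (inner_part j e f (tder (d x))) (xs z) = l2_act p (U (P x z))).
  rewrite inner_part_zero // /inner (lin0 (act_lin _)) subr0.
  rewrite (ti x (val z) (sub_gen z genX)).
  by have [_ <-] := hd x; rewrite ffunE.
(* gamma is tau p, which is real because p is self-adjoint. *)
have gr : gamma = (complex.Re gamma)%:C.
  have h : (gamma)^* = gamma.
    by rewrite -(cproj_tau EMB (tensor_taur ht)) -tau_star (cproj_star EMB hj ef_star).
  by rewrite RRe_real //; apply/CrealP.
rewrite (stein_dim_on_reduced hj (tensor_taur ht) hAB jAB ef1 ef_swap ef_star
  xsAB xs_star AB_gen genY (w := w)).
- congr (_ + _); rewrite /stein_dim_on vn_dimE -ReRM -gr; congr complex.Re.
  rewrite mulr_sumr; apply: eq_bigr => x _; rewrite wE.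
  have HP z : HA (P x z).
    by have [_ <-] := hd x; rewrite ffunE; apply: (derivation_values (dd x)); exact: sub_gen.
  (* p is moved to the trace vector, and slicing gives tau p times the diagonal entry of P x. *)
  rewrite (cproj_dot hj ef_star) l2_act_hat mulr1.
  rewrite (emb_dot_slice ht hA (HP x) cproj_sub_range).
  by rewrite (cproj_tau EMB (tensor_taur ht)) {1}gr conj_real -gr.
- by move=> x; rewrite wD; exists (tder (d x)) => //; apply: tder_closure; case: (hd x).
move=> x dl Dl; have [hdl _] := Dl.
pose dl' := reduced_part j e f dl.
have Dl' : DY dl'.
  apply: (submoduleB (Der11_closure_submodule EMB hAB Y)) => //.
  by apply: inner_Der11_closure => //; exact: inner_part_H0.
have := slice_closure Dl' => Dsl.
have [_ ho] := sum_projP sX cX (sum_basis oM x).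
(* The pairing to be shown zero equals, coordinate by coordinate, that of the trace vector at x
   minus P x with the slice of [dl']. The values of [dl'] on A are fixed by p, so p drops out, and
   the adjoint of U brings the pairing back to A. *)
have := ho (phi X (slice dl')) (ex_intro2 _ _ _ Dsl erefl); rewrite -/(P x) => <-.
rewrite /sum_dot sum_option !ffunE /= wE subr0 hdot0l add0r; apply: eq_bigr => z _.
rewrite !ffunE wE -/dl'.
have Az : A (val z) by exact: sub_gen.
have pdl : l2_act p (dl' (xs z)) = dl' (xs z).
  by apply: (cproj_fix hj ef1); exact: reduced_part_central.
have HP : HA (P x z).
  by have [_ <-] := hd x; rewrite ffunE; exact: (derivation_values (dd x)).
have Ho : HA oM := @H0_one R _ HM _ (env_sub_subalg EM hA).
have HB : HA (if z == x then oM else 0).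
  by case: ifP => // _; case: (@H0_submodule R _ HM _ (env_sub_subalg EM hA)).
have eo : (if Some z == Some x then o else 0) = U (if z == x then oM else 0).
  rewrite (inj_eq (@Some_inj _)); case: ifP => _; first by rewrite (emb_one ht EM EMB hA).
  by rewrite (lin0 (emb_lin ht EMB hA)).
rewrite eo hdotBl (cproj_dot hj ef_star) pdl -hdotBl -(linB (emb_lin ht EMB hA)).
have [_ hadj] := emb_adjP ht EM hA (dl' (xs z)).
rewrite hdot_conj -hadj; last exact: (submoduleB (@H0_submodule R _ HM _ (env_sub_subalg EM hA))).
by rewrite -hdot_conj.
Qed.

End TensorDerivation.

(** The splitting of B along itself, with j the identity and no further generators: only the
    coordinate [None] contributes. *)
Lemma stein_dim_on_finite (R : realType) (B : tracialVNA R) (E : enveloping B)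
    (X : {fset B}) (m : nat) (e f : 'I_m -> B) :
  \sum_s e s * f s = 1 ->
  (forall (V : lmodType R[i]) (F : B -> B -> V) y, bilin F ->
    \sum_s F (y * e s) (f s) = \sum_s F (e s) (f s * y)) ->
  (forall (V : lmodType R[i]) (F : B -> B -> V), bilin F ->
    \sum_s F (vn_star (e s)) (vn_star (f s)) = \sum_s F (e s) (f s)) ->
  sa_generating setT X ->
  stein_dim_on E setT X = 1 - complex.Re (\sum_s vn_tau (e s) * vn_tau (f s)).
Proof.
move=> ef1 ef_swap ef_star genX.
have hid : star_hom (@id B) by split.
pose xs (z : 'I_0) : B := 0.
have gen : [set: B] = star_algebra_gen (range xs `|` range id).
  by apply/seteqP; split=> // x _; apply: sub_star_algebra_gen; right; exists x.
rewrite (stein_dim_on_reduced hid (fun=> erefl) (@setT_subalg R B) (fun=> Logic.I)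
  ef1 ef_swap ef_star (xs := xs) (w := fun=> 0) _ _ gen genX) //.
- by rewrite big_ord0 addr0.
- by case.
- by case.
- by case.
Qed.

Theorem corollary2p6 (R : realType)
    (M B MB : tracialVNA R) (i : M -> MB) (j : B -> MB)
    (tensMB : is_vn_tensor i j)
    (finB : finite_dimensional B)
    (EM : enveloping M) (EB : enveloping B) (EMB : enveloping MB)
    (A : set M) (subA : unital_star_subalgebra A)
    (fgA : finitely_generated A) :
  stein_dim EMB (alg_tensor i j A setT) =
    stein_dim EM A + stein_dim EB setT - stein_dim EM A * stein_dim EB setT.
Proof.
have fgB := finite_dimensional_generated finB.
have [X genX ->] := stein_dim_witness EM fgA.
have [Z genZ ->] := stein_dim_witness EB fgB.
have [Y genY ->] := stein_dim_witness EMB (alg_tensor_finitely_generated tensMB fgA fgB).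
have [n [b [orth span]]] := orthonormal_basis finB.
have [m [e [f [ef1 ef_swap ef_star]]]] := separability_idempotent finB.
rewrite (stein_dim_on_tensor tensMB EM EMB subA genX genY orth span ef1 ef_swap ef_star).
rewrite (stein_dim_on_finite EB ef1 ef_swap ef_star genZ).
(* With g = tau p and s the value for A: 1 - g + g s = s + (1 - g) - s (1 - g). *)
by ring.
Qed.
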